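(* Let $D_\zeta=\{\zeta=xe_1+ye_2:\|\zeta\|<1\}$ be the unit disk in the biharmonic plane $\mu$ and $D_z=\{z\in\mathbb{C}:|z|<1\}$. Let $u_1,u_4:\partial D_\zeta\to\mathbb{R}$ be functions satisfying the Dini condition $$\int_0^1\frac{\omega(u_l,\eta)}{\eta}\,d\eta<\infty,\qquad l\in\{1,4\},$$ and put $\widehat u_l(x+iy)=u_l(xe_1+ye_2)$ for $x+iy\in\partial D_z$. Then the general solution of the (1-4)-problem for $D_\zeta$ with data $u_1,u_4$ is expressed in the form $$\Phi(\zeta)=S_{D_\zeta}[u_1](\zeta)\,e_1+S_{D_\zeta}[u_4](\zeta)\,ie_2+\bigl((b_1+ib_2)\zeta+b\bigr)(e_1+ie_2)+a_1\,ie_1+a_2\,e_2,\qquad\zeta\in D_\zeta,$$ (with boundary values given by continuous extension), where $$b_1=-\frac1{2\pi}\,\mathrm{Im}\int_{\partial D_z}\frac{\widehat u_1(t)-\widehat u_4(t)}{t^2}\,dt,\qquad b_2=-\frac1{2\pi}\,\mathrm{Re}\int_{\partial D_z}\frac{\widehat u_1(t)-\widehat u_4(t)}{t^2}\,dt,$$ $$b=-\frac1{2\pi}\,\mathrm{Im}\int_{\partial D_z}\frac{\widehat u_1(t)-\widehat u_4(t)}{t^3}\,dt,$$ and $a_1,a_2$ are any real constants.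
   Context: Let $\mathbb{B}$ be the commutative associative algebra over $\mathbb{C}$ with basis $\{e_1,e_2\}$, where $e_1=1$ is the unit and $e_2^2=e_1+2ie_2$ ($i$ is the imaginary complex unit, acting as a scalar). The norm is $\|z_1e_1+z_2e_2\|=\sqrt{|z_1|^2+|z_2|^2}$, $z_1,z_2\in\mathbb{C}$. The biharmonic plane is $\mu=\{xe_1+ye_2:x,y\in\mathbb{R}\}$. Any function $\Phi$ with values in $\mathbb{B}$ is written $\Phi=U_1e_1+U_2\,ie_1+U_3e_2+U_4\,ie_2$ with real-valued components $U_1,\dots,U_4$ depending on $(x,y)$, where $\zeta=xe_1+ye_2$. A function $\Phi:D_\zeta\to\mathbb{B}$ is monogenic in $D_\zeta$ if for every $\zeta\in D_\zeta$ the limit $\Phi'(\zeta)=\lim_{h\to0,\,h\in\mu}(\Phi(\zeta+h)-\Phi(\zeta))h^{-1}$ exists. (1-4)-problem for $D_\zeta$: given $u_1,u_4:\partial D_\zeta\to\mathbb{R}$, find a continuous function $\Phi:\overline{D_\zeta}\to\mathbb{B}$, monogenic in $D_\zeta$, with $U_1(x,y)=u_1(\zeta)$ and $U_4(x,y)=u_4(\zeta)$ for all $\zeta=xe_1+ye_2\in\partial D_\zeta$. ''General solution'' means that the set of all solutions is exactly the family given by the formula as the constants $a_1,a_2$ range over $\mathbb{R}$. For $u:\partial D_\zeta\to\mathbb{R}$ and $\varepsilon>0$, the modulus of continuity is $\omega(u,\varepsilon)=\sup\{|u(\zeta_1)-u(\zeta_2)|:\zeta_1,\zeta_2\in\partial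 D_\zeta,\ \|\zeta_1-\zeta_2\|\le\varepsilon\}$, and $$S_{D_\zeta}[u](\zeta)=\frac1{2\pi i}\int_{\partial D_\zeta}u(\tau)(\tau+\zeta)(\tau-\zeta)^{-1}\tau^{-1}\,d\tau,\qquad\zeta\in D_\zeta,$$ where for $\tau=\tau_1e_1+\tau_2e_2$ with $\tau_1,\tau_2\in\mathbb{R}$ one has $d\tau=e_1\,d\tau_1+e_2\,d\tau_2$. The circles $\partial D_\zeta$ and $\partial D_z$ are oriented counterclockwise. *)

(* Defs.v *)
From Stdlib Require Import Reals Lra.
From Coquelicot Require Import Coquelicot.
Local Open Scope R_scope.

(** The element z1 e1 + z2 e2 is the pair (z1, z2).  Linear structure, topology
    and norm are those of the product C * C; see [B_norm]. *)
Definition B : NormedModule C_AbsRing :=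
  prod_NormedModule C_AbsRing C_NormedModule C_NormedModule.

Definition e1 : B := (RtoC 1, RtoC 0).
Definition e2 : B := (RtoC 0, RtoC 1).

(** Bilinear extension of [e1 * x = x] and [e2 * e2 = e1 + 2 i e2]. *)
Definition Bmul (a b : B) : B :=
  ((fst a * fst b + snd a * snd b)%C,
   (fst a * snd b + snd a * fst b + 2 * Ci * (snd a * snd b))%C).

(** z1 e1 + z2 e2 is invertible if and only if z1 + i z2 <> 0, see [Binv_spec]
    and [Binv_domain]; on noninvertible elements the value of [Binv] is
    irrelevant. *)
Definition Binv (a : B) : B :=
  let n := ((fst a + Ci * snd a) * (fst a + Ci * snd a))%C in
  (((fst a + 2 * Ci * snd a) / n)%C, (- snd a / n)%C).

Declare Scope B_scope.
Delimit Scope B_scope with B.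
Bind Scope B_scope with B.
Notation "x + y" := (@plus B x y) : B_scope.
Notation "x - y" := (@minus B x y) : B_scope.
Notation "- x" := (@opp B x) : B_scope.
Notation "x * y" := (Bmul x y) : B_scope.
Notation "/ x" := (Binv x) : B_scope.
Notation "c *: x" := (@scal C_AbsRing B c%C x)
  (at level 40, left associativity) : B_scope.

Lemma B_norm (z1 z2 : C) :
  @norm C_AbsRing B (z1, z2) = sqrt (Cmod z1 ^ 2 + Cmod z2 ^ 2).
Proof. reflexivity. Qed.

Lemma B_ring : ring_theory (@zero B) e1 (@plus B) Bmul (@minus B) (@opp B) eq.
Proof.
  split; intros;
    repeat match goal with x : _ |- _ => destruct x as [[? ?] [? ?]] end;
    try reflexivity;
    apply injective_projections; apply injective_projections; cbn; ring.
Qed.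

Lemma B_scal (c : C) (a b : B) :
  Bmul (scal c a) b = scal c (Bmul a b) /\ scal c e1 = (c, RtoC 0).
Proof.
  destruct c as [? ?], a as [[? ?] [? ?]], b as [[? ?] [? ?]].
  split; apply injective_projections; apply injective_projections; cbn; ring.
Qed.

Lemma e2_square : Bmul e2 e2 = (e1 + (2 * Ci) *: e2)%B.
Proof.
  apply injective_projections; apply injective_projections; cbn; ring.
Qed.

Lemma Binv_spec (a : B) :
  (fst a + Ci * snd a)%C <> RtoC 0 -> Bmul a (Binv a) = e1.
Proof.
  destruct a as [z w]; unfold Bmul, Binv, e1; simpl fst; simpl snd; intros H.
  assert (I2 : (Ci * Ci)%C = (- (1))%C)
    by (apply injective_projections; cbn; ring).
  set (n := ((z + Ci * w) * (z + Ci * w))%C).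
  assert (En : n = (z * z + 2 * Ci * z * w - w * w)%C).
  { unfold n.
    replace ((z + Ci * w) * (z + Ci * w))%C
      with (z * z + 2 * Ci * z * w + (Ci * Ci) * (w * w))%C by ring.
    rewrite I2; ring. }
  assert (Hn : n <> RtoC 0) by (unfold n; apply Cmult_neq_0; assumption).
  apply f_equal2.
  - replace (RtoC 1) with (n / n)%C by (field; exact Hn).
    rewrite En at 3. field. exact Hn.
  - field. exact Hn.
Qed.

Lemma Binv_domain (a b : B) :
  Bmul a b = e1 -> (fst a + Ci * snd a)%C <> RtoC 0.
Proof.
  destruct a as [z w], b as [x y]; unfold Bmul, e1; simpl fst; simpl snd.
  intros H H0; injection H as H1 H2 H3 H4.
  assert (E : ((z + Ci * w) * (x + Ci * y))%C = RtoC 1).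
  { destruct z, w, x, y; apply injective_projections; cbn in *; lra. }
  rewrite H0, Cmult_0_l in E. apply RtoC_inj in E. lra.
Qed.

Definition muplane (x y : R) : B := (RtoC x *: e1 + RtoC y *: e2)%B.

Definition in_mu (zeta : B) : Prop := exists x y : R, zeta = muplane x y.

(** Functions on subsets of the plane are total functions on B of which only
    the values on the relevant subset are ever used. *)

(** The closed plane mu contains the closure, taken in B, of each of its
    subsets. *)
Definition closure (D : B -> Prop) (zeta : B) : Prop :=
  forall P : B -> Prop, locally zeta P -> exists w, P w /\ D w.

(** The boundary relative to mu, not relative to B. *)
Definition boundary (D : B -> Prop) (zeta : B) : Prop :=
  closure D zeta /\ closure (fun w => in_mu w /\ ~ D w) zeta.

(** Every nonzero element of mu is invertible. *)
Definition monogenic (D : B -> Prop) (Phi : B -> B) : Prop :=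
  forall zeta, D zeta -> exists dPhi : B,
    filterlim (fun h : B => ((Phi (zeta + h) - Phi zeta) * / h)%B)
      (within (fun h => in_mu h /\ h <> zero) (locally (@zero B)))
      (locally dPhi).

(** The real components of the decomposition [B_components]. *)
Definition U1 (a : B) : R := Re (fst a).
Definition U2 (a : B) : R := Im (fst a).
Definition U3 (a : B) : R := Re (snd a).
Definition U4 (a : B) : R := Im (snd a).

Lemma B_components (a : B) :
  a = (RtoC (U1 a) *: e1 + RtoC (U2 a) *: (Ci *: e1)
       + RtoC (U3 a) *: e2 + RtoC (U4 a) *: (Ci *: e2))%B.
Proof.
  destruct a as [[? ?] [? ?]].
  apply injective_projections; apply injective_projections; cbn; ring.
Qed.

Definition problem14 (D : B -> Prop) (u1 u4 : B -> R) (Phi : B -> B) : Prop :=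
  continuous_on (closure D) Phi /\
  monogenic D Phi /\
  (forall zeta, boundary D zeta ->
     U1 (Phi zeta) = u1 zeta /\ U4 (Phi zeta) = u4 zeta).

Definition omega (D : B -> Prop) (u : B -> R) (eps : R) : Rbar :=
  Lub_Rbar (fun r => exists z1 z2 : B,
    boundary D z1 /\ boundary D z2 /\ norm (z1 - z2)%B <= eps /\
    r = Rabs (u z1 - u z2)).

(** [omega] takes values in [0, +oo] and is nondecreasing in [eps], so that
    its integral against d eta / eta over (0, 1) can be finite only if [omega]
    is finite there.  This has to be required, as [real p_infty] is 0. *)
Definition dini (D : B -> Prop) (u : B -> R) : Prop :=
  (forall eta, 0 < eta < 1 -> is_finite (omega D u eta)) /\
  ex_RInt_gen (fun eta => real (omega D u eta) / eta) (at_right 0) (at_point 1).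

Definition disk (zeta : B) : Prop := in_mu zeta /\ norm zeta < 1.

Definition CRInt (f : R -> C) (a b : R) : C :=
  @RInt C_R_CompleteNormedModule f a b.

(** Counterclockwise contour integral over |t| = 1 in the complex plane, with
    t = cos s + i sin s and dt = (- sin s + i cos s) ds. *)
Definition Ccircle_int (f : C -> C) : C :=
  CRInt (fun s => (f (cos s, sin s) * ((- sin s)%R, cos s))%C) 0 (2 * PI).

(** Its analogue in mu: tau = cos s e1 + sin s e2 and
    dtau = (- sin s e1 + cos s e2) ds. *)
Definition Bcircle_int (f : B -> B) : B :=
  let g (s : R) := (f (muplane (cos s) (sin s)) * muplane (- sin s) (cos s))%B in
  (CRInt (fun s => fst (g s)) 0 (2 * PI), CRInt (fun s => snd (g s)) 0 (2 * PI)).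

Definition S_disk (u : B -> R) (zeta : B) : B :=
  ((/ (2 * PI * Ci)) *: Bcircle_int (fun tau =>
     RtoC (u tau) *: ((tau + zeta) * / (tau - zeta) * / tau)))%B.

Definition hat (u : B -> R) (t : C) : R := u (muplane (Re t) (Im t)).

(* Main.v *)
(** With rho = e1 + i e2 one has rho^2 = 0 and B = C + C rho; write [pa] and
    [pb] for the two coordinates.  A point of mu is zeta = z - i y rho, where
    z = x + i y, and the boundary conditions say that on the circle
    Re (pa Phi) = u1 - u4 and Re (pb Phi) = u4.

    Uniqueness.  For the difference of two solutions, pa is holomorphic in the
    disk, continuous on its closure, and has zero real part on the circle, so
    it is constant; monogenicity then makes pb holomorphic, and it is constant
    for the same reason.

    Existence.  pa (S_disk u) is the Schwarz integral S of u, and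
    pb (S_disk u) = J3 + J2 / z - (1 - |z|^2) / (2 z) S', where J2 and J3 are
    the means of u t^-1 and u t^-2 over the circle |t| = 1.  Under the Dini
    condition S extends continuously to the closed disk and (1 - |z|^2) S'
    tends to 0 at the circle.  There the real part of J2 / z is cancelled by
    that of the term (b1 + i b2) z, because b1 + i b2 = - conj J2 for the
    density u1 - u4, and the real part of J3 is cancelled by b. *)
Require Import Defs.
From Stdlib Require Import Reals Lra.
From Coquelicot Require Import Coquelicot.
Local Open Scope R_scope.

(** * Complex-valued functions of a real variable *)

(** The Dini condition serves the imaginary part of the Schwarz integral: its kernel is only of size
    1/|t - z|, and for merely continuous u the real part of S has boundary limits while S itself may
    have none. All three limits at the circle (Re S -> u, S along a radius, (1 - |z|^2) S' -> 0)
    come from kernels bounded by (1 - r) / (|t - z| |t - z'|) with z, z' on one radius, once the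
    value of u at the end of that radius is subtracted; [dini_kernel] treats them together. Being
    Cauchy along radii uniformly in the angle, combined with continuity inside, already yields the
    continuous extension. The formula for the rho-coordinate of [S_disk] has poles at z = 0 that
    cancel only in the sum, so monogenicity is not read off it but obtained by differentiating under
    the integral in B. The uniqueness part rests on Goursat's theorem: in the coordinate log z it
    gives the mean value at the centre, a disk automorphism carries this to every point, and a
    holomorphic function with vanishing real part has derivative 0. *)

Notation ccont f s := (@continuous R_UniformSpace C_R_NormedModule f s).

Lemma continuous_C (f : R -> C) (s : R) :
  continuous (fun x => Re (f x)) s -> continuous (fun x => Im (f x)) s ->
  ccont f s.
Proof.
  intros H1 H2 P [eps HP]; unfold filtermap.
  generalize (filter_and _ _ (proj1 (filterlim_locally _ _) H1 eps)
                (proj1 (filterlim_locally _ _) H2 eps)).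
  apply filter_imp; intros x [B1 B2]; apply HP; split; [exact B1 | exact B2].
Qed.

Lemma continuous_Re (f : R -> C) (s : R) :
  ccont f s -> continuous (fun x => Re (f x)) s.
Proof.
  intros H; apply filterlim_locally; intros eps; unfold filtermap.
  generalize (proj1 (filterlim_locally _ _) H eps).
  apply filter_imp; intros x [B1 B2]; exact B1.
Qed.

Lemma continuous_Im (f : R -> C) (s : R) :
  ccont f s -> continuous (fun x => Im (f x)) s.
Proof.
  intros H; apply filterlim_locally; intros eps; unfold filtermap.
  generalize (proj1 (filterlim_locally _ _) H eps).
  apply filter_imp; intros x [B1 B2]; exact B2.
Qed.

Lemma continuous_Cplus (f g : R -> C) (s : R) :
  ccont f s -> ccont g s -> ccont (fun x => f x + g x)%C s.
Proof. apply (continuous_plus (V := C_R_NormedModule)). Qed.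

Lemma continuous_Cminus (f g : R -> C) (s : R) :
  ccont f s -> ccont g s -> ccont (fun x => f x - g x)%C s.
Proof. apply (continuous_minus (V := C_R_NormedModule)). Qed.

Lemma continuous_Copp (f : R -> C) (s : R) :
  ccont f s -> ccont (fun x => - f x)%C s.
Proof. apply (continuous_opp (V := C_R_NormedModule)). Qed.

Lemma continuous_Cmult (f g : R -> C) (s : R) :
  ccont f s -> ccont g s -> ccont (fun x => f x * g x)%C s.
Proof.
  intros Hf Hg.
  generalize (continuous_Re _ _ Hf) (continuous_Im _ _ Hf)
    (continuous_Re _ _ Hg) (continuous_Im _ _ Hg); intros.
  apply continuous_C; unfold Cmult, Re, Im; simpl.
  - apply (@continuous_minus _ R_AbsRing R_NormedModule);
      apply (continuous_mult (K := R_AbsRing)); assumption.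
  - apply (@continuous_plus _ R_AbsRing R_NormedModule);
      apply (continuous_mult (K := R_AbsRing)); assumption.
Qed.

Lemma continuous_Cconj (f : R -> C) (s : R) :
  ccont f s -> ccont (fun x => Cconj (f x)) s.
Proof.
  intros Hf; apply continuous_C; simpl.
  - exact (continuous_Re _ _ Hf).
  - apply (continuous_opp (V := R_NormedModule)); exact (continuous_Im _ _ Hf).
Qed.

Lemma continuous_RtoC (f : R -> R) (s : R) :
  continuous f s -> ccont (fun x => RtoC (f x)) s.
Proof.
  intros Hf; apply continuous_C; simpl; [exact Hf | apply continuous_const].
Qed.

Lemma continuous_Cmod (f : R -> C) (s : R) :
  ccont f s -> continuous (fun x => Cmod (f x)) s.
Proof.
  intros Hf.
  apply (@continuous_ext R_UniformSpace R_UniformSpace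
           (fun x => @norm _ C_R_NormedModule (f x))).
  { intros x; symmetry; apply Cmod_norm. }
  apply (@continuous_comp R_UniformSpace C_R_NormedModule R_UniformSpace f norm);
    [exact Hf |].
  apply (@filterlim_norm _ C_R_NormedModule).
Qed.

Lemma continuous_Rinv_comp (f : R -> R) (s : R) :
  continuous f s -> f s <> 0 -> continuous (fun x => / f x) s.
Proof.
  intros Hf H0. apply (continuous_comp f Rinv); [exact Hf |].
  apply continuity_pt_filterlim, (continuity_pt_inv (fun x => x)); [| exact H0].
  apply continuity_pt_id.
Qed.

(** Reduces the continuity of complex inversion to that of a real reciprocal. *)
Lemma Cinv_Cconj (z : C) : (/ z = RtoC (/ (Cmod z ^ 2)) * Cconj z)%C.
Proof.
  rewrite Cmod2_alt. destruct z as [x y]; unfold Cinv, Cmult, RtoC, Cconj, Re, Im; simpl.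
  apply injective_projections; simpl; unfold Rdiv; ring.
Qed.

Lemma continuous_Cinv (f : R -> C) (s : R) :
  ccont f s -> f s <> 0 -> ccont (fun x => / f x)%C s.
Proof.
  intros Hf H0.
  apply (@continuous_ext R_UniformSpace C_R_NormedModule
           (fun x => RtoC (/ (Cmod (f x) ^ 2)) * Cconj (f x))%C).
  { intros x; symmetry; apply Cinv_Cconj. }
  apply continuous_Cmult; [| apply continuous_Cconj, Hf].
  apply continuous_RtoC, continuous_Rinv_comp.
  - simpl. apply (continuous_mult (K := R_AbsRing)); [apply continuous_Cmod, Hf|].
    apply (continuous_mult (K := R_AbsRing)); [apply continuous_Cmod, Hf|].
    apply continuous_const.
  - apply pow_nonzero. apply Rgt_not_eq, Cmod_gt_0, H0.
Qed.

Lemma continuous_Cdiv (f g : R -> C) (s : R) :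
  ccont f s -> ccont g s -> g s <> 0 -> ccont (fun x => f x / g x)%C s.
Proof. intros; apply continuous_Cmult; [| apply continuous_Cinv]; assumption. Qed.

Lemma continuous_Cconst (c : C) (s : R) : ccont (fun _ => c) s.
Proof. apply continuous_const. Qed.

(** * The unit circle *)

Definition cis (s : R) : C := (cos s, sin s).

Lemma continuous_cos (s : R) : continuous cos s.
Proof. apply continuity_pt_filterlim, continuity_cos. Qed.
Lemma continuous_sin (s : R) : continuous sin s.
Proof. apply continuity_pt_filterlim, continuity_sin. Qed.

Lemma continuous_cis (s : R) : ccont cis s.
Proof. apply continuous_C; [apply continuous_cos | apply continuous_sin]. Qed.

Lemma Cmod_cis (s : R) : Cmod (cis s) = 1.
Proof.
  rewrite <- sqrt_1; unfold Cmod, cis; apply f_equal; cbn [fst snd].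
  generalize (sin2_cos2 s); unfold Rsqr; lra.
Qed.

Lemma cis_neq_0 (s : R) : cis s <> 0.
Proof. apply Cmod_gt_0. rewrite Cmod_cis; lra. Qed.

Lemma cis_plus (a b : R) : cis (a + b) = (cis a * cis b)%C.
Proof.
  unfold cis, Cmult; simpl; rewrite cos_plus, sin_plus.
  apply injective_projections; simpl; ring.
Qed.

Lemma cis_opp (a : R) : cis (- a) = Cconj (cis a).
Proof. unfold cis, Cconj; simpl; rewrite cos_neg, sin_neg; reflexivity. Qed.

Lemma cis_conj_mult (a : R) : (cis a * Cconj (cis a))%C = 1.
Proof. rewrite <- Cmod2_conj, Cmod_cis. apply injective_projections; simpl; ring. Qed.

Lemma cis_2PI (a : R) : cis (a + 2 * PI) = cis a.
Proof.
  unfold cis. replace (a + 2 * PI) with (a + 2 * INR 1 * PI) by (simpl; ring).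
  rewrite cos_period, sin_period; reflexivity.
Qed.

(** * Integrals of complex-valued functions *)

Lemma ex_CRInt (f : R -> C) (a b : R) :
  (forall s, Rmin a b <= s <= Rmax a b -> ccont f s) ->
  @ex_RInt C_R_CompleteNormedModule f a b.
Proof. apply (ex_RInt_continuous (V := C_R_CompleteNormedModule)). Qed.

Lemma CRInt_components (f : R -> C) (a b : R) :
  @ex_RInt C_R_CompleteNormedModule f a b ->
  CRInt f a b = (RInt (fun s => Re (f s)) a b, RInt (fun s => Im (f s)) a b).
Proof.
  intros H; apply RInt_correct in H.
  symmetry.
  apply (RInt_fct_extend_pair (U := R_NormedModule) (V := R_NormedModule)
           (fun g a b => RInt g a b) (fun g a b => RInt g a b)); [..| exact H];
    intros; apply is_RInt_unique; assumption.
Qed.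

Lemma is_CRInt (f : R -> C) (a b : R) (x y : R) :
  is_RInt (fun s => Re (f s)) a b x -> is_RInt (fun s => Im (f s)) a b y ->
  @is_RInt C_R_NormedModule f a b (x, y).
Proof.
  intros H1 H2.
  apply (is_RInt_fct_extend_pair (U := R_NormedModule) (V := R_NormedModule)); assumption.
Qed.

Lemma is_CRInt_Cmult (f : R -> C) (a b : R) (c l : C) :
  @is_RInt C_R_NormedModule f a b l ->
  @is_RInt C_R_NormedModule (fun s => c * f s)%C a b (c * l)%C.
Proof.
  intros H.
  assert (H1 := is_RInt_fct_extend_fst (U := R_NormedModule) (V := R_NormedModule) _ _ _ _ H).
  assert (H2 := is_RInt_fct_extend_snd (U := R_NormedModule) (V := R_NormedModule) _ _ _ _ H).
  apply is_CRInt.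
  - exact (@is_RInt_minus R_NormedModule _ _ _ _ _ _ (is_RInt_scal _ _ _ _ _ H1) (is_RInt_scal _ _ _ _ _ H2)).
  - exact (@is_RInt_plus R_NormedModule _ _ _ _ _ _ (is_RInt_scal _ _ _ _ _ H2) (is_RInt_scal _ _ _ _ _ H1)).
Qed.

Lemma is_CRInt_conj (f : R -> C) (a b : R) (l : C) :
  @is_RInt C_R_NormedModule f a b l ->
  @is_RInt C_R_NormedModule (fun s => Cconj (f s)) a b (Cconj l).
Proof.
  intros H.
  assert (H1 := is_RInt_fct_extend_fst (U := R_NormedModule) (V := R_NormedModule) _ _ _ _ H).
  assert (H2 := is_RInt_fct_extend_snd (U := R_NormedModule) (V := R_NormedModule) _ _ _ _ H).
  apply is_CRInt; [exact H1 |].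
  exact (@is_RInt_opp R_NormedModule _ _ _ _ H2).
Qed.

Lemma Cmod_CRInt_le (f : R -> C) (g : R -> R) (a b : R) :
  a <= b -> (forall s, a <= s <= b -> Cmod (f s) <= g s) ->
  @ex_RInt C_R_CompleteNormedModule f a b -> ex_RInt g a b ->
  Cmod (CRInt f a b) <= RInt g a b.
Proof.
  intros Hab Hle Hf Hg; rewrite Cmod_norm.
  apply (norm_RInt_le (V := C_R_NormedModule) f g a b); [exact Hab | | |].
  - intros x Hx. rewrite <- Cmod_norm. apply Hle, Hx.
  - apply (RInt_correct (V := C_R_CompleteNormedModule)), Hf.
  - apply (RInt_correct (V := R_CompleteNormedModule)), Hg.
Qed.

(** * Goursat's theorem for rectangles *)

Notation Cderiv f z d := (@is_derive C_AbsRing (AbsRing_NormedModule C_AbsRing) f z d).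

(** The form with [<=] and a factor Cmod (w - z) on the right admits w = z, so estimates based on it
    need no case distinction. *)
Lemma Cderiv_iff (f : C -> C) (z d : C) :
  Cderiv f z d <->
  (forall eps, 0 < eps -> exists delta, 0 < delta /\
     forall w, Cmod (w - z) < delta ->
       Cmod (f w - f z - (w - z) * d) <= eps * Cmod (w - z)).
Proof.
  split.
  - intros [_ H] eps Heps.
    destruct (H z (fun P HP => HP) (mkposreal eps Heps)) as [delta Hd].
    exists delta; split; [apply cond_pos |].
    intros w Hw. exact (Hd w Hw).
  - intros H; split; [apply is_linear_scal_l |].
    intros x Hx eps.
    apply (@is_filter_lim_locally_unique C_AbsRing (AbsRing_NormedModule C_AbsRing)) in Hx; subst x.
    destruct (H eps (cond_pos eps)) as [delta [Hd Hw]].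
    exists (mkposreal delta Hd). intros w Bw. exact (Hw w Bw).
Qed.

Lemma Cderiv_continuous (f : C -> C) (z d : C) :
  Cderiv f z d ->
  forall eps, 0 < eps -> exists delta, 0 < delta /\
    forall w, Cmod (w - z) < delta -> Cmod (f w - f z) < eps.
Proof.
  intros H eps Heps.
  destruct (proj1 (Cderiv_iff f z d) H 1 Rlt_0_1) as [delta [Hd Hw]].
  assert (Hc : 0 < 1 + Cmod d) by (generalize (Cmod_ge_0 d); lra).
  exists (Rmin delta (eps / (1 + Cmod d))); split.
  - apply Rmin_pos; [exact Hd | apply Rdiv_lt_0_compat; assumption].
  - intros w B.
    assert (B1 := Rlt_le_trans _ _ _ B (Rmin_l _ _)).
    assert (B2 := Rlt_le_trans _ _ _ B (Rmin_r _ _)).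
    replace (f w - f z)%C with ((f w - f z - (w - z) * d) + (w - z) * d)%C by ring.
    eapply Rle_lt_trans; [apply Cmod_triangle |].
    rewrite Cmod_mult. specialize (Hw w B1).
    apply (Rmult_lt_compat_r (1 + Cmod d)) in B2; [| exact Hc].
    replace (eps / (1 + Cmod d) * (1 + Cmod d)) with eps in B2 by (field; lra).
    lra.
Qed.

Definition hside (f : C -> C) (y a b : R) : C := CRInt (fun x => f (x, y)) a b.
Definition vside (f : C -> C) (x c d : R) : C := CRInt (fun y => f (x, y)) c d.

(** The integral of f dz counterclockwise round the rectangle [a, b] x [c, d]; the factor Ci is dz =
    i dy on the vertical sides. *)
Definition rect_int (f : C -> C) (a b c d : R) : C :=
  (hside f c a b - hside f d a b + Ci * (vside f b c d - vside f a c d))%C.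

Definition Cdiff_on (D : C -> Prop) (f : C -> C) : Prop :=
  forall z, D z -> exists d, Cderiv f z d.

Definition rect (a b c d : R) (z : C) : Prop :=
  a <= Re z <= b /\ c <= Im z <= d.

Lemma Cmod_vertical (x y y' : R) : Cmod ((x, y') - (x, y))%C = Rabs (y' - y).
Proof.
  unfold Cmod; simpl.
  replace ((x + - x) * ((x + - x) * 1) + (y' + - y) * ((y' + - y) * 1))
    with (Rsqr (y' - y)) by (unfold Rsqr; ring).
  apply sqrt_Rsqr_abs.
Qed.

Lemma Cmod_horizontal (x x' y : R) : Cmod ((x', y) - (x, y))%C = Rabs (x' - x).
Proof.
  unfold Cmod; simpl.
  replace ((x' + - x) * ((x' + - x) * 1) + (y + - y) * ((y + - y) * 1))
    with (Rsqr (x' - x)) by (unfold Rsqr; ring).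
  apply sqrt_Rsqr_abs.
Qed.

(** Neighbourhoods in the codomain are taken for the product structure, whose balls are squares; a
    disk of the same radius lies inside. *)
Lemma ccont_eps (f : R -> C) (s : R) :
  (forall eps, 0 < eps -> exists delta, 0 < delta /\
     forall t, Rabs (t - s) < delta -> Cmod (f t - f s) < eps) ->
  ccont f s.
Proof.
  intros H. apply (proj2 (filterlim_locally (U := C_UniformSpace) _ _)); intros eps.
  destruct (H eps (cond_pos eps)) as [delta [Hd Ht]].
  exists (mkposreal delta Hd); intros t Bt.
  apply C_NormedModule_mixin_compat1. exact (Ht t Bt).
Qed.

Lemma Cderiv_ccont_h (f : C -> C) (x y : R) (d : C) :
  Cderiv f (x, y) d -> ccont (fun x => f (x, y)) x.
Proof.
  intros H; apply ccont_eps; intros eps Heps.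
  destruct (Cderiv_continuous _ _ _ H eps Heps) as [delta [Hd Hw]].
  exists delta; split; [exact Hd |]; intros t Ht.
  apply Hw. rewrite Cmod_horizontal; exact Ht.
Qed.

Lemma Cderiv_ccont_v (f : C -> C) (x y : R) (d : C) :
  Cderiv f (x, y) d -> ccont (fun y => f (x, y)) y.
Proof.
  intros H; apply ccont_eps; intros eps Heps.
  destruct (Cderiv_continuous _ _ _ H eps Heps) as [delta [Hd Hw]].
  exists delta; split; [exact Hd |]; intros t Ht.
  apply Hw. rewrite Cmod_vertical; exact Ht.
Qed.

Lemma ex_hside (f : C -> C) (a b y : R) :
  a <= b -> (forall x, a <= x <= b -> exists d, Cderiv f (x, y) d) ->
  forall u v, a <= u <= v -> v <= b ->
  @ex_RInt C_R_CompleteNormedModule (fun x => f (x, y)) u v.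
Proof.
  intros Hab H u v Hu Hv; apply ex_CRInt; intros s.
  rewrite Rmin_left, Rmax_right by lra; intros Hs.
  destruct (H s ltac:(lra)) as [d Hd]. exact (Cderiv_ccont_h _ _ _ _ Hd).
Qed.

Lemma ex_vside (f : C -> C) (c d x : R) :
  c <= d -> (forall y, c <= y <= d -> exists e, Cderiv f (x, y) e) ->
  forall u v, c <= u <= v -> v <= d ->
  @ex_RInt C_R_CompleteNormedModule (fun y => f (x, y)) u v.
Proof.
  intros Hab H u v Hu Hv; apply ex_CRInt; intros s.
  rewrite Rmin_left, Rmax_right by lra; intros Hs.
  destruct (H s ltac:(lra)) as [e He]. exact (Cderiv_ccont_v _ _ _ _ He).
Qed.

Lemma CRInt_Chasles (f : R -> C) (a b c : R) :
  @ex_RInt C_R_CompleteNormedModule f a b ->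
  @ex_RInt C_R_CompleteNormedModule f b c ->
  (CRInt f a b + CRInt f b c)%C = CRInt f a c.
Proof. apply (RInt_Chasles (V := C_R_CompleteNormedModule)). Qed.

(** Each of the four inner segments is traversed twice, in opposite directions. *)
Lemma rect_int_split (f : C -> C) (a m b c n d : R) :
  a <= m <= b -> c <= n <= d -> Cdiff_on (rect a b c d) f ->
  rect_int f a b c d =
  (rect_int f a m c n + rect_int f m b c n
   + (rect_int f a m n d + rect_int f m b n d))%C.
Proof.
  intros Hm Hn H.
  assert (Eh : forall y u v, c <= y <= d -> a <= u <= v -> v <= b ->
    @ex_RInt C_R_CompleteNormedModule (fun x => f (x, y)) u v).
  { intros y u v Hy; apply (ex_hside f a b); [lra |].
    intros x Hx; apply H; split; simpl; lra. }
  assert (Ev : forall x u v, a <= x <= b -> c <= u <= v -> v <= d ->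
    @ex_RInt C_R_CompleteNormedModule (fun y => f (x, y)) u v).
  { intros x u v Hx; apply (ex_vside f c d); [lra |].
    intros y Hy; apply H; split; simpl; lra. }
  unfold rect_int, hside, vside.
  rewrite <- (CRInt_Chasles (fun x => f (x, c)) a m b) by (apply Eh; lra).
  rewrite <- (CRInt_Chasles (fun x => f (x, d)) a m b) by (apply Eh; lra).
  rewrite <- (CRInt_Chasles (fun y => f (b, y)) c n d) by (apply Ev; lra).
  rewrite <- (CRInt_Chasles (fun y => f (a, y)) c n d) by (apply Ev; lra).
  ring.
Qed.

Lemma CRInt_affine (p q : C) (a b : R) :
  CRInt (fun x => p + RtoC x * q)%C a b
  = (RtoC (b - a) * p + RtoC ((b ^ 2 - a ^ 2) / 2) * q)%C.
Proof.
  assert (A : forall u v : R, is_RInt (fun x => u + x * v) a b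
                ((b - a) * u + (b ^ 2 - a ^ 2) / 2 * v)).
  { intros u v.
    replace ((b - a) * u + (b ^ 2 - a ^ 2) / 2 * v)
      with (minus (b * u + b ^ 2 / 2 * v) (a * u + a ^ 2 / 2 * v))
      by (unfold minus, plus, opp; simpl; field).
    apply (is_RInt_derive (fun x => x * u + x ^ 2 / 2 * v) (fun x => u + x * v)).
    - intros x _; auto_derive; [trivial | field].
    - intros x _. apply (@continuous_plus _ R_AbsRing R_NormedModule).
      + apply continuous_const.
      + apply (continuous_mult (K := R_AbsRing)); [apply continuous_id | apply continuous_const]. }
  apply (is_RInt_unique (V := C_R_CompleteNormedModule)).
  destruct p as [p1 p2], q as [q1 q2].
  replace (RtoC (b - a) * (p1, p2) + RtoC ((b ^ 2 - a ^ 2) / 2) * (q1, q2))%C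
    with ((b - a) * p1 + (b ^ 2 - a ^ 2) / 2 * q1,
          (b - a) * p2 + (b ^ 2 - a ^ 2) / 2 * q2)
    by (apply injective_projections; simpl; ring).
  apply is_CRInt.
  - eapply is_RInt_ext; [| apply A]. intros x _; simpl; ring.
  - eapply is_RInt_ext; [| apply A]. intros x _; simpl; ring.
Qed.

Lemma CRInt_ext (f g : R -> C) (a b : R) :
  (forall x, Rmin a b < x < Rmax a b -> f x = g x) -> CRInt f a b = CRInt g a b.
Proof. apply (RInt_ext (V := C_R_CompleteNormedModule)). Qed.

(** On every side p + z q is affine in the real parameter, so the integral can be evaluated
    outright. This allows the tangent map of f to be subtracted in [rect_int_bound]. *)
Lemma rect_int_affine (p q : C) (a b c d : R) :
  rect_int (fun z => p + z * q)%C a b c d = 0.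
Proof.
  assert (Eh : forall y, hside (fun z => p + z * q)%C y a b
     = CRInt (fun x => (p + Ci * RtoC y * q) + RtoC x * q)%C a b).
  { intros y; apply CRInt_ext; intros x _. apply injective_projections; simpl; ring. }
  assert (Ev : forall x, vside (fun z => p + z * q)%C x c d
     = CRInt (fun y => (p + RtoC x * q) + RtoC y * (Ci * q))%C c d).
  { intros y; apply CRInt_ext; intros x _. apply injective_projections; simpl; ring. }
  unfold rect_int. rewrite !Eh, !Ev, !CRInt_affine.
  destruct p, q; apply injective_projections; simpl; field.
Qed.

Lemma CRInt_const (c : C) (a b : R) : CRInt (fun _ => c) a b = (RtoC (b - a) * c)%C.
Proof.
  transitivity (CRInt (fun x => c + RtoC x * 0)%C a b).
  - apply CRInt_ext; intros x _; ring.
  - rewrite CRInt_affine; ring.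
Qed.

Lemma CRInt_minus (f g : R -> C) (a b : R) :
  @ex_RInt C_R_CompleteNormedModule f a b ->
  @ex_RInt C_R_CompleteNormedModule g a b ->
  CRInt (fun x => f x - g x)%C a b = (CRInt f a b - CRInt g a b)%C.
Proof. apply (RInt_minus (V := C_R_CompleteNormedModule)). Qed.

Lemma Cmod_CRInt_le_const (f : R -> C) (a b M : R) :
  a <= b -> (forall s, a <= s <= b -> Cmod (f s) <= M) ->
  @ex_RInt C_R_CompleteNormedModule f a b ->
  Cmod (CRInt f a b) <= (b - a) * M.
Proof.
  intros Hab Hle Hf.
  eapply Rle_trans; [apply (Cmod_CRInt_le f (fun _ => M)) |]; try assumption.
  - apply ex_RInt_const.
  - rewrite RInt_const. apply Req_le; unfold scal; simpl; unfold mult; simpl; ring.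
Qed.

Lemma ex_CRInt_affine (p q : C) (g : R -> C) (a b : R) :
  (forall s, ccont g s) ->
  @ex_RInt C_R_CompleteNormedModule (fun x => p + g x * q)%C a b.
Proof.
  intros Hg; apply ex_CRInt; intros s _.
  apply continuous_Cplus; [apply continuous_Cconst |].
  apply continuous_Cmult; [apply Hg | apply continuous_Cconst].
Qed.

Lemma Cmod_le_Rabs (z : C) : Cmod z <= Rabs (Re z) + Rabs (Im z).
Proof.
  replace z with (RtoC (Re z) + Ci * RtoC (Im z))%C at 1
    by (destruct z; apply injective_projections; simpl; ring).
  eapply Rle_trans; [apply Cmod_triangle |].
  rewrite Cmod_mult, Cmod_Ci, !Cmod_R. lra.
Qed.

(** Only the remainder of the first-order expansion at z contributes. It is at most eps times the
    semiperimeter l, and the path has length 2 l. *)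
Lemma rect_int_bound (f : C -> C) (a b c d eps : R) (z e : C) :
  a <= b -> c <= d -> rect a b c d z -> Cdiff_on (rect a b c d) f ->
  (forall w, rect a b c d w ->
     Cmod (f w - f z - (w - z) * e) <= eps * Cmod (w - z)) -> 0 <= eps ->
  Cmod (rect_int f a b c d) <= eps * (2 * ((b - a) + (d - c)) ^ 2).
Proof.
  intros Hab Hcd Hz Hf Hw Heps.
  set (L := fun w => (f z - z * e + w * e)%C).
  set (M := eps * ((b - a) + (d - c))).
  assert (HM : forall w, rect a b c d w -> Cmod (f w - L w)%C <= M).
  { intros w Rw. unfold L.
    replace (f w - (f z - z * e + w * e))%C with (f w - f z - (w - z) * e)%C by ring.
    eapply Rle_trans; [apply Hw, Rw |].
    apply Rmult_le_compat_l; [exact Heps |].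
    eapply Rle_trans; [apply Cmod_le_Rabs |].
    destruct Rw, Hz. destruct w, z; simpl in *.
    apply Rplus_le_compat; apply Rabs_le; lra. }
  assert (Eh : forall y, c <= y <= d ->
    @ex_RInt C_R_CompleteNormedModule (fun x => f (x, y)) a b).
  { intros y Hy; apply (ex_hside f a b); [lra | | lra | lra].
    intros x Hx; apply Hf; split; simpl; lra. }
  assert (Ev : forall x, a <= x <= b ->
    @ex_RInt C_R_CompleteNormedModule (fun y => f (x, y)) c d).
  { intros x Hx; apply (ex_vside f c d); [lra | | lra | lra].
    intros y Hy; apply Hf; split; simpl; lra. }
  assert (Lh : forall y,
    @ex_RInt C_R_CompleteNormedModule (fun x => L (x, y)) a b).
  { intros y. apply (ex_CRInt_affine _ _ (fun x => (x, y))); intros s.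
    apply continuous_C; simpl; [apply continuous_id | apply continuous_const]. }
  assert (Lv : forall x,
    @ex_RInt C_R_CompleteNormedModule (fun y => L (x, y)) c d).
  { intros x. apply (ex_CRInt_affine _ _ (fun y => (x, y))); intros s.
    apply continuous_C; simpl; [apply continuous_const | apply continuous_id]. }
  assert (Bh : forall y, c <= y <= d ->
    Cmod (hside f y a b - hside L y a b) <= (b - a) * M).
  { intros y Hy. unfold hside. rewrite <- CRInt_minus; [| apply Eh, Hy | apply Lh].
    apply Cmod_CRInt_le_const; [exact Hab | | apply (ex_RInt_minus (V := C_R_NormedModule)); [apply Eh, Hy | apply Lh]].
    intros s Hs; apply HM; split; simpl; lra. }
  assert (Bv : forall x, a <= x <= b ->
    Cmod (vside f x c d - vside L x c d) <= (d - c) * M).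
  { intros x Hx. unfold vside. rewrite <- CRInt_minus; [| apply Ev, Hx | apply Lv].
    apply Cmod_CRInt_le_const; [exact Hcd | | apply (ex_RInt_minus (V := C_R_NormedModule)); [apply Ev, Hx | apply Lv]].
    intros s Hs; apply HM; split; simpl; lra. }
  replace (rect_int f a b c d) with (rect_int f a b c d - rect_int L a b c d)%C
    by (unfold L; rewrite rect_int_affine; ring).
  unfold rect_int.
  replace (hside f c a b - hside f d a b + Ci * (vside f b c d - vside f a c d)
    - (hside L c a b - hside L d a b + Ci * (vside L b c d - vside L a c d)))%C
   with ((hside f c a b - hside L c a b) + - (hside f d a b - hside L d a b)
     + Ci * ((vside f b c d - vside L b c d) + - (vside f a c d - vside L a c d)))%C by ring.
  eapply Rle_trans; [apply Cmod_triangle |].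
  rewrite Cmod_mult, Cmod_Ci, Rmult_1_l.
  eapply Rle_trans; [apply Rplus_le_compat; apply Cmod_triangle |].
  rewrite !Cmod_opp.
  generalize (Bh c ltac:(lra)) (Bh d ltac:(lra)) (Bv a ltac:(lra)) (Bv b ltac:(lra)).
  unfold M. intros. simpl pow. lra.
Qed.

Lemma nested_intervals (a b : nat -> R) :
  (forall n, a n <= a (S n)) -> (forall n, b (S n) <= b n) ->
  (forall n, a n <= b n) -> exists x, forall n, a n <= x <= b n.
Proof.
  intros Ha Hb Hab.
  assert (Ma : forall m k, a m <= a (m + k)%nat).
  { intros m; induction k as [|k IH]; [rewrite Nat.add_0_r; lra |].
    rewrite Nat.add_succ_r. eapply Rle_trans; [exact IH | apply Ha]. }
  assert (Mb : forall m k, b (m + k)%nat <= b m).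
  { intros m; induction k as [|k IH]; [rewrite Nat.add_0_r; lra |].
    rewrite Nat.add_succ_r. eapply Rle_trans; [apply Hb | exact IH]. }
  assert (AB : forall m n, a m <= b n).
  { intros m n. eapply Rle_trans; [apply (Ma m n) |].
    eapply Rle_trans; [apply Hab |]. rewrite Nat.add_comm. apply Mb. }
  destruct (completeness (fun r => exists n, r = a n)) as [x [U L]].
  - exists (b O). intros r [n ->]. apply AB.
  - exists (a O), O; reflexivity.
  - exists x; intros n; split.
    + apply U; exists n; reflexivity.
    + apply L. intros r [m ->]. apply AB.
Qed.

(** The lower left corner of a quarter that carries at least a fourth of the integral. The decidable
    tests make the sequence of rectangles a plain recursion, without choice; the last branch is
    untested because the failure of the first three forces it, by the triangle inequality. *)
Definition quarter (f : C -> C) (w h : R) (p : R * R) : R * R :=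
  let J x y w h := Cmod (rect_int f x (x + w) y (y + h)) in
  let x := fst p in let y := snd p in
  let w' := w / 2 in let h' := h / 2 in
  if Rle_dec (J x y w h) (4 * J x y w' h') then (x, y)
  else if Rle_dec (J x y w h) (4 * J (x + w') y w' h') then (x + w', y)
  else if Rle_dec (J x y w h) (4 * J x (y + h') w' h') then (x, y + h')
  else (x + w', y + h').

Lemma quarter_spec (f : C -> C) (w h x y : R) :
  0 <= w -> 0 <= h -> Cdiff_on (rect x (x + w) y (y + h)) f ->
  let q := quarter f w h (x, y) in
  x <= fst q <= x + w / 2 /\ y <= snd q <= y + h / 2 /\
  Cmod (rect_int f x (x + w) y (y + h)) <=
  4 * Cmod (rect_int f (fst q) (fst q + w / 2) (snd q) (snd q + h / 2)).
Proof.
  intros Hw Hh Hf.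
  assert (E := rect_int_split f x (x + w / 2) (x + w) y (y + h / 2) (y + h)
                 ltac:(lra) ltac:(lra) Hf).
  unfold quarter; cbv zeta; simpl fst; simpl snd.
  replace (x + w) with (x + w / 2 + w / 2) in * by field.
  replace (y + h) with (y + h / 2 + h / 2) in * by field.
  destruct Rle_dec as [H1|H1]; [simpl; repeat split; lra|].
  destruct Rle_dec as [H2|H2]; [simpl; repeat split; lra|].
  destruct Rle_dec as [H3|H3]; [simpl; repeat split; lra|].
  simpl; repeat split; try lra.
  apply Rnot_le_lt in H1, H2, H3.
  apply Rnot_lt_le; intros H4.
  assert (T := Cmod_triangle).
  revert E H1 H2 H3 H4.
  generalize (rect_int f x (x + w / 2) y (y + h / 2))
    (rect_int f (x + w / 2) (x + w / 2 + w / 2) y (y + h / 2))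
    (rect_int f x (x + w / 2) (y + h / 2) (y + h / 2 + h / 2))
    (rect_int f (x + w / 2) (x + w / 2 + w / 2) (y + h / 2) (y + h / 2 + h / 2)).
  intros A B' D E ->. intros.
  generalize (T (A + B')%C (D + E)%C) (T A B') (T D E). lra.
Qed.

Fixpoint corner (f : C -> C) (w h : R) (p : R * R) (n : nat) : R * R :=
  match n with
  | O => p
  | S n => quarter f (w / 2 ^ n) (h / 2 ^ n) (corner f w h p n)
  end.

Lemma goursat (f : C -> C) (a b c d : R) :
  a <= b -> c <= d -> Cdiff_on (rect a b c d) f -> rect_int f a b c d = 0.
Proof.
  intros Hab Hcd Hf.
  set (w := b - a); set (h := d - c).
  set (p := corner f w h (a, c)).
  assert (Pw : forall n, 0 <= w / 2 ^ n).
  { intros n; apply Rdiv_le_0_compat; [unfold w; lra | apply pow_lt; lra]. }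
  assert (Ph : forall n, 0 <= h / 2 ^ n).
  { intros n; apply Rdiv_le_0_compat; [unfold h; lra | apply pow_lt; lra]. }
  assert (Ew : forall r n, r / 2 ^ S n = r / 2 ^ n / 2).
  { intros r n; simpl; field; apply pow_nonzero; lra. }
  assert (Inv : forall n, let q := p n in
     (a <= fst q /\ fst q + w / 2 ^ n <= b) /\
     (c <= snd q /\ snd q + h / 2 ^ n <= d) /\
     Cmod (rect_int f a b c d) <= 4 ^ n *
       Cmod (rect_int f (fst q) (fst q + w / 2 ^ n) (snd q) (snd q + h / 2 ^ n))).
  { induction n as [|n IH].
    - simpl. replace (a + w / 1) with b by (unfold w; field).
      replace (c + h / 1) with d by (unfold h; field). repeat split; lra.
    - cbv zeta in IH |- *.
      assert (Eq : p (S n) = quarter f (w / 2 ^ n) (h / 2 ^ n) (fst (p n), snd (p n))).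
      { rewrite <- surjective_pairing. reflexivity. }
      rewrite Eq. destruct IH as [I1 [I2 I3]].
      destruct (quarter_spec f (w / 2 ^ n) (h / 2 ^ n) (fst (p n)) (snd (p n)))
        as [Q1 [Q2 Q3]]; [apply Pw | apply Ph | |].
      { intros z [Z1 Z2]; apply Hf; split; lra. }
      rewrite !Ew.
      split; [lra | split; [lra |]].
      eapply Rle_trans; [exact I3 |].
      replace (4 ^ S n) with (4 ^ n * 4) by (simpl; ring).
      rewrite Rmult_assoc.
      apply Rmult_le_compat_l; [apply pow_le; lra | exact Q3]. }
  assert (Step : forall n, fst (p n) <= fst (p (S n)) <= fst (p n) + w / 2 ^ n / 2 /\
     snd (p n) <= snd (p (S n)) <= snd (p n) + h / 2 ^ n / 2).
  { intros n.
    assert (Eq : p (S n) = quarter f (w / 2 ^ n) (h / 2 ^ n) (fst (p n), snd (p n))).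
    { rewrite <- surjective_pairing. reflexivity. }
    rewrite Eq.
    destruct (quarter_spec f (w / 2 ^ n) (h / 2 ^ n) (fst (p n)) (snd (p n)))
        as [Q1 [Q2 Q3]]; [apply Pw | apply Ph | |].
    { destruct (Inv n) as [I1 [I2 _]]. intros z [Z1 Z2]; apply Hf; split; lra. }
    split; assumption. }
  destruct (nested_intervals (fun n => fst (p n)) (fun n => fst (p n) + w / 2 ^ n))
    as [x Hx].
  { intros n; apply Step. }
  { intros n; rewrite Ew; destruct (Step n); lra. }
  { intros n; generalize (Pw n); lra. }
  destruct (nested_intervals (fun n => snd (p n)) (fun n => snd (p n) + h / 2 ^ n))
    as [y Hy].
  { intros n; apply Step. }
  { intros n; rewrite Ew; destruct (Step n); lra. }
  { intros n; generalize (Ph n); lra. }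
  assert (Rz : rect a b c d (x, y)).
  { destruct (Inv O) as [I1 [I2 _]]; generalize (Hx O) (Hy O).
    intros; split; simpl in *; lra. }
  destruct (Hf _ Rz) as [e He].
  apply Cmod_eq_0, Rle_antisym; [| apply Cmod_ge_0].
  apply le_epsilon; intros eps Heps; rewrite Rplus_0_l.
  (* On the n-th rectangle the bound is 4^n (eps / K) 2 ((w + h) / 2^n)^2 = eps 2 (w + h)^2 / K: the
     powers cancel. The 1 keeps K positive for a degenerate rectangle. *)
  set (K := 2 * (w + h) ^ 2 + 1).
  assert (HK : 0 < K).
  { unfold K. generalize (pow2_ge_0 (w + h)); lra. }
  destruct (proj1 (Cderiv_iff _ _ _) He (eps / K)) as [delta [Hd Hw]].
  { apply Rdiv_lt_0_compat; lra. }
  assert (Hn : exists n, (w + h) / 2 ^ n < delta).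
  { destruct (pow_lt_1_zero (/ 2) ltac:(rewrite Rabs_pos_eq; lra)
                (delta / (w + h + 1))) as [n Hn].
    { apply Rdiv_lt_0_compat; [exact Hd | unfold w, h; lra]. }
    exists n. specialize (Hn n (Nat.le_refl n)).
    rewrite Rabs_pos_eq in Hn by (apply pow_le; lra).
    rewrite pow_inv in Hn.
    assert (P2 : 0 < / 2 ^ n) by (apply Rinv_0_lt_compat, pow_lt; lra).
    assert (W : 0 < w + h + 1) by (unfold w, h; lra).
    apply (Rmult_lt_compat_r (w + h + 1)) in Hn; [| exact W].
    replace (delta / (w + h + 1) * (w + h + 1)) with delta in Hn by (field; lra).
    unfold Rdiv. nra. }
  destruct Hn as [n Hn].
  destruct (Inv n) as [I1 [I2 I3]]. eapply Rle_trans; [exact I3 |].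
  assert (Bn := rect_int_bound f (fst (p n)) (fst (p n) + w / 2 ^ n)
     (snd (p n)) (snd (p n) + h / 2 ^ n) (eps / K) (x, y) e).
  eapply Rle_trans; [apply Rmult_le_compat_l; [apply pow_le; lra | apply Bn] |].
  - generalize (Pw n); lra.
  - generalize (Ph n); lra.
  - split; [exact (Hx n) | exact (Hy n)].
  - intros z [Z1 Z2]; apply Hf; split; lra.
  - intros z [Z1 Z2]; apply Hw.
    eapply Rle_lt_trans; [apply Cmod_le_Rabs | eapply Rle_lt_trans; [| exact Hn]].
    destruct z as [z1 z2]; cbn [Re Im fst snd Cminus Cplus Copp] in Z1, Z2 |- *.
    generalize (Hx n) (Hy n); cbv beta; intros.
    rewrite Rdiv_plus_distr.
    apply Rplus_le_compat; apply Rabs_le; lra.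
  - apply Rdiv_le_0_compat; lra.
  - replace (fst (p n) + w / 2 ^ n - fst (p n) + (snd (p n) + h / 2 ^ n - snd (p n)))
      with ((w + h) / 2 ^ n) by (field; apply pow_nonzero; lra).
    replace (4 ^ n) with (2 ^ n * 2 ^ n) by (rewrite <- Rpow_mult_distr; f_equal; ring).
    replace (2 ^ n * 2 ^ n * (eps / K * (2 * ((w + h) / 2 ^ n) ^ 2)))
      with (eps * (2 * (w + h) ^ 2 / K)) by (field; repeat split; first [lra | apply pow_nonzero; lra]).
    rewrite <- (Rmult_1_r eps) at 2. apply Rmult_le_compat_l; [lra |].
    apply (Rmult_le_reg_r K); [exact HK |].
    replace (2 * (w + h) ^ 2 / K * K) with (2 * (w + h) ^ 2) by (field; lra).
    unfold K; lra.
Qed.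

(** * The mean value property *)

Lemma Cderiv_const (c z : C) : Cderiv (fun _ => c) z (RtoC 0).
Proof. apply (@is_derive_const C_AbsRing (AbsRing_NormedModule C_AbsRing)). Qed.

Lemma Cderiv_id (z : C) : Cderiv (fun w => w) z (RtoC 1).
Proof. apply (@is_derive_id C_AbsRing). Qed.

Lemma Cderiv_plus (f g : C -> C) (z d e : C) :
  Cderiv f z d -> Cderiv g z e -> Cderiv (fun w => f w + g w)%C z (d + e)%C.
Proof. apply (@is_derive_plus C_AbsRing (AbsRing_NormedModule C_AbsRing)). Qed.

Lemma Cderiv_mult (f g : C -> C) (z d e : C) :
  Cderiv f z d -> Cderiv g z e ->
  Cderiv (fun w => f w * g w)%C z (d * g z + f z * e)%C.
Proof.
  intros Hf Hg. apply (@is_derive_mult C_AbsRing); try assumption. exact Cmult_comm.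
Qed.

Lemma Cderiv_comp (f g : C -> C) (z d e : C) :
  Cderiv f (g z) d -> Cderiv g z e -> Cderiv (fun w => f (g w)) z (e * d)%C.
Proof. apply (@is_derive_comp C_AbsRing (AbsRing_NormedModule C_AbsRing)). Qed.

Lemma Cderiv_inv (z : C) : z <> 0 -> Cderiv (fun w => / w)%C z (- / (z * z))%C.
Proof.
  intros Hz. apply Cderiv_iff; intros eps Heps.
  assert (Mz : 0 < Cmod z) by (apply Cmod_gt_0, Hz).
  assert (M3 : 0 < Cmod z ^ 3) by (apply pow_lt, Mz).
  (* The first bound gives |w| > |z| / 2; the second then brings |w - z| / (|w| |z|^2), the
     remainder divided by |w - z|, below eps. *)
  exists (Rmin (Cmod z / 2) (eps * Cmod z ^ 3 / 2)); split.
  { apply Rmin_pos; [lra |]. apply Rdiv_lt_0_compat; [apply Rmult_lt_0_compat |]; lra. }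
  intros w B.
  assert (B1 := Rlt_le_trans _ _ _ B (Rmin_l _ _)).
  assert (B2 := Rlt_le_trans _ _ _ B (Rmin_r _ _)).
  assert (Mw : Cmod z / 2 < Cmod w).
  { generalize (Cmod_triangle w (- (w - z))%C). rewrite Cmod_opp.
    replace (w + - (w - z))%C with z by ring. lra. }
  assert (Hw : w <> 0) by (apply Cmod_gt_0; lra).
  replace (/ w - / z - (w - z) * - / (z * z))%C
    with ((w - z) * ((w - z) / (w * (z * z))))%C by (field; split; assumption).
  rewrite Cmod_mult, Rmult_comm.
  apply Rmult_le_compat_r; [apply Cmod_ge_0 |].
  rewrite Cmod_div by (repeat apply Cmult_neq_0; assumption).
  rewrite !Cmod_mult.
  assert (Pz : 0 < Cmod z * Cmod z) by nra.
  assert (P : 0 < Cmod w * (Cmod z * Cmod z)) by (apply Rmult_lt_0_compat; lra).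
  apply (Rmult_le_reg_r (Cmod w * (Cmod z * Cmod z))); [exact P |].
  unfold Rdiv; rewrite Rmult_assoc, Rinv_l, Rmult_1_r by lra.
  apply Rle_trans with (eps * (Cmod z / 2 * (Cmod z * Cmod z))).
  - simpl in B2. lra.
  - apply Rmult_le_compat_l; [lra |]. apply Rmult_le_compat_r; lra.
Qed.

Lemma im_le_Cmod (z : C) : Rabs (Im z) <= Cmod z.
Proof. eapply Rle_trans; [apply Rmax_r | apply (Rmax_Cmod z)]. Qed.

(** * The complex exponential *)

Definition cexp (z : C) : C := (RtoC (exp (Re z)) * cis (Im z))%C.

Lemma cexp_plus (z w : C) : cexp (z + w) = (cexp z * cexp w)%C.
Proof.
  unfold cexp.
  change (Re (z + w)) with (Re z + Re w); change (Im (z + w)) with (Im z + Im w).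
  rewrite exp_plus, cis_plus, RtoC_mult. ring.
Qed.

Lemma derivable_pt_lim_0_bound (f : R -> R) (l eps : R) :
  derivable_pt_lim f 0 l -> 0 < eps ->
  exists delta, 0 < delta /\
    forall h, Rabs h < delta -> Rabs (f h - f 0 - h * l) <= eps * Rabs h.
Proof.
  intros H Heps. destruct (H eps Heps) as [delta Hd].
  exists delta; split; [apply cond_pos |]; intros h Hh.
  destruct (Req_dec h 0) as [-> | H0].
  - rewrite !Rmult_0_l, Rminus_0_r, Rminus_diag, Rabs_R0. lra.
  - specialize (Hd h H0 Hh). rewrite Rplus_0_l in Hd.
    replace (f h - f 0 - h * l) with (((f h - f 0) / h - l) * h) by (field; exact H0).
    rewrite Rabs_mult. apply Rmult_le_compat_r; [apply Rabs_pos | lra].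
Qed.

Lemma cexp_derive_0 (eps : R) : 0 < eps ->
  exists delta, 0 < delta /\
    forall h, Cmod h < delta -> Cmod (cexp h - 1 - h) <= eps * Cmod h.
Proof.
  intros Heps.
  (* The remainder is split as exp x (cos y - 1 + i (sin y - y)) + (exp x - 1 - x) + i y (exp x -
     1). With exp x <= 2, ensured by [e] <= 1/2, the parts are at most 4 e |y|, e |x| and e |y|, in
     all 6 e |h|. *)
  set (e := Rmin (eps / 6) (1 / 2)).
  assert (He : 0 < e) by (apply Rmin_pos; lra).
  assert (He1 : e <= eps / 6) by apply Rmin_l.
  assert (He2 : e <= 1 / 2) by apply Rmin_r.
  assert (D1 : derivable_pt_lim exp 0 1).
  { generalize (derivable_pt_lim_exp 0); rewrite exp_0; trivial. }
  assert (D2 : derivable_pt_lim sin 0 1).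
  { generalize (derivable_pt_lim_sin 0); rewrite cos_0; trivial. }
  assert (D3 : derivable_pt_lim cos 0 0).
  { generalize (derivable_pt_lim_cos 0); rewrite sin_0, Ropp_0; trivial. }
  destruct (derivable_pt_lim_0_bound _ _ _ D1 He) as [d1 [P1 B1]].
  destruct (derivable_pt_lim_0_bound _ _ _ D2 He) as [d2 [P2 B2]].
  destruct (derivable_pt_lim_0_bound _ _ _ D3 He) as [d3 [P3 B3]].
  exists (Rmin (Rmin d1 d2) (Rmin d3 (e / 2))); split.
  { repeat apply Rmin_pos; lra. }
  intros [x y] Hh.
  assert (Q1 := Rlt_le_trans _ _ _ Hh (Rmin_l _ _)).
  assert (Q2 := Rlt_le_trans _ _ _ Hh (Rmin_r _ _)).
  assert (H1 := Rlt_le_trans _ _ _ Q1 (Rmin_l _ _)).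
  assert (H2 := Rlt_le_trans _ _ _ Q1 (Rmin_r _ _)).
  assert (H3 := Rlt_le_trans _ _ _ Q2 (Rmin_l _ _)).
  assert (H4 := Rlt_le_trans _ _ _ Q2 (Rmin_r _ _)).
  assert (Mx : Rabs x <= Cmod (x, y)) by apply (re_le_Cmod (x, y)).
  assert (My : Rabs y <= Cmod (x, y)).
  { apply (im_le_Cmod (x, y)). }
  specialize (B1 x ltac:(lra)). specialize (B2 y ltac:(lra)). specialize (B3 y ltac:(lra)).
  rewrite exp_0 in B1. rewrite sin_0 in B2. rewrite cos_0 in B3.
  assert (E1 : Rabs (exp x - 1) <= e).
  { replace (exp x - 1) with ((exp x - 1 - x * 1) + x) by ring.
    eapply Rle_trans; [apply Rabs_triang |].
    assert (e * Rabs x <= 1 / 2 * Rabs x) by (apply Rmult_le_compat_r; [apply Rabs_pos | lra]).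
    lra. }
  assert (E2 : Rabs (exp x) <= 2).
  { replace (exp x) with ((exp x - 1) + 1) by ring.
    eapply Rle_trans; [apply Rabs_triang |]. rewrite Rabs_R1. lra. }
  replace (cexp (x, y) - 1 - (x, y))%C
    with (RtoC (exp x) * ((cos y - 1 - y * 0)%R, (sin y - 0 - y * 1)%R)
          + (RtoC (exp x - 1 - x * 1) + Ci * RtoC (y * (exp x - 1))))%C
    by (unfold cexp, cis; apply injective_projections; simpl; ring).
  eapply Rle_trans; [apply Cmod_triangle |].
  eapply Rle_trans; [apply Rplus_le_compat_l, Cmod_triangle |].
  rewrite !Cmod_mult, Cmod_Ci, !Cmod_R, Rabs_mult.
  eapply Rle_trans; [apply Rplus_le_compat_r, Rmult_le_compat_l;
                     [apply Rabs_pos | apply Cmod_le_Rabs] |].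
  cbn [Re Im fst snd].
  assert (X1 : Rabs (exp x) * (Rabs (cos y - 1 - y * 0) + Rabs (sin y - 0 - y * 1))
          <= 2 * (e * Rabs y + e * Rabs y)).
  { apply Rmult_le_compat; [apply Rabs_pos | | exact E2 | lra].
    apply Rplus_le_le_0_compat; apply Rabs_pos. }
  assert (X2 : Rabs y * Rabs (exp x - 1) <= Rabs y * e).
  { apply Rmult_le_compat_l; [apply Rabs_pos | exact E1]. }
  assert (X3 : e * Rabs x <= e * Cmod (x, y)) by (apply Rmult_le_compat_l; lra).
  assert (X4 : e * Rabs y <= e * Cmod (x, y)) by (apply Rmult_le_compat_l; lra).
  assert (X5 : e * Cmod (x, y) <= eps / 6 * Cmod (x, y)).
  { apply Rmult_le_compat_r; [apply Cmod_ge_0 | lra]. }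
  lra.
Qed.

Lemma Cmod_cexp (z : C) : Cmod (cexp z) = exp (Re z).
Proof.
  unfold cexp. rewrite Cmod_mult, Cmod_cis, Cmod_R, Rabs_pos_eq; [ring |].
  apply Rlt_le, exp_pos.
Qed.

Lemma Cderiv_cexp (z : C) : Cderiv cexp z (cexp z).
Proof.
  apply Cderiv_iff; intros eps Heps.
  assert (M : 0 < Cmod (cexp z)) by (rewrite Cmod_cexp; apply exp_pos).
  destruct (cexp_derive_0 (eps / Cmod (cexp z))) as [delta [Hd H]].
  { apply Rdiv_lt_0_compat; assumption. }
  exists delta; split; [exact Hd |]; intros w Hw.
  replace w with (z + (w - z))%C at 1 by ring.
  rewrite cexp_plus.
  replace (cexp z * cexp (w - z) - cexp z - (w - z) * cexp z)%C
    with (cexp z * (cexp (w - z) - 1 - (w - z)))%C by ring.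
  rewrite Cmod_mult.
  apply Rle_trans with (Cmod (cexp z) * (eps / Cmod (cexp z) * Cmod (w - z))).
  - apply Rmult_le_compat_l; [lra | apply H, Hw].
  - apply Req_le; field; lra.
Qed.

Definition holo (f : C -> C) : Prop := Cdiff_on (fun z => Cmod z < 1) f.

Definition ccont_disc (f : C -> C) : Prop :=
  forall z, Cmod z <= 1 -> forall eps, 0 < eps ->
  exists delta, 0 < delta /\
    forall w, Cmod w <= 1 -> Cmod (w - z) < delta -> Cmod (f w - f z) < eps.

(** In the coordinate log z the annulus is a rectangle, two sides of which
    cancel by periodicity. *)
Lemma circle_mean_constant (f : C -> C) (r1 r2 : R) :
  holo f -> 0 < r1 <= r2 -> r2 < 1 ->
  CRInt (fun s => f (RtoC r1 * cis s)%C) 0 (2 * PI)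
  = CRInt (fun s => f (RtoC r2 * cis s)%C) 0 (2 * PI).
Proof.
  intros Hf Hr1 Hr2.
  assert (Hpi := PI_RGT_0).
  assert (Hln : ln r1 <= ln r2).
  { destruct (proj2 Hr1) as [H | ->]; [apply Rlt_le, ln_increasing; lra | lra]. }
  assert (G : rect_int (fun z => f (cexp z)) (ln r1) (ln r2) 0 (2 * PI) = 0).
  { apply goursat; [exact Hln | lra |].
    intros z [Hz _].
    destruct (Hf (cexp z)) as [d Hd].
    { rewrite Cmod_cexp. eapply Rle_lt_trans; [| exact Hr2].
      rewrite <- (exp_ln r2) by lra.
      destruct (proj2 Hz) as [H | ->]; [apply Rlt_le, exp_increasing, H | lra]. }
    exists (cexp z * d)%C. apply Cderiv_comp; [exact Hd | apply Cderiv_cexp]. }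
  unfold rect_int in G.
  assert (P : hside (fun z => f (cexp z)) (2 * PI) (ln r1) (ln r2)
              = hside (fun z => f (cexp z)) 0 (ln r1) (ln r2)).
  { apply CRInt_ext; intros x _. unfold cexp; simpl.
    rewrite <- (cis_2PI 0), Rplus_0_l. reflexivity. }
  rewrite P in G.
  assert (V : forall r, 0 < r -> vside (fun z => f (cexp z)) (ln r) 0 (2 * PI)
     = CRInt (fun s => f (RtoC r * cis s)%C) 0 (2 * PI)).
  { intros r Hr. apply CRInt_ext; intros y _. unfold cexp; simpl.
    rewrite exp_ln by exact Hr. reflexivity. }
  rewrite !V in G by lra.
  replace (CRInt (fun s => f (RtoC r1 * cis s)%C) 0 (2 * PI))
    with (CRInt (fun s => f (RtoC r2 * cis s)%C) 0 (2 * PI) + Ci *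
      (Ci * (CRInt (fun s => f (RtoC r2 * cis s)%C) 0 (2 * PI)
             - CRInt (fun s => f (RtoC r1 * cis s)%C) 0 (2 * PI))))%C.
  - replace (Ci * (CRInt (fun s => f (RtoC r2 * cis s)%C) 0 (2 * PI)
             - CRInt (fun s => f (RtoC r1 * cis s)%C) 0 (2 * PI)))%C with (RtoC 0).
    + ring.
    + rewrite <- G. ring.
  - apply injective_projections; simpl; ring.
Qed.

Lemma Cmod_cis_minus (a b : R) : Cmod (cis a - cis b) = 2 * Rabs (sin ((a - b) / 2)).
Proof.
  unfold Cmod, cis; cbn [fst snd Cminus Cplus Copp].
  replace ((cos a + - cos b) ^ 2 + (sin a + - sin b) ^ 2)
    with (Rsqr (2 * sin ((a - b) / 2))).
  - rewrite sqrt_Rsqr_abs, Rabs_mult, (Rabs_pos_eq 2) by lra. reflexivity.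
  - assert (E := cos_2a_sin ((a - b) / 2)).
    replace (2 * ((a - b) / 2)) with (a - b) in E by field.
    rewrite cos_minus in E.
    generalize (sin2_cos2 a) (sin2_cos2 b); unfold Rsqr; intros.
    replace (2 * sin ((a - b) / 2) * (2 * sin ((a - b) / 2)))
      with (2 * (2 * sin ((a - b) / 2) * sin ((a - b) / 2))) by ring.
    replace (2 * sin ((a - b) / 2) * sin ((a - b) / 2))
      with (1 - (cos a * cos b + sin a * sin b)) by lra.
    nra.
Qed.

Lemma Rabs_sin_le (x : R) : Rabs (sin x) <= Rabs x.
Proof.
  assert (P : forall x, 0 <= x -> Rabs (sin x) <= x).
  { intros y [Hy | <-]; [| rewrite sin_0, Rabs_R0; lra].
    apply Rabs_le. split; [| apply Rlt_le, sin_lt_x, Hy].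
    destruct (Rle_dec y PI) as [H | H].
    - generalize (sin_ge_0 y ltac:(lra) H); lra.
    - generalize PI2_1 (SIN_bound y); unfold PI2; intros; lra. }
  destruct (Rle_dec 0 x) as [H | H].
  - rewrite (Rabs_pos_eq x) by exact H. apply P, H.
  - rewrite <- (Rabs_Ropp (sin x)), <- sin_neg, <- (Rabs_Ropp x), (Rabs_pos_eq (- x)) by lra.
    apply P; lra.
Qed.

Lemma Cmod_cis_minus_le (a b : R) : Cmod (cis a - cis b) <= Rabs (a - b).
Proof.
  rewrite Cmod_cis_minus. eapply Rle_trans.
  - apply Rmult_le_compat_l; [lra | apply Rabs_sin_le].
  - unfold Rdiv. rewrite Rabs_mult, (Rabs_pos_eq (/ 2)) by lra. lra.
Qed.

(** Uniform continuity on the compact rectangle of polar coordinates, applied to the real and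
    imaginary parts separately. *)
Lemma ccont_disc_polar (f : C -> C) (eps : R) :
  ccont_disc f -> 0 < eps ->
  exists delta, 0 < delta /\ forall r s, 1 - delta < r < 1 -> 0 <= s <= 2 * PI ->
    Cmod (f (RtoC r * cis s)%C - f (cis s)) <= eps.
Proof.
  intros Hf Heps.
  (* [uniform_continuity_2d] asks for continuity in full neighbourhoods of the points of the
     rectangle, while f is controlled only for r <= 1. Clipping the radius is 1-Lipschitz and
     extends the function beyond. *)
  set (clip := fun r => Rmax 0 (Rmin r 1)).
  assert (C01 : forall r, 0 <= clip r <= 1).
  { intros r; unfold clip; split; [apply Rmax_l |].
    apply Rmax_lub; [lra | apply Rmin_r]. }
  assert (Cid : forall r, 0 <= r <= 1 -> clip r = r).
  { intros r Hr; unfold clip. rewrite Rmin_left, Rmax_right; lra. }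
  assert (Clip : forall r r', Rabs (clip r - clip r') <= Rabs (r - r')).
  { intros r r'; unfold clip, Rmax, Rmin.
    repeat destruct Rle_dec; unfold Rabs; repeat destruct Rcase_abs; lra. }
  assert (Q : forall x y e, 0 < e -> exists delta : posreal, forall u v,
     Rabs (u - x) < delta -> Rabs (v - y) < delta ->
     Cmod (f (RtoC (clip u) * cis v)%C - f (RtoC (clip x) * cis y)%C) < e).
  { intros x y e He.
    assert (M : forall u v, Cmod (RtoC (clip u) * cis v) <= 1).
    { intros u v. rewrite Cmod_mult, Cmod_cis, Cmod_R, Rabs_pos_eq by apply C01.
      rewrite Rmult_1_r. apply C01. }
    destruct (Hf (RtoC (clip x) * cis y)%C (M x y) e He) as [delta [Hd H]].
    assert (Hd2 : 0 < delta / 2) by lra.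
    exists (mkposreal _ Hd2); simpl; intros u v Hu Hv.
    apply H; [apply M |].
    replace (RtoC (clip u) * cis v - RtoC (clip x) * cis y)%C
      with (RtoC (clip u) * (cis v - cis y) + RtoC (clip u - clip x) * cis y)%C
      by (rewrite RtoC_minus; ring).
    eapply Rle_lt_trans; [apply Cmod_triangle |].
    rewrite !Cmod_mult, Cmod_cis, !Cmod_R, Rmult_1_r, (Rabs_pos_eq (clip u)) by apply C01.
    generalize (Clip u x) (Cmod_cis_minus_le v y) (Cmod_ge_0 (cis v - cis y)) (C01 u).
    intros. assert (clip u * Cmod (cis v - cis y) <= 1 * Cmod (cis v - cis y))
      by (apply Rmult_le_compat_r; lra). lra. }
  assert (Heps2 : 0 < eps / 2) by lra.
  destruct (uniform_continuity_2d (fun x y => Re (f (RtoC (clip x) * cis y)%C)) 0 1 0 (2 * PI))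
    with (eps := mkposreal _ Heps2) as [d1 H1].
  { intros x y _ _ e. destruct (Q x y e (cond_pos e)) as [d Hd].
    exists d; intros u v Hu Hv. eapply Rle_lt_trans; [| apply (Hd u v Hu Hv)].
    apply (re_le_Cmod (_ - _)%C). }
  destruct (uniform_continuity_2d (fun x y => Im (f (RtoC (clip x) * cis y)%C)) 0 1 0 (2 * PI))
    with (eps := mkposreal _ Heps2) as [d2 H2].
  { intros x y _ _ e. destruct (Q x y e (cond_pos e)) as [d Hd].
    exists d; intros u v Hu Hv. eapply Rle_lt_trans; [| apply (Hd u v Hu Hv)].
    apply (im_le_Cmod (_ - _)%C). }
  exists (Rmin (Rmin d1 d2) 1); split.
  { repeat apply Rmin_pos; [apply cond_pos | apply cond_pos | lra]. }
  intros r s [Hr1 Hr2] Hs.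
  assert (R1 := Rmin_l (Rmin d1 d2) 1). assert (R2 := Rmin_r (Rmin d1 d2) 1).
  assert (R3 := Rmin_l d1 d2). assert (R4 := Rmin_r d1 d2).
  assert (Ar : Rabs (r - 1) = 1 - r) by (rewrite Rabs_left; lra).
  assert (As : Rabs (s - s) = 0) by (rewrite Rminus_diag; apply Rabs_R0).
  specialize (H1 1 s r s). specialize (H2 1 s r s).
  rewrite As, Ar in H1, H2. simpl in H1, H2. rewrite !Cid in H1, H2 by lra.
  eapply Rle_trans; [apply Cmod_le_Rabs |].
  replace (f (cis s)) with (f (RtoC 1 * cis s)%C) by (apply f_equal; ring).
  assert (D1 := cond_pos d1). assert (D2 := cond_pos d2).
  apply Rle_trans with (eps / 2 + eps / 2); [| lra].
  apply Rplus_le_compat; apply Rlt_le; [apply H1 | apply H2]; lra.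
Qed.

Lemma ccont_disc_circle (f : C -> C) (r : R) (s : R) :
  ccont_disc f -> 0 <= r <= 1 -> ccont (fun s => f (RtoC r * cis s)%C) s.
Proof.
  intros Hf Hr. apply ccont_eps; intros eps Heps.
  assert (M : forall v, Cmod (RtoC r * cis v) <= 1).
  { intros v. rewrite Cmod_mult, Cmod_cis, Cmod_R, Rabs_pos_eq; lra. }
  destruct (Hf _ (M s) eps Heps) as [delta [Hd H]].
  exists delta; split; [exact Hd |]; intros t Ht.
  apply H; [apply M |].
  replace (RtoC r * cis t - RtoC r * cis s)%C with (RtoC r * (cis t - cis s))%C by ring.
  rewrite Cmod_mult, Cmod_R, Rabs_pos_eq by lra.
  eapply Rle_lt_trans; [| exact Ht].
  eapply Rle_trans; [apply Rmult_le_compat_l; [lra | apply Cmod_cis_minus_le] |].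
  generalize (Rabs_pos (t - s)); nra.
Qed.

(** The mean over |z| = r is the same for all 0 < r < 1. Uniform continuity takes it to r = 1,
    continuity at the centre to r = 0. *)
Lemma mean_value (f : C -> C) :
  ccont_disc f -> holo f ->
  CRInt (fun s => f (cis s)) 0 (2 * PI) = (RtoC (2 * PI) * f 0)%C.
Proof.
  intros Hc Hh.
  assert (Hpi := PI_RGT_0).
  set (M := fun r => CRInt (fun s => f (RtoC r * cis s)%C) 0 (2 * PI)).
  assert (I : forall r, 0 <= r <= 1 -> @ex_RInt C_R_CompleteNormedModule
     (fun s => f (RtoC r * cis s)%C) 0 (2 * PI)).
  { intros r Hr; apply ex_CRInt; intros s _. apply ccont_disc_circle; assumption. }
  assert (E1 : CRInt (fun s => f (cis s)) 0 (2 * PI) = M 1).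
  { apply CRInt_ext; intros s _. apply f_equal; ring. }
  assert (E0 : (RtoC (2 * PI) * f 0)%C = M 0).
  { unfold M. transitivity (CRInt (fun _ => f 0) 0 (2 * PI)).
    - rewrite CRInt_const, Rminus_0_r; reflexivity.
    - apply CRInt_ext; intros s _. apply f_equal; ring. }
  rewrite E1, E0.
  assert (L : forall r r' e, 0 <= r <= 1 -> 0 <= r' <= 1 ->
    (forall s, 0 <= s <= 2 * PI -> Cmod (f (RtoC r * cis s)%C - f (RtoC r' * cis s)%C) <= e) ->
    Cmod (M r - M r') <= 2 * PI * e).
  { intros r r' e Hr Hr' He. unfold M. rewrite <- CRInt_minus; [| apply I, Hr | apply I, Hr'].
    replace (2 * PI * e) with ((2 * PI - 0) * e) by ring.
    apply Cmod_CRInt_le_const; [lra | exact He |].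
    apply (ex_RInt_minus (V := C_R_NormedModule)); [apply I, Hr | apply I, Hr']. }
  assert (Z : (M 1 - M 0)%C = 0).
  { apply Cmod_eq_0, Rle_antisym; [| apply Cmod_ge_0].
    apply le_epsilon; intros eps Heps; rewrite Rplus_0_l.
    (* Each of the two passages to the limit costs 2 PI e. *)
    set (e := eps / (4 * PI)).
    assert (He : 0 < e) by (apply Rdiv_lt_0_compat; lra).
    destruct (ccont_disc_polar f e Hc He) as [d1 [Hd1 H1]].
    destruct (Hc 0 ltac:(rewrite Cmod_0; lra) e He) as [d0 [Hd0 H0]].
    set (r1 := Rmax (1 / 2) (1 - d1 / 2)).
    assert (Hr1 : 1 / 2 <= r1) by apply Rmax_l.
    assert (Hr1' : 1 - d1 / 2 <= r1) by apply Rmax_r.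
    assert (Hr1'' : r1 < 1) by (apply Rmax_lub_lt; lra).
    set (r0 := Rmin (1 / 2) (d0 / 2)).
    assert (Hr0 : r0 <= 1 / 2) by apply Rmin_l.
    assert (Hr0' : r0 <= d0 / 2) by apply Rmin_r.
    assert (Hr0'' : 0 < r0) by (apply Rmin_pos; lra).
    assert (B1 : Cmod (M r1 - M 1) <= 2 * PI * e).
    { apply L; [lra | lra |]. intros s Hs.
      replace (RtoC 1 * cis s)%C with (cis s) by ring. apply H1; lra. }
    assert (B0 : Cmod (M r0 - M 0) <= 2 * PI * e).
    { apply L; [lra | lra |]. intros s Hs.
      replace (RtoC 0 * cis s)%C with (RtoC 0) by ring.
      assert (Mr : Cmod (RtoC r0 * cis s) = r0).
      { rewrite Cmod_mult, Cmod_cis, Cmod_R, Rabs_pos_eq; lra. }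
      apply Rlt_le, H0; [rewrite Mr; lra |].
      replace (RtoC r0 * cis s - 0)%C with (RtoC r0 * cis s)%C by ring.
      rewrite Mr; lra. }
    assert (E : M r0 = M r1).
    { apply circle_mean_constant; [exact Hh | lra | exact Hr1'']. }
    replace (M 1 - M 0)%C with (- (M r1 - M 1) + (M r0 - M 0))%C by (rewrite E; ring).
    eapply Rle_trans; [apply Cmod_triangle |]. rewrite Cmod_opp.
    replace eps with (2 * PI * e + 2 * PI * e) by (unfold e; field; lra).
    lra. }
  replace (M 1) with ((M 1 - M 0) + M 0)%C by ring. rewrite Z; ring.
Qed.

(** * Holomorphic functions with vanishing real part on the circle *)

Lemma one_plus_neq_0 (z : C) : Cmod z < 1 -> (1 + z)%C <> 0.
Proof.
  intros H E. assert (Ez : z = (- (1))%C).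
  { replace z with ((1 + z) - 1)%C by ring. rewrite E. ring. }
  rewrite Ez, Cmod_m1 in H. lra.
Qed.

Definition moebius (a w : C) : C := ((w + a) / (1 + Cconj a * w))%C.

Lemma moebius_den (a w : C) :
  Cmod a < 1 -> Cmod w <= 1 -> (1 + Cconj a * w)%C <> 0.
Proof.
  intros Ha Hw. apply one_plus_neq_0. rewrite Cmod_mult, Cmod_conj.
  generalize (Cmod_ge_0 a) (Cmod_ge_0 w); nra.
Qed.

(** This one identity shows both that the open disk is preserved and that the circle is. *)
Lemma moebius_Cmod (a w : C) :
  Cmod a < 1 -> Cmod w <= 1 ->
  1 - Cmod (moebius a w) ^ 2
  = (1 - Cmod a ^ 2) * (1 - Cmod w ^ 2) / Cmod (1 + Cconj a * w) ^ 2.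
Proof.
  intros Ha Hw. unfold moebius.
  assert (H := moebius_den a w Ha Hw).
  assert (P : 0 < Cmod (1 + Cconj a * w)) by (apply Cmod_gt_0, H).
  rewrite Cmod_div by exact H.
  replace ((Cmod (w + a) / Cmod (1 + Cconj a * w)) ^ 2)
    with (Cmod (w + a) ^ 2 / Cmod (1 + Cconj a * w) ^ 2) by (field; lra).
  apply (Rmult_eq_reg_r (Cmod (1 + Cconj a * w) ^ 2)); [| apply pow_nonzero; lra].
  replace ((1 - Cmod (w + a) ^ 2 / Cmod (1 + Cconj a * w) ^ 2) * Cmod (1 + Cconj a * w) ^ 2)
    with (Cmod (1 + Cconj a * w) ^ 2 - Cmod (w + a) ^ 2) by (field; lra).
  replace ((1 - Cmod a ^ 2) * (1 - Cmod w ^ 2) / Cmod (1 + Cconj a * w) ^ 2 * Cmod (1 + Cconj a * w) ^ 2)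
    with ((1 - Cmod a ^ 2) * (1 - Cmod w ^ 2)) by (field; lra).
  rewrite !Cmod2_alt. destruct a, w; simpl; ring.
Qed.

Lemma moebius_lt (a w : C) : Cmod a < 1 -> Cmod w < 1 -> Cmod (moebius a w) < 1.
Proof.
  intros Ha Hw. assert (E := moebius_Cmod a w Ha (Rlt_le _ _ Hw)).
  assert (H := moebius_den a w Ha (Rlt_le _ _ Hw)). apply Cmod_gt_0 in H.
  assert (0 < (1 - Cmod a ^ 2) * (1 - Cmod w ^ 2) / Cmod (1 + Cconj a * w) ^ 2).
  { apply Rdiv_lt_0_compat; [| apply pow_lt, H].
    generalize (Cmod_ge_0 a) (Cmod_ge_0 w); intros. apply Rmult_lt_0_compat; nra. }
  generalize (Cmod_ge_0 (moebius a w)); nra.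
Qed.

Lemma moebius_eq (a w : C) : Cmod a < 1 -> Cmod w = 1 -> Cmod (moebius a w) = 1.
Proof.
  intros Ha Hw. assert (E := moebius_Cmod a w Ha ltac:(lra)).
  rewrite Hw in E.
  replace ((1 - Cmod a ^ 2) * (1 - 1 ^ 2) / Cmod (1 + Cconj a * w) ^ 2) with 0 in E
    by (unfold Rdiv; ring).
  generalize (Cmod_ge_0 (moebius a w)); nra.
Qed.

Lemma moebius_Cderiv (a w : C) : (1 + Cconj a * w)%C <> 0 ->
  exists d, Cderiv (moebius a) w d.
Proof.
  intros H. eexists. unfold moebius, Cdiv.
  apply (Cderiv_mult (fun w => w + a)%C (fun w => / (1 + Cconj a * w))%C).
  - apply (Cderiv_plus (fun w => w) (fun _ => a)); [apply Cderiv_id | apply Cderiv_const].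
  - apply (Cderiv_comp (fun w => / w)%C (fun w => 1 + Cconj a * w)%C).
    + apply Cderiv_inv, H.
    + apply (Cderiv_plus (fun _ => RtoC 1) (fun w => Cconj a * w)%C); [apply Cderiv_const |].
      apply (Cderiv_mult (fun _ => Cconj a) (fun w => w)); [apply Cderiv_const | apply Cderiv_id].
Qed.

Lemma comp_moebius_holo (f : C -> C) (a : C) :
  Cmod a < 1 -> holo f -> holo (fun w => f (moebius a w)).
Proof.
  intros Ha Hf w Hw.
  destruct (moebius_Cderiv a w) as [d Hd]; [apply moebius_den; [exact Ha | lra] |].
  destruct (Hf (moebius a w)) as [e He]; [apply moebius_lt; assumption |].
  exists (d * e)%C. exact (Cderiv_comp f (moebius a) w e d He Hd).
Qed.

Lemma moebius_le (a w : C) : Cmod a < 1 -> Cmod w <= 1 -> Cmod (moebius a w) <= 1.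
Proof.
  intros Ha [Hw | Hw]; [apply Rlt_le, moebius_lt | apply Req_le, moebius_eq]; assumption.
Qed.

Lemma comp_moebius_ccont (f : C -> C) (a : C) :
  Cmod a < 1 -> ccont_disc f -> ccont_disc (fun w => f (moebius a w)).
Proof.
  intros Ha Hf z Hz eps Heps.
  destruct (Hf (moebius a z) (moebius_le a z Ha Hz) eps Heps) as [d1 [Hd1 H1]].
  destruct (moebius_Cderiv a z) as [d Hd]; [apply moebius_den; assumption |].
  destruct (Cderiv_continuous _ _ _ Hd d1 Hd1) as [d2 [Hd2 H2]].
  exists d2; split; [exact Hd2 |]; intros w Hw Bw.
  apply H1; [apply moebius_le; assumption | apply H2, Bw].
Qed.

Lemma zero_Re_center (f : C -> C) :
  ccont_disc f -> holo f -> (forall z, Cmod z = 1 -> Re (f z) = 0) -> Re (f 0) = 0.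
Proof.
  intros Hc Hh Hb.
  assert (Hpi := PI_RGT_0).
  assert (E := mean_value f Hc Hh).
  rewrite CRInt_components in E.
  - apply (f_equal Re) in E; simpl in E.
    rewrite (RInt_ext _ (fun _ => 0)) in E.
    + rewrite RInt_const in E. unfold scal in E; simpl in E; unfold mult in E; simpl in E.
      unfold Re. apply (Rmult_eq_reg_l (2 * PI)); lra.
    + intros s _. apply Hb, Cmod_cis.
  - apply ex_CRInt; intros s _.
    apply (@continuous_ext R_UniformSpace C_R_NormedModule (fun s => f (RtoC 1 * cis s)%C)).
    + intros t. apply f_equal; ring.
    + apply ccont_disc_circle; [exact Hc | lra].
Qed.

(** The automorphism [moebius] a takes 0 to a, so the statement at the centre, applied to the
    composition, gives it at a. This takes the place of the Poisson formula. *)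
Lemma zero_Re_disc (f : C -> C) :
  ccont_disc f -> holo f -> (forall z, Cmod z = 1 -> Re (f z) = 0) ->
  forall z, Cmod z < 1 -> Re (f z) = 0.
Proof.
  intros Hc Hh Hb a Ha.
  replace a with (moebius a 0).
  - apply (zero_Re_center (fun w => f (moebius a w))).
    + apply comp_moebius_ccont; assumption.
    + apply comp_moebius_holo; assumption.
    + intros z Hz. apply Hb, moebius_eq; assumption.
  - unfold moebius. field.
Qed.

(** In every direction u the real part of f does not change, hence Re (u d) = 0; the directions 1
    and i give both components of d. *)
Lemma zero_Re_Cderiv (f : C -> C) (z d : C) (r : R) :
  0 < r -> (forall w, Cmod (w - z) < r -> Re (f w) = 0) -> Cderiv f z d -> d = 0.
Proof.
  intros Hr H Hd.
  assert (B : forall eps, 0 < eps -> Rabs (Re d) <= eps /\ Rabs (Im d) <= eps).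
  { intros eps Heps.
    destruct (proj1 (Cderiv_iff _ _ _) Hd eps Heps) as [delta [Pd Hw]].
    set (t := Rmin r delta / 2).
    assert (Ht : 0 < t) by (apply Rdiv_lt_0_compat; [apply Rmin_pos; assumption | lra]).
    assert (T1 : t < r) by (generalize (Rmin_l r delta); unfold t in *; lra).
    assert (T2 : t < delta) by (generalize (Rmin_r r delta); unfold t in *; lra).
    assert (G : forall u, Cmod u = 1 -> Rabs (Re (u * d)) <= eps).
    { intros u Hu.
      assert (Mu : Cmod (z + RtoC t * u - z) = t).
      { replace (z + RtoC t * u - z)%C with (RtoC t * u)%C by ring.
        rewrite Cmod_mult, Hu, Cmod_R, Rabs_pos_eq; lra. }
      assert (K := Hw (z + RtoC t * u)%C ltac:(lra)). rewrite Mu in K.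
      eapply Rle_trans in K; [| apply re_le_Cmod].
      assert (E : Re (f (z + RtoC t * u) - f z - (z + RtoC t * u - z) * d)%C
                = - (t * Re (u * d)%C)).
      { replace (z + RtoC t * u - z)%C with (RtoC t * u)%C by ring.
        change (Re (f (z + RtoC t * u) - f z - RtoC t * u * d)%C)
          with (Re (f (z + RtoC t * u)%C) + - Re (f z) + - Re (RtoC t * u * d)%C).
        rewrite !H; [destruct u, d; simpl; ring | |].
        - replace (z - z)%C with (RtoC 0) by ring. rewrite Cmod_0; exact Hr.
        - rewrite Mu; exact T1. }
      rewrite E, Rabs_Ropp, Rabs_mult, (Rabs_pos_eq t) in K by lra.
      apply (Rmult_le_reg_l t); lra. }
    split.
    - replace (Re d) with (Re (1 * d)%C) by (destruct d; simpl; ring).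
      apply G, Cmod_1.
    - replace (Im d) with (- Re (Ci * d)%C) by (destruct d; simpl; ring).
      rewrite Rabs_Ropp. apply G, Cmod_Ci. }
  apply injective_projections; simpl.
  - apply Rabs_eq_0, Rle_antisym; [| apply Rabs_pos].
    apply le_epsilon; intros eps Heps; rewrite Rplus_0_l; apply B, Heps.
  - apply Rabs_eq_0, Rle_antisym; [| apply Rabs_pos].
    apply le_epsilon; intros eps Heps; rewrite Rplus_0_l; apply B, Heps.
Qed.

(** The derivative vanishes on the disk, so Im f is constant along each segment from 0 to z. *)
Lemma zero_Re_constant (f : C -> C) :
  ccont_disc f -> holo f -> (forall z, Cmod z = 1 -> Re (f z) = 0) ->
  exists c : R, forall z, Cmod z < 1 -> f z = (Ci * RtoC c)%C.
Proof.
  intros Hc Hh Hb. exists (Im (f 0)); intros z Hz.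
  assert (H0 := zero_Re_disc f Hc Hh Hb).
  assert (D : forall p, Cmod p < 1 -> Cderiv f p (RtoC 0)).
  { intros p Hp. destruct (Hh p Hp) as [d Hd].
    rewrite <- (zero_Re_Cderiv f p d (1 - Cmod p)); [exact Hd | lra | | exact Hd].
    intros w Hw. apply H0. generalize (Cmod_triangle (w - p) p).
    replace (w - p + p)%C with w by ring. lra. }
  assert (E : Im (f (RtoC 0 * z)%C) = Im (f (RtoC 1 * z)%C)).
  { apply (eq_is_derive (fun s => Im (f (RtoC s * z)%C)) 0 1); [| lra].
    intros s Hs. apply is_derive_Reals.
    intros eps Heps.
    assert (Hp : Cmod (RtoC s * z) < 1).
    { rewrite Cmod_mult, Cmod_R, Rabs_pos_eq by lra.
      generalize (Cmod_ge_0 z); nra. }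
    (* Half of eps, because the real derivative is defined by a strict inequality. *)
    destruct (proj1 (Cderiv_iff _ _ _) (D _ Hp) (eps / 2) ltac:(lra)) as [delta [Pd Hw]].
    exists (mkposreal delta Pd); simpl; intros h Hh0 Hhd.
    assert (Eh : (RtoC (s + h) * z - RtoC s * z)%C = (RtoC h * z)%C)
      by (rewrite RtoC_plus; ring).
    assert (Mh : Cmod (RtoC (s + h) * z - RtoC s * z) <= Rabs h).
    { rewrite Eh, Cmod_mult, Cmod_R. generalize (Cmod_ge_0 z) (Rabs_pos h); nra. }
    specialize (Hw (RtoC (s + h) * z)%C ltac:(lra)).
    rewrite Cmult_0_r in Hw.
    assert (Q : Rabs (Im (f (RtoC (s + h) * z)%C) - Im (f (RtoC s * z)%C)) <= eps / 2 * Rabs h).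
    { eapply Rle_trans; [apply (im_le_Cmod (f (RtoC (s + h) * z) - f (RtoC s * z))%C) |].
      replace (f (RtoC (s + h) * z) - f (RtoC s * z))%C
        with (f (RtoC (s + h) * z) - f (RtoC s * z) - 0)%C by ring.
      eapply Rle_trans; [exact Hw |]. apply Rmult_le_compat_l; lra. }
    unfold zero; simpl. rewrite Rminus_0_r. unfold Rdiv.
    rewrite Rabs_mult, Rabs_inv.
    assert (0 < Rabs h) by (apply Rabs_pos_lt, Hh0).
    apply (Rmult_lt_reg_r (Rabs h)); [assumption |].
    rewrite Rmult_assoc, Rinv_l, Rmult_1_r by lra. nra. }
  replace (RtoC 0 * z)%C with (RtoC 0) in E by ring.
  replace (RtoC 1 * z)%C with z in E by ring.
  generalize (H0 z Hz). destruct (f z) as [x y]; unfold Re, Im in *; simpl in *; intros ->.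
  apply injective_projections; simpl; rewrite E; ring.
Qed.

(** * The algebra B as dual numbers *)

(** Equalities between components of elements of B are retyped as equalities in C, the type known to
    [ring]. *)
Ltac cring := match goal with |- @eq _ ?a ?b => change (@eq C a b) end; first [ring | symmetry; ring].

(** [pa] is the ring homomorphism from B to C that kills rho; an element is invertible exactly when
    its image under [pa] is nonzero. *)
Definition pa (b : B) : C := (fst b + Ci * snd b)%C.
Definition pb (b : B) : C := (- Ci * snd b)%C.
(** A norm equivalent to that of B and, unlike it, submultiplicative: the norm of e2 is 1, that of
    its square is sqrt 5. *)
Definition nB (b : B) : R := Cmod (pa b) + Cmod (pb b).
(** This identification of C with mu is only real-linear: the rho-coordinate of [emb] z is - i Im z,
    and products leave mu. *)
Definition emb (z : C) : B := muplane (Re z) (Im z).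

Lemma Ci_Ci : (Ci * Ci)%C = (- (1))%C.
Proof. apply injective_projections; simpl; ring. Qed.

Lemma fst_pa_pb (b : B) : fst b = (pa b + pb b)%C.
Proof. unfold pa, pb; cring. Qed.

Lemma snd_pb (b : B) : snd b = (Ci * pb b)%C.
Proof.
  unfold pb. replace (Ci * (- Ci * snd b))%C with (- (Ci * Ci) * snd b)%C by cring.
  rewrite Ci_Ci; cring.
Qed.

Lemma B_ext (a b : B) : pa a = pa b -> pb a = pb b -> a = b.
Proof.
  intros H1 H2. apply injective_projections.
  - rewrite !fst_pa_pb, H1, H2; reflexivity.
  - rewrite !snd_pb, H2; reflexivity.
Qed.

Lemma pa_plus (a b : B) : pa (a + b)%B = (pa a + pa b)%C.
Proof. destruct a, b; unfold pa; simpl; unfold plus; simpl; cring. Qed.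
Lemma pb_plus (a b : B) : pb (a + b)%B = (pb a + pb b)%C.
Proof. destruct a, b; unfold pb; simpl; unfold plus; simpl; cring. Qed.
Lemma pa_minus (a b : B) : pa (a - b)%B = (pa a - pa b)%C.
Proof. destruct a, b; unfold pa; simpl; unfold minus, plus, opp; simpl; unfold plus; simpl; cring. Qed.
Lemma pb_minus (a b : B) : pb (a - b)%B = (pb a - pb b)%C.
Proof. destruct a, b; unfold pb; simpl; unfold minus, plus, opp; simpl; unfold plus; simpl; cring. Qed.
Lemma pa_scal (c : C) (a : B) : pa (c *: a)%B = (c * pa a)%C.
Proof. destruct a; unfold pa; simpl; unfold scal; simpl; unfold mult; simpl; cring. Qed.
Lemma pb_scal (c : C) (a : B) : pb (c *: a)%B = (c * pb a)%C.
Proof. destruct a; unfold pb; simpl; unfold scal; simpl; unfold mult; simpl; cring. Qed.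
Lemma pa_mult (a b : B) : pa (a * b)%B = (pa a * pa b)%C.
Proof.
  destruct a as [x y], b as [z w]; unfold pa, Bmul; simpl fst; simpl snd.
  transitivity (x * z + Ci * (x * w + y * z) + (1 + 2 * (Ci * Ci)) * (y * w))%C; [cring |].
  transitivity (x * z + Ci * (x * w + y * z) + (Ci * Ci) * (y * w))%C; [| cring].
  rewrite Ci_Ci; cring.
Qed.
Lemma pb_mult (a b : B) : pb (a * b)%B = (pa a * pb b + pb a * pa b)%C.
Proof.
  destruct a as [x y], b as [z w]; unfold pa, pb, Bmul; simpl fst; simpl snd. cring.
Qed.
Lemma pa_e1 : pa e1 = 1. Proof. unfold pa, e1; simpl; cring. Qed.
Lemma pb_e1 : pb e1 = 0. Proof. unfold pb, e1; simpl; cring. Qed.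
Lemma pa_e2 : pa e2 = Ci. Proof. unfold pa, e2; simpl; cring. Qed.
Lemma pb_e2 : pb e2 = (- Ci)%C. Proof. unfold pb, e2; simpl; cring. Qed.

Lemma pa_emb (z : C) : pa (emb z) = z.
Proof.
  unfold emb, muplane. rewrite pa_plus, !pa_scal, pa_e1, pa_e2.
  destruct z; apply injective_projections; simpl; ring.
Qed.
Lemma pb_emb (z : C) : pb (emb z) = (- Ci * RtoC (Im z))%C.
Proof.
  unfold emb, muplane. rewrite pb_plus, !pb_scal, pb_e1, pb_e2. ring.
Qed.

Lemma muplane_emb (x y : R) : muplane x y = emb (x, y).
Proof. reflexivity. Qed.

Lemma emb_plus (z w : C) : emb (z + w) = (emb z + emb w)%B.
Proof.
  apply B_ext.
  - rewrite pa_plus, !pa_emb; reflexivity.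
  - rewrite pb_plus, !pb_emb. destruct z, w; apply injective_projections; cbn; ring.
Qed.

Lemma emb_minus (z w : C) : emb (z - w) = (emb z - emb w)%B.
Proof.
  apply B_ext.
  - rewrite pa_minus, !pa_emb; reflexivity.
  - rewrite pb_minus, !pb_emb. destruct z, w; apply injective_projections; cbn; ring.
Qed.

Lemma norm_emb (z : C) : norm (emb z) = Cmod z.
Proof.
  assert (E : emb z = (RtoC (Re z), RtoC (Im z))).
  { destruct z; apply injective_projections; apply injective_projections;
      cbn; ring. }
  rewrite E, B_norm, !Cmod_R. unfold Cmod. f_equal.
  rewrite !pow2_abs. reflexivity.
Qed.

Lemma nB_mult (a b : B) : nB (a * b)%B <= nB a * nB b.
Proof.
  unfold nB. rewrite pa_mult, pb_mult, Cmod_mult.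
  generalize (Cmod_triangle (pa a * pb b) (pb a * pa b)).
  rewrite !Cmod_mult.
  generalize (Cmod_ge_0 (pa a)) (Cmod_ge_0 (pa b)) (Cmod_ge_0 (pb a)) (Cmod_ge_0 (pb b)).
  nra.
Qed.

Lemma nB_plus (a b : B) : nB (a + b)%B <= nB a + nB b.
Proof.
  unfold nB. rewrite pa_plus, pb_plus.
  generalize (Cmod_triangle (pa a) (pa b)) (Cmod_triangle (pb a) (pb b)). lra.
Qed.

Lemma nB_scal (c : C) (a : B) : nB (c *: a)%B = Cmod c * nB a.
Proof. unfold nB. rewrite pa_scal, pb_scal, !Cmod_mult. ring. Qed.

Lemma nB_pos (a : B) : 0 <= nB a.
Proof. unfold nB. generalize (Cmod_ge_0 (pa a)) (Cmod_ge_0 (pb a)); lra. Qed.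

Lemma norm_fst (b : B) : Cmod (fst b) <= norm b.
Proof.
  destruct b as [x y]. rewrite B_norm. simpl fst.
  rewrite <- (sqrt_pow2 (Cmod x)) by apply Cmod_ge_0.
  apply sqrt_le_1_alt. rewrite sqrt_pow2 by apply Cmod_ge_0.
  generalize (pow2_ge_0 (Cmod y)); lra.
Qed.

Lemma norm_snd (b : B) : Cmod (snd b) <= norm b.
Proof.
  destruct b as [x y]. rewrite B_norm. simpl snd.
  rewrite <- (sqrt_pow2 (Cmod y)) by apply Cmod_ge_0.
  apply sqrt_le_1_alt. rewrite sqrt_pow2 by apply Cmod_ge_0.
  generalize (pow2_ge_0 (Cmod x)); lra.
Qed.

Lemma nB_le_norm (b : B) : nB b <= 3 * norm b.
Proof.
  unfold nB, pa, pb. generalize (norm_fst b) (norm_snd b)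
    (Cmod_triangle (fst b) (Ci * snd b)).
  rewrite !Cmod_mult, Cmod_opp, Cmod_Ci. lra.
Qed.

Lemma norm_le_nB (b : B) : norm b <= 2 * nB b.
Proof.
  assert (H : norm b <= Cmod (fst b) + Cmod (snd b)).
  { destruct b as [x y]. rewrite B_norm; simpl fst; simpl snd.
    generalize (Cmod_ge_0 x) (Cmod_ge_0 y); intros.
    rewrite <- (sqrt_pow2 (Cmod x + Cmod y)) by lra.
    apply sqrt_le_1_alt. nra. }
  revert H. rewrite fst_pa_pb, snd_pb, Cmod_mult, Cmod_Ci.
  unfold nB. generalize (Cmod_triangle (pa b) (pb b)) (Cmod_ge_0 (pa b)). lra.
Qed.

Lemma nB_emb (z : C) : Cmod z <= nB (emb z) <= 2 * Cmod z.
Proof.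
  unfold nB. rewrite pa_emb, pb_emb, Cmod_mult, Cmod_opp, Cmod_Ci, Cmod_R.
  generalize (im_le_Cmod z) (Rabs_pos (Im z)). lra.
Qed.

(** * Neighbourhoods in B, and the disk with its closure and boundary *)

Lemma locally_B (zeta : B) (P : B -> Prop) :
  locally zeta P <-> exists eps, 0 < eps /\ forall w, nB (w - zeta)%B < eps -> P w.
Proof.
  split.
  - intros H. destruct (locally_norm_le_locally (V := B) zeta P H) as [eps He].
    exists (eps / 2); split; [generalize (cond_pos eps); lra |].
    intros w Hw. apply He. unfold ball_norm. eapply Rle_lt_trans; [apply norm_le_nB | lra].
  - intros [eps [He H]]. apply (locally_le_locally_norm (V := B)).
    assert (He3 : 0 < eps / 3) by lra.
    exists (mkposreal _ He3). intros w Hw. apply H.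
    unfold ball_norm in Hw; simpl in Hw. generalize (nB_le_norm (w - zeta)%B). lra.
Qed.

(** mu is the common zero set of the imaginary parts of the two components, hence closed in B. *)
Lemma in_mu_closure (D : B -> Prop) (zeta : B) :
  (forall w, D w -> in_mu w) -> closure D zeta -> exists z, zeta = emb z.
Proof.
  intros HD Hz.
  assert (K : forall eps, 0 < eps -> Rabs (Im (fst zeta)) <= eps /\ Rabs (Im (snd zeta)) <= eps).
  { intros eps He.
    destruct (Hz (fun w => nB (w - zeta)%B < eps / 2)) as [w [Hw Dw]].
    { apply locally_B. exists (eps / 2); split; [lra | trivial]. }
    destruct (HD w Dw) as [x [y ->]].
    assert (N := norm_le_nB (muplane x y - zeta)%B).
    assert (N1 := norm_fst (muplane x y - zeta)%B).
    assert (N2 := norm_snd (muplane x y - zeta)%B).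
    assert (M1 := im_le_Cmod (fst (muplane x y - zeta)%B)).
    assert (M2 := im_le_Cmod (snd (muplane x y - zeta)%B)).
    assert (E1 : Im (fst (muplane x y - zeta)%B) = - Im (fst zeta)).
    { destruct zeta as [[? ?] [? ?]]; cbn; ring. }
    assert (E2 : Im (snd (muplane x y - zeta)%B) = - Im (snd zeta)).
    { destruct zeta as [[? ?] [? ?]]; cbn; ring. }
    rewrite E1, Rabs_Ropp in M1. rewrite E2, Rabs_Ropp in M2. lra. }
  exists (Re (fst zeta), Re (snd zeta)).
  assert (I1 : Im (fst zeta) = 0).
  { apply Rabs_eq_0, Rle_antisym; [| apply Rabs_pos].
    apply le_epsilon; intros eps Heps; rewrite Rplus_0_l; apply K, Heps. }
  assert (I2 : Im (snd zeta) = 0).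
  { apply Rabs_eq_0, Rle_antisym; [| apply Rabs_pos].
    apply le_epsilon; intros eps Heps; rewrite Rplus_0_l; apply K, Heps. }
  destruct zeta as [[? ?] [? ?]]; simpl in *; subst.
  apply injective_projections; apply injective_projections; cbn; ring.
Qed.

Lemma disk_emb (z : C) : disk (emb z) <-> Cmod z < 1.
Proof.
  unfold disk. rewrite norm_emb. split; [tauto |]. intros H; split; [| exact H].
  exists (Re z), (Im z); reflexivity.
Qed.

Lemma disk_inv (zeta : B) : disk zeta -> exists z, zeta = emb z /\ Cmod z < 1.
Proof.
  intros H. destruct (proj1 H) as [x [y E]]. exists (x, y). split; [exact E |].
  apply disk_emb. rewrite <- muplane_emb, <- E; exact H.
Qed.

Lemma closure_emb (D : C -> Prop) (E : B -> Prop) (z : C) :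
  (forall w, E w -> in_mu w) -> (forall w, E (emb w) <-> D w) ->
  closure E (emb z) <-> forall eps, 0 < eps -> exists w, Cmod (w - z) < eps /\ D w.
Proof.
  intros HE HD; split.
  - intros H eps He.
    destruct (H (fun w => nB (w - emb z)%B < eps)) as [w [Hw Dw]].
    { apply locally_B. exists eps; split; [exact He | trivial]. }
    destruct (HE w Dw) as [x [y ->]]. exists (x, y).
    rewrite muplane_emb, <- emb_minus in Hw. rewrite muplane_emb in Dw.
    split; [| apply HD, Dw]. generalize (nB_emb ((x, y) - z)%C). lra.
  - intros H P HP. apply locally_B in HP. destruct HP as [eps [He HP]].
    destruct (H (eps / 2) ltac:(lra)) as [w [Hw Dw]].
    exists (emb w); split; [| apply HD, Dw].
    apply HP. rewrite <- emb_minus. generalize (nB_emb (w - z)%C). lra.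
Qed.

Lemma closure_disk_emb (z : C) : closure disk (emb z) <-> Cmod z <= 1.
Proof.
  rewrite (closure_emb (fun z => Cmod z < 1));
    [| intros w [H _]; exact H | apply disk_emb].
  split.
  - intros H. apply le_epsilon; intros eps He.
    destruct (H eps He) as [w [Hw Dw]].
    generalize (Cmod_triangle w (- (w - z))%C). rewrite Cmod_opp.
    replace (w + - (w - z))%C with z by ring. lra.
  - intros H eps He.
    set (t := Rmin (eps / 2) 1).
    assert (T1 : t <= eps / 2) by apply Rmin_l. assert (T2 : t <= 1) by apply Rmin_r.
    assert (T3 : 0 < t) by (apply Rmin_pos; lra).
    exists (RtoC (1 - t) * z)%C; split.
    + replace (RtoC (1 - t) * z - z)%C with (RtoC (- t) * z)%C
        by (rewrite RtoC_minus, RtoC_opp; ring).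
      rewrite Cmod_mult, Cmod_R, Rabs_Ropp, Rabs_pos_eq by lra.
      generalize (Cmod_ge_0 z); nra.
    + rewrite Cmod_mult, Cmod_R, Rabs_pos_eq by lra.
      generalize (Cmod_ge_0 z); nra.
Qed.

Lemma closure_disk_inv (zeta : B) :
  closure disk zeta -> exists z, zeta = emb z /\ Cmod z <= 1.
Proof.
  intros H. destruct (in_mu_closure disk zeta) as [z ->]; [intros w [K _]; exact K | exact H |].
  exists z; split; [reflexivity | apply closure_disk_emb, H].
Qed.

Lemma boundary_disk_emb (z : C) : boundary disk (emb z) <-> Cmod z = 1.
Proof.
  unfold boundary. rewrite closure_disk_emb.
  rewrite (closure_emb (fun z => ~ Cmod z < 1)).
  - split.
    + intros [H1 H2]. apply Rle_antisym; [exact H1 |].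
      apply le_epsilon; intros eps He. destruct (H2 eps He) as [w [Hw Dw]].
      generalize (Cmod_triangle (w - z) z). replace (w - z + z)%C with w by ring. lra.
    + intros E; split; [lra |]. intros eps He. exists z; split; [| lra].
      replace (z - z)%C with (RtoC 0) by ring. rewrite Cmod_0; exact He.
  - intros w [H _]; exact H.
  - intros w. rewrite disk_emb. split; [tauto |]. intros H; split; [| exact H].
    exists (Re w), (Im w); reflexivity.
Qed.

Lemma boundary_disk_inv (zeta : B) :
  boundary disk zeta -> exists z, zeta = emb z /\ Cmod z = 1.
Proof.
  intros H. destruct (closure_disk_inv zeta (proj1 H)) as [z [-> _]].
  exists z; split; [reflexivity | apply boundary_disk_emb, H].
Qed.

(** * Boundary data as functions of the angle *)

Definition bval (u : B -> R) (s : R) : R := u (emb (cis s)).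

(** A chord is at most as long as its arc, so differences of angles can be used in the modulus of
    continuity. *)
Lemma omega_bound (u : B -> R) (eta s t : R) :
  is_finite (omega disk u eta) -> Rabs (s - t) <= eta ->
  Rabs (bval u s - bval u t) <= real (omega disk u eta).
Proof.
  intros Hf Hst. change (Rbar_le (Rabs (bval u s - bval u t)) (real (omega disk u eta))).
  rewrite Hf. apply (proj1 (Lub_Rbar_correct _)).
  exists (emb (cis s)), (emb (cis t)).
  split; [apply boundary_disk_emb, Cmod_cis |].
  split; [apply boundary_disk_emb, Cmod_cis |].
  split; [| reflexivity].
  rewrite <- emb_minus, norm_emb. eapply Rle_trans; [apply Cmod_cis_minus_le | exact Hst].
Qed.

Lemma omega_mono (u : B -> R) (eta eta' : R) :
  is_finite (omega disk u eta) -> is_finite (omega disk u eta') -> eta <= eta' ->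
  real (omega disk u eta) <= real (omega disk u eta').
Proof.
  intros H H' Le.
  change (Rbar_le (real (omega disk u eta)) (real (omega disk u eta'))).
  rewrite H, H'. apply Lub_Rbar_correct.
  intros r [z1 [z2 [B1 [B2 [N E]]]]]. apply (proj1 (Lub_Rbar_correct _)).
  exists z1, z2. repeat split; try tauto; try apply B1; try apply B2; lra.
Qed.

(** The Cauchy criterion: the integral over [a, b] is the difference of the integrals over [a, 1]
    and [b, 1], both within eps / 2 of the improper integral. *)
Lemma dini_tail (u : B -> R) : dini disk u ->
  forall eps, 0 < eps -> exists h, 0 < h < 1 /\
    forall a b, 0 < a <= b -> b <= h ->
      exists l, is_RInt (fun eta => real (omega disk u eta) / eta) a b l /\ l <= eps.
Proof.
  intros [_ [l H]] eps He.
  assert (He2 : 0 < eps / 2) by lra.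
  destruct (H (fun y => ball l (mkposreal _ He2) y)) as [Q1 Q2 HQ1 HQ2 HQ].
  { exists (mkposreal _ He2); trivial. }
  destruct HQ1 as [d Hd].
  assert (Pd := cond_pos d).
  exists (Rmin (d / 2) (1 / 2)).
  assert (R1 := Rmin_l (d / 2) (1 / 2)). assert (R2 := Rmin_r (d / 2) (1 / 2)).
  split; [split; [apply Rmin_pos; lra | lra] |].
  intros a b Ha Hb.
  assert (K : forall c, 0 < c <= b -> exists y,
     is_RInt (fun eta => real (omega disk u eta) / eta) c 1 y /\ Rabs (y - l) < eps / 2).
  { intros c Hc. destruct (HQ c 1) as [y [Y1 Y2]].
    - apply Hd; [| lra]. change (Rabs (c - 0) < d). rewrite Rabs_pos_eq; lra.
    - exact HQ2.
    - exists y; split; [exact Y1 | exact Y2]. }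
  destruct (K a ltac:(lra)) as [ya [Ia Ba]]. destruct (K b ltac:(lra)) as [yb [Ib Bb]].
  exists (ya - yb); split.
  - apply is_RInt_swap in Ib.
    replace (ya - yb) with (plus ya (opp yb)) by reflexivity.
    apply (is_RInt_Chasles _ a 1 b); assumption.
  - apply Rabs_def2 in Ba, Bb. lra.
Qed.

(** By monotonicity the integrand on [h / 2, h] is at least omega (h / 2) / h, so the integral there
    is at least omega (h / 2) / 2, and it is small. *)
Lemma dini_omega_0 (u : B -> R) : dini disk u ->
  forall eps, 0 < eps -> exists eta, 0 < eta < 1 /\ real (omega disk u eta) <= eps.
Proof.
  intros Hu eps He. destruct (dini_tail u Hu (eps / 2) ltac:(lra)) as [h [Hh H]].
  exists (h / 2); split; [lra |].
  destruct (H (h / 2) h ltac:(lra) ltac:(lra)) as [l [Il Hl]].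
  assert (Fin : forall eta, 0 < eta < 1 -> is_finite (omega disk u eta)) by apply Hu.
  set (w := real (omega disk u (h / 2))) in *.
  assert (W0 : 0 <= w).
  { eapply Rle_trans; [apply Rabs_pos | apply (omega_bound u (h / 2) 0 0)].
    - apply Fin; lra.
    - rewrite Rminus_diag, Rabs_R0; lra. }
  assert (L : w / 2 <= l).
  { apply (is_RInt_le (fun _ => w / h) (fun eta => real (omega disk u eta) / eta) (h / 2) h);
      [lra | | exact Il |].
    - replace (w / 2) with (scal (h - h / 2) (w / h))
        by (unfold scal; simpl; unfold mult; simpl; field; lra).
      apply (is_RInt_const (V := R_NormedModule)).
    - intros x Hx. apply Rle_trans with (w / x).
      + apply Rmult_le_compat_l; [exact W0 | apply Rinv_le_contravar; lra].
      + apply Rmult_le_compat_r; [apply Rlt_le, Rinv_0_lt_compat; lra |].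
        apply omega_mono; [apply Fin; lra | apply Fin; lra | lra]. }
  lra.
Qed.

Lemma dini_continuous (u : B -> R) (s : R) : dini disk u -> continuous (bval u) s.
Proof.
  intros Hu. apply filterlim_locally; intros eps.
  destruct (dini_omega_0 u Hu (eps / 2)) as [eta [He Hw]].
  { generalize (cond_pos eps); lra. }
  exists (mkposreal eta (proj1 He)); intros t Ht.
  change (Rabs (t - s) < eta) in Ht. change (Rabs (bval u t - bval u s) < eps).
  eapply Rle_lt_trans; [apply (omega_bound u eta); [apply Hu, He | lra] |].
  generalize (cond_pos eps); lra.
Qed.

Lemma bval_2PI (u : B -> R) (s : R) : bval u (s + 2 * PI) = bval u s.
Proof. unfold bval. rewrite cis_2PI; reflexivity. Qed.

(** * The Dini condition *)

Lemma RInt_periodic (F : R -> R) (T a : R) :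
  (forall s, continuous F s) -> (forall s, F (s + T) = F s) ->
  RInt F 0 T = RInt F a (a + T).
Proof.
  intros Hc Hp.
  assert (I : forall u v, ex_RInt F u v).
  { intros u v; apply (ex_RInt_continuous (V := R_CompleteNormedModule)).
    intros z _; apply Hc. }
  assert (E : RInt F T (a + T) = RInt F 0 a).
  { transitivity (RInt (fun y => scal 1 (F (1 * y + T))) 0 a).
    - symmetry; etransitivity.
      + apply (RInt_comp_lin (V := R_CompleteNormedModule) F 1 T 0 a), I.
      + f_equal; ring.
    - apply RInt_ext; intros x _. rewrite Rmult_1_l, Hp. rewrite Rmult_1_l; reflexivity. }
  assert (C1 := RInt_Chasles F 0 T (a + T) (I _ _) (I _ _)).
  assert (C2 := RInt_Chasles F 0 a (a + T) (I _ _) (I _ _)).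
  unfold plus in C1, C2; simpl in C1, C2. lra.
Qed.

Lemma RInt_symmetric (F : R -> R) (s b : R) :
  (forall s, continuous F s) ->
  RInt F (s - b) (s + b) = RInt (fun t => F (s + t) + F (s - t)) 0 b.
Proof.
  intros Hc.
  assert (I : forall u v, ex_RInt F u v).
  { intros u v; apply (ex_RInt_continuous (V := R_CompleteNormedModule)).
    intros z _; apply Hc. }
  assert (E1 : is_RInt (fun t => F (s + t)) 0 b (RInt F s (s + b))).
  { apply (is_RInt_ext (fun t => scal 1 (F (1 * t + s)))).
    - intros x _. unfold scal; simpl; unfold mult; simpl. rewrite !Rmult_1_l. f_equal; ring.
    - apply (is_RInt_comp_lin F 1 s).
      replace (1 * 0 + s) with s by ring. replace (1 * b + s) with (s + b) by ring.
      apply (RInt_correct (V := R_CompleteNormedModule)), I. }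
  assert (E2 : is_RInt (fun t => F (s - t)) 0 b (RInt F (s - b) s)).
  { rewrite <- (Ropp_involutive (RInt F (s - b) s)).
    apply (is_RInt_ext (fun t => opp (scal (-1) (F (-1 * t + s))))).
    - intros x _. unfold scal, opp; simpl; unfold mult; simpl.
      replace (-1 * x + s) with (s - x) by ring. ring.
    - apply (is_RInt_opp (V := R_NormedModule)).
      apply (is_RInt_comp_lin F (-1) s).
      replace (-1 * 0 + s) with s by ring. replace (-1 * b + s) with (s - b) by ring.
      apply (is_RInt_swap (V := R_NormedModule)).
      apply (RInt_correct (V := R_CompleteNormedModule)), I. }
  rewrite <- (RInt_Chasles F (s - b) s (s + b)) by apply I.
  symmetry. apply is_RInt_unique. rewrite plus_comm.
  apply (is_RInt_plus (V := R_NormedModule)); assumption.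
Qed.

Lemma sin_ge_half (x : R) : 0 <= x <= 1 -> x / 2 <= sin x.
Proof.
  intros Hx. generalize PI2_1; intros.
  (* The Taylor bound sin x >= x - x^3 / 6. *)
  destruct (sin_bound x 0) as [H1 _]; [lra | lra |].
  unfold sin_approx, sin_term in H1; simpl in H1. nra.
Qed.

Lemma cis_minus_r_bounds (r t : R) : 0 <= r < 1 ->
  1 - r <= Cmod (cis t - RtoC r) /\ Rabs (sin t) <= Cmod (cis t - RtoC r).
Proof.
  intros Hr; split.
  - generalize (Cmod_triangle (cis t - RtoC r) (RtoC r)).
    replace (cis t - RtoC r + RtoC r)%C with (cis t) by ring.
    rewrite Cmod_cis, Cmod_R, Rabs_pos_eq; lra.
  - replace (sin t) with (Im (cis t - RtoC r)%C) by (simpl; ring). apply im_le_Cmod.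
Qed.

(** |cis t - r|^2 = 1 - 2 r cos t + r^2 >= 1 - 2 r cos h + r^2 = (r - cos h)^2 + (sin h)^2. *)
Lemma cis_minus_r_far (r h t : R) : 0 <= r -> 0 < h <= 1 -> h <= t <= PI ->
  sin h <= Cmod (cis t - RtoC r).
Proof.
  intros Hr Hh Ht.
  assert (S : 0 <= sin h) by (generalize (sin_ge_half h); lra).
  assert (P2 := PI2_1).
  assert (Cl : cos t <= cos h).
  { destruct (proj1 Ht) as [L | <-]; [| lra].
    apply Rlt_le, cos_decreasing_1; lra. }
  apply Rsqr_incr_0_var; [| apply Cmod_ge_0].
  assert (P : 0 <= r * (cos h - cos t)) by (apply Rmult_le_pos; lra).
  assert (Q := pow2_ge_0 (r - cos h)).
  rewrite !Rsqr_pow2, Cmod2_alt. simpl in Q |- *.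
  generalize (sin2_cos2 h) (sin2_cos2 t); unfold Rsqr; lra.
Qed.

(** The majorant w may be singular at 0 and is integrated only away from it. As G is continuous,
    hence bounded on [0, h], the piece over [0, a] tends to 0 with a. *)
Lemma RInt_small_part (G w : R -> R) (h c e : R) :
  0 < h -> 0 <= c -> (forall s, continuous G s) ->
  (forall x, 0 < x <= h -> G x <= c * w x) ->
  (forall a, 0 < a <= h -> exists l, is_RInt w a h l /\ l <= e) ->
  RInt G 0 h <= c * e.
Proof.
  intros Hh Hc Gc Gw Hw.
  assert (I : forall u v, ex_RInt G u v).
  { intros u v; apply (ex_RInt_continuous (V := R_CompleteNormedModule)).
    intros z _; apply Gc. }
  destruct (bounded_continuity (K := R_AbsRing) (V := R_NormedModule) G 0 h) as [M HM].
  { intros x _; apply Gc. }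
  assert (HM' : forall x, 0 <= x <= h -> G x <= Rabs M).
  { intros x Hx. generalize (HM x Hx) (Rle_abs (G x)) (Rle_abs M).
    unfold norm; simpl; unfold abs; simpl. lra. }
  apply le_epsilon; intros eps Heps.
  assert (PM := Rabs_pos M).
  set (a := Rmin h (eps / (Rabs M + 1))).
  assert (A1 : a <= h) by apply Rmin_l.
  assert (A2 : a <= eps / (Rabs M + 1)) by apply Rmin_r.
  assert (A0 : 0 < a).
  { apply Rmin_pos; [exact Hh |]. apply Rdiv_lt_0_compat; lra. }
  destruct (Hw a (conj A0 A1)) as [l [Il Hl]].
  rewrite <- (RInt_Chasles G 0 a h) by apply I. unfold plus; simpl.
  assert (B1 : RInt G 0 a <= a * Rabs M).
  { replace (a * Rabs M) with (RInt (fun _ => Rabs M) 0 a).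
    - apply RInt_le; [lra | apply I | apply ex_RInt_const |]. intros x Hx; apply HM'; lra.
    - rewrite RInt_const. unfold scal; simpl; unfold mult; simpl; ring. }
  assert (B2 : RInt G a h <= c * l).
  { apply (is_RInt_le G (fun x => c * w x) a h); [exact A1 | | |].
    - apply (RInt_correct (V := R_CompleteNormedModule)), I.
    - apply (is_RInt_scal (V := R_NormedModule) w), Il.
    - intros x Hx; apply Gw; lra. }
  assert (B3 : a * (Rabs M + 1) <= eps).
  { apply (Rmult_le_compat_r (Rabs M + 1)) in A2; [| lra].
    replace (eps / (Rabs M + 1) * (Rabs M + 1)) with eps in A2 by (field; lra). exact A2. }
  nra.
Qed.

Lemma bval_bounded (u : B -> R) : dini disk u ->
  exists M, 0 <= M /\ forall s t, Rabs (s - t) <= PI -> Rabs (bval u s - bval u t) <= M.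
Proof.
  intros Hu. set (W := real (omega disk u (1 / 2))).
  assert (H0 : forall s t, Rabs (s - t) <= 1 / 2 -> Rabs (bval u s - bval u t) <= W).
  { intros s t; apply omega_bound. apply Hu; lra. }
  assert (D : forall e w, (forall s t, Rabs (s - t) <= e -> Rabs (bval u s - bval u t) <= w) ->
     forall s t, Rabs (s - t) <= 2 * e -> Rabs (bval u s - bval u t) <= 2 * w).
  { intros e w He s t Hst.
    assert (H1 := He s ((s + t) / 2)). assert (H2 := He ((s + t) / 2) t).
    replace (s - (s + t) / 2) with ((s - t) * / 2) in H1 by field.
    replace ((s + t) / 2 - t) with ((s - t) * / 2) in H2 by field.
    rewrite Rabs_mult, (Rabs_pos_eq (/ 2)) in H1, H2 by lra.
    specialize (H1 ltac:(lra)). specialize (H2 ltac:(lra)).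
    replace (bval u s - bval u t) with
      ((bval u s - bval u ((s + t) / 2)) + (bval u ((s + t) / 2) - bval u t)) by ring.
    eapply Rle_trans; [apply Rabs_triang | lra]. }
  (* Three doublings through midpoints take arcs of length 1 / 2 to arcs of length 4, which is at
     least PI. *)
  assert (H3 := D _ _ (D _ _ (D _ _ H0))).
  exists (2 * (2 * (2 * W))); split.
  - eapply Rle_trans; [apply Rabs_pos | apply (H3 0 0)]. rewrite Rminus_diag, Rabs_R0; lra.
  - intros s t Hst; apply H3. generalize PI_4; lra.
Qed.

Lemma cis_rotate (s t r : R) :
  Cmod (cis (s + t) - RtoC r * cis s) = Cmod (cis t - RtoC r).
Proof.
  rewrite cis_plus.
  replace (cis s * cis t - RtoC r * cis s)%C with (cis s * (cis t - RtoC r))%C by ring.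
  rewrite Cmod_mult, Cmod_cis; ring.
Qed.

Lemma Cmod_cis_opp_minus (t r : R) : Cmod (cis (- t) - RtoC r) = Cmod (cis t - RtoC r).
Proof.
  rewrite <- (Cmod_conj (cis t - RtoC r)), cis_opp. f_equal.
  apply injective_projections; simpl; ring.
Qed.

(** For [r' = r] the bound on [k] is that of the Poisson kernel; the Dini
    condition is what makes it sufficient for [r' > r]. *)
Lemma dini_kernel (u : B -> R) (eps : R) : dini disk u -> 0 < eps ->
  exists delta, 0 < delta < 1 /\ forall r r' s0 (k : R -> C),
    1 - delta < r -> r <= r' < 1 -> (forall s, ccont k s) ->
    (forall s, k (s + 2 * PI) = k s) ->
    (forall s, Cmod (k s) <= 4 * (1 - r) /
       (Cmod (cis s - RtoC r * cis s0) * Cmod (cis s - RtoC r' * cis s0))) ->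
    Cmod (CRInt (fun s => RtoC (bval u s - bval u s0) * k s)%C 0 (2 * PI)) <= eps.
Proof.
  intros Hu He.
  assert (Hpi := PI_RGT_0). assert (Hpi2 := PI2_1).
  destruct (dini_tail u Hu (eps / 32) ltac:(lra)) as [h [Hh Tail]].
  destruct (bval_bounded u Hu) as [M [M0 HM]].
  assert (Sh : 0 < sin h) by (generalize (sin_ge_half h); lra).
  assert (Sh2 : 0 < sin h * sin h) by nra.
  set (K := 8 * M * PI / (sin h * sin h)).
  assert (HK : 0 <= K).
  { unfold K. apply Rdiv_le_0_compat; [| exact Sh2]. nra. }
  set (delta := Rmin (1 / 2) (eps / (2 * (K + 1)))).
  assert (D1 : delta <= 1 / 2) by apply Rmin_l.
  assert (D2 : delta <= eps / (2 * (K + 1))) by apply Rmin_r.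
  assert (D0 : 0 < delta).
  { apply Rmin_pos; [lra |]. apply Rdiv_lt_0_compat; lra. }
  exists delta; split; [lra |].
  intros r r' s0 k Hr Hr' Kc Kp Kb.
  set (g := fun s => Rabs (bval u s - bval u s0) * Cmod (k s)).
  assert (Gc : forall s, continuous g s).
  { intros s. apply (continuous_mult (K := R_AbsRing)); [| apply continuous_Cmod, Kc].
    apply (continuous_comp (fun s => bval u s - bval u s0) Rabs);
      [| apply continuous_Rabs].
    apply (@continuous_minus _ R_AbsRing R_NormedModule);
      [apply dini_continuous, Hu | apply continuous_const]. }
  assert (Gp : forall s, g (s + 2 * PI) = g s).
  { intros s; unfold g. rewrite bval_2PI, Kp; reflexivity. }
  assert (IG : forall u v, ex_RInt g u v).
  { intros a b; apply (ex_RInt_continuous (V := R_CompleteNormedModule)).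
    intros z _; apply Gc. }
  apply Rle_trans with (RInt g 0 (2 * PI)).
  { apply Cmod_CRInt_le; [lra | | | apply IG].
    - intros s _. rewrite Cmod_mult, Cmod_R. apply Rle_refl.
    - apply ex_CRInt; intros s _. apply continuous_Cmult; [| apply Kc].
      apply continuous_RtoC, (@continuous_minus _ R_AbsRing R_NormedModule);
        [apply dini_continuous, Hu | apply continuous_const]. }
  rewrite (RInt_periodic g (2 * PI) (s0 - PI) Gc Gp).
  replace (s0 - PI + 2 * PI) with (s0 + PI) by ring.
  rewrite (RInt_symmetric g s0 PI Gc).
  set (G := fun t => g (s0 + t) + g (s0 - t)).
  assert (GG : forall t, continuous G t).
  { intros t. apply (@continuous_plus _ R_AbsRing R_NormedModule).
    - apply (continuous_comp (fun t => s0 + t) g); [| apply Gc].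
      apply (@continuous_plus _ R_AbsRing R_NormedModule);
        [apply continuous_const | apply continuous_id].
    - apply (continuous_comp (fun t => s0 - t) g); [| apply Gc].
      apply (@continuous_minus _ R_AbsRing R_NormedModule);
        [apply continuous_const | apply continuous_id]. }
  assert (IGG : forall u v, ex_RInt G u v).
  { intros a b; apply (ex_RInt_continuous (V := R_CompleteNormedModule)).
    intros z _; apply GG. }
  assert (Kt : forall t b, 0 < b -> b * (1 - r) <= Cmod (cis t - RtoC r) * Cmod (cis t - RtoC r') * (1 - r) ->
     Cmod (k (s0 + t)) <= 4 * (1 - r) / b /\ Cmod (k (s0 - t)) <= 4 * (1 - r) / b).
  { intros t b Hb Hbt.
    apply Rmult_le_reg_r in Hbt; [| lra].
    split; (eapply Rle_trans; [apply Kb |]).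
    - rewrite !cis_rotate.
      apply Rmult_le_compat_l; [lra | apply Rinv_le_contravar; assumption].
    - replace (s0 - t) with (s0 + - t) by ring. rewrite !cis_rotate, !Cmod_cis_opp_minus.
      apply Rmult_le_compat_l; [lra | apply Rinv_le_contravar; assumption]. }
  assert (Near : RInt G 0 h <= 16 * (eps / 32)).
  { apply (RInt_small_part G (fun eta => real (omega disk u eta) / eta)); [lra | lra | exact GG | |].
    - intros t Ht.
      (* One factor of the denominator is at least 1 - r and cancels the numerator; the other is at
         least sin t >= t / 2, whatever r' is. What remains is 8 / t, the weight of the Dini
         integral. *)
      destruct (Kt t ((1 - r) * (t / 2))) as [K1 K2]; [nra | |].
      { apply Rmult_le_compat_r; [lra |].
        destruct (cis_minus_r_bounds r t) as [Q1 _]; [lra |].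
        destruct (cis_minus_r_bounds r' t) as [_ Q2]; [lra |].
        apply Rmult_le_compat; [lra | lra | exact Q1 |].
        eapply Rle_trans; [| exact Q2]. eapply Rle_trans; [| apply Rle_abs].
        apply sin_ge_half; lra. }
      replace (4 * (1 - r) / ((1 - r) * (t / 2))) with (8 / t) in K1, K2 by (field; lra).
      assert (Fin : is_finite (omega disk u t)) by (apply Hu; lra).
      assert (O1 : Rabs (bval u (s0 + t) - bval u s0) <= real (omega disk u t)).
      { apply omega_bound; [exact Fin |]. replace (s0 + t - s0) with t by ring.
        rewrite Rabs_pos_eq; lra. }
      assert (O2 : Rabs (bval u (s0 - t) - bval u s0) <= real (omega disk u t)).
      { apply omega_bound; [exact Fin |]. replace (s0 - t - s0) with (- t) by ring.
        rewrite Rabs_Ropp, Rabs_pos_eq; lra. }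
      unfold G, g.
      replace (16 * (real (omega disk u t) / t))
        with (real (omega disk u t) * (8 / t) + real (omega disk u t) * (8 / t)) by (field; lra).
      apply Rplus_le_compat; apply Rmult_le_compat;
        try apply Rabs_pos; try apply Cmod_ge_0; assumption.
    - intros a Ha. apply Tail; lra. }
  assert (Far : RInt G h PI <= PI * (8 * M * (1 - r) / (sin h * sin h))).
  { apply Rle_trans with (RInt (fun _ => 8 * M * (1 - r) / (sin h * sin h)) h PI).
    - apply RInt_le; [lra | apply IGG | apply ex_RInt_const |].
      intros t Ht.
      destruct (Kt t (sin h * sin h)) as [K1 K2]; [exact Sh2 | |].
      { apply Rmult_le_compat_r; [lra |].
        apply Rmult_le_compat; [lra | lra | |]; apply cis_minus_r_far; lra. }
      assert (O1 : Rabs (bval u (s0 + t) - bval u s0) <= M).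
      { apply HM. replace (s0 + t - s0) with t by ring. rewrite Rabs_pos_eq; lra. }
      assert (O2 : Rabs (bval u (s0 - t) - bval u s0) <= M).
      { apply HM. replace (s0 - t - s0) with (- t) by ring.
        rewrite Rabs_Ropp, Rabs_pos_eq; lra. }
      unfold G, g.
      replace (8 * M * (1 - r) / (sin h * sin h))
        with (M * (4 * (1 - r) / (sin h * sin h)) + M * (4 * (1 - r) / (sin h * sin h))) by (field; lra).
      apply Rplus_le_compat; apply Rmult_le_compat;
        try apply Rabs_pos; try apply Cmod_ge_0; assumption.
    - rewrite RInt_const. unfold scal; simpl; unfold mult; simpl.
      apply Rmult_le_compat_r; [| lra].
      apply Rdiv_le_0_compat; [| exact Sh2]. apply Rmult_le_pos; lra. }
  rewrite <- (RInt_Chasles G 0 h PI) by apply IGG. unfold plus; simpl.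
  assert (E : PI * (8 * M * (1 - r) / (sin h * sin h)) = K * (1 - r)).
  { unfold K; field; lra. }
  assert (F : delta * (2 * (K + 1)) <= eps).
  { apply (Rmult_le_compat_r (2 * (K + 1))) in D2; [| lra].
    replace (eps / (2 * (K + 1)) * (2 * (K + 1))) with eps in D2 by (field; lra). exact D2. }
  assert (K * (1 - r) <= K * delta) by (apply Rmult_le_compat_l; lra).
  nra.
Qed.

(** * The Schwarz kernel *)

Definition schwarz_ker (z : C) (s : R) : C := ((cis s + z) / (cis s - z))%C.
(** The derivative of [schwarz_ker] with respect to z. *)
Definition dschwarz_ker (z : C) (s : R) : C :=
  (2 * cis s / ((cis s - z) * (cis s - z)))%C.

Lemma cis_minus_neq_0 (z : C) (s : R) : Cmod z < 1 -> (cis s - z)%C <> 0.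
Proof.
  intros Hz E. assert (Ez : z = cis s).
  { replace z with (cis s - (cis s - z))%C by ring. rewrite E; ring. }
  rewrite Ez, Cmod_cis in Hz; lra.
Qed.

Lemma schwarz_ker_ccont (z : C) (s : R) : Cmod z < 1 -> ccont (schwarz_ker z) s.
Proof.
  intros Hz. apply continuous_Cdiv.
  - apply continuous_Cplus; [apply continuous_cis | apply continuous_Cconst].
  - apply continuous_Cminus; [apply continuous_cis | apply continuous_Cconst].
  - apply cis_minus_neq_0, Hz.
Qed.

Lemma dschwarz_ker_ccont (z : C) (s : R) : Cmod z < 1 -> ccont (dschwarz_ker z) s.
Proof.
  intros Hz. apply continuous_Cdiv.
  - apply continuous_Cmult; [apply continuous_Cconst | apply continuous_cis].
  - apply continuous_Cmult;
    (apply continuous_Cminus; [apply continuous_cis | apply continuous_Cconst]).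
  - apply Cmult_neq_0; apply cis_minus_neq_0, Hz.
Qed.

Lemma mean_value_closed (f : C -> C) :
  (forall w, Cmod w <= 1 -> exists d, Cderiv f w d) ->
  CRInt (fun s => f (cis s)) 0 (2 * PI) = (RtoC (2 * PI) * f 0)%C.
Proof.
  intros H. apply mean_value.
  - intros z Hz eps He. destruct (H z Hz) as [d Hd].
    destruct (Cderiv_continuous _ _ _ Hd eps He) as [delta [Pd Hw]].
    exists delta; split; [exact Pd |]. intros w _; apply Hw.
  - intros z Hz. apply H; lra.
Qed.

Lemma CRInt_conj (f : R -> C) (a b : R) :
  @ex_RInt C_R_CompleteNormedModule f a b ->
  CRInt (fun s => Cconj (f s)) a b = Cconj (CRInt f a b).
Proof.
  intros H. apply (is_RInt_unique (V := C_R_CompleteNormedModule)), is_CRInt_conj.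
  apply (RInt_correct (V := C_R_CompleteNormedModule)), H.
Qed.

Lemma CRInt_Cmult (f : R -> C) (c : C) (a b : R) :
  @ex_RInt C_R_CompleteNormedModule f a b ->
  CRInt (fun s => c * f s)%C a b = (c * CRInt f a b)%C.
Proof.
  intros H. apply (is_RInt_unique (V := C_R_CompleteNormedModule)), is_CRInt_Cmult.
  apply (RInt_correct (V := C_R_CompleteNormedModule)), H.
Qed.

Lemma Cconj_RtoC (a : R) : Cconj (RtoC a) = RtoC a.
Proof. apply injective_projections; simpl; ring. Qed.

Lemma one_minus_conj_neq_0 (z w : C) :
  Cmod z < 1 -> Cmod w <= 1 -> (1 - Cconj z * w)%C <> 0.
Proof.
  intros Hz Hw. replace (1 - Cconj z * w)%C with (1 + Cconj (- z) * w)%C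
    by (destruct z, w; apply injective_projections; simpl; ring).
  apply moebius_den; [rewrite Cmod_opp; exact Hz | exact Hw].
Qed.

Lemma cis_conj (s : R) : Cconj (cis s) = (/ cis s)%C.
Proof.
  assert (H := cis_neq_0 s).
  replace (/ cis s)%C with (/ cis s * (cis s * Cconj (cis s)))%C
    by (rewrite cis_conj_mult; ring).
  field; exact H.
Qed.

Lemma Cderiv_one_minus_inv (c w : C) : (1 - c * w)%C <> 0 ->
  exists d, Cderiv (fun w => / (1 - c * w))%C w d.
Proof.
  intros H. eexists.
  apply (Cderiv_comp (fun w => / w)%C (fun w => 1 - c * w)%C); [apply Cderiv_inv, H |].
  apply (Cderiv_plus (fun _ => RtoC 1) (fun w => - (c * w))%C); [apply Cderiv_const |].
  apply (@is_derive_opp C_AbsRing (AbsRing_NormedModule C_AbsRing) (fun w => c * w)%C).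
  apply (Cderiv_mult (fun _ => c) (fun w => w)); [apply Cderiv_const | apply Cderiv_id].
Qed.

(** As a function of t the kernel has a pole at z inside the disk. On the circle conj t = 1 / t, so
    its conjugate is (1 + conj z t) / (1 - conj z t), holomorphic across the closed disk with value
    1 at t = 0, and the mean value property applies. *)
Lemma CRInt_schwarz_ker (z : C) : Cmod z < 1 ->
  CRInt (schwarz_ker z) 0 (2 * PI) = RtoC (2 * PI).
Proof.
  intros Hz.
  set (f := fun w => ((1 + Cconj z * w) * / (1 - Cconj z * w))%C).
  assert (E : CRInt (schwarz_ker z) 0 (2 * PI)
              = CRInt (fun s => Cconj (f (cis s))) 0 (2 * PI)).
  { apply CRInt_ext; intros s _. unfold f, schwarz_ker.
    rewrite <- (Cconj_conj ((cis s + z) / (cis s - z))). apply f_equal.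
    assert (H1 := cis_minus_neq_0 z s Hz). assert (H2 := cis_neq_0 s).
    assert (H3 : (1 - Cconj z * cis s)%C <> 0)
      by (apply one_minus_conj_neq_0; [exact Hz | rewrite Cmod_cis; lra]).
    rewrite Cdiv_conj, Cplus_conj, Cminus_conj, cis_conj by exact H1.
    field. repeat split; assumption. }
  assert (M : CRInt (fun s => f (cis s)) 0 (2 * PI) = RtoC (2 * PI)).
  { rewrite mean_value_closed.
    - unfold f. field.
    - intros w Hw.
      destruct (Cderiv_one_minus_inv (Cconj z) w (one_minus_conj_neq_0 z w Hz Hw)) as [d Hd].
      eexists. apply (Cderiv_mult (fun w => 1 + Cconj z * w)%C); [| exact Hd].
      apply (Cderiv_plus (fun _ => RtoC 1) (fun w => Cconj z * w)%C); [apply Cderiv_const |].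
      apply (Cderiv_mult (fun _ => Cconj z) (fun w => w)); [apply Cderiv_const | apply Cderiv_id]. }
  rewrite E, CRInt_conj, M; [apply Cconj_RtoC |].
  apply ex_CRInt; intros s _. unfold f.
  apply continuous_Cdiv.
  - apply continuous_Cplus; [apply continuous_Cconst |].
    apply continuous_Cmult; [apply continuous_Cconst | apply continuous_cis].
  - apply continuous_Cminus; [apply continuous_Cconst |].
    apply continuous_Cmult; [apply continuous_Cconst | apply continuous_cis].
  - apply one_minus_conj_neq_0; [exact Hz | rewrite Cmod_cis; lra].
Qed.

(** By the same reflection the conjugate of the kernel is 2 t / (1 - conj z t)^2, which vanishes at
    t = 0. *)
Lemma CRInt_dschwarz_ker (z : C) : Cmod z < 1 ->
  CRInt (dschwarz_ker z) 0 (2 * PI) = 0.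
Proof.
  intros Hz.
  set (f := fun w => (2 * w * (/ (1 - Cconj z * w) * / (1 - Cconj z * w)))%C).
  assert (E : CRInt (dschwarz_ker z) 0 (2 * PI)
              = CRInt (fun s => Cconj (f (cis s))) 0 (2 * PI)).
  { apply CRInt_ext; intros s _. unfold f, dschwarz_ker.
    rewrite <- (Cconj_conj (_ / _)). apply f_equal.
    assert (H1 := cis_minus_neq_0 z s Hz). assert (H2 := cis_neq_0 s).
    assert (H3 : (1 - Cconj z * cis s)%C <> 0)
      by (apply one_minus_conj_neq_0; [exact Hz | rewrite Cmod_cis; lra]).
    rewrite Cdiv_conj, !Cmult_conj, Cminus_conj, cis_conj, Cconj_RtoC
      by (apply Cmult_neq_0; exact H1).
    field. repeat split; assumption. }
  assert (M : CRInt (fun s => f (cis s)) 0 (2 * PI) = 0).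
  { rewrite mean_value_closed.
    - unfold f. ring.
    - intros w Hw.
      destruct (Cderiv_one_minus_inv (Cconj z) w (one_minus_conj_neq_0 z w Hz Hw)) as [d Hd].
      eexists. apply (Cderiv_mult (fun w => 2 * w)%C).
      + apply (Cderiv_mult (fun _ => RtoC 2) (fun w => w)); [apply Cderiv_const | apply Cderiv_id].
      + apply Cderiv_mult; exact Hd. }
  rewrite E, CRInt_conj, M; [apply Cconj_RtoC |].
  apply ex_CRInt; intros s _. unfold f.
  assert (Hi : ccont (fun s => / (1 - Cconj z * cis s))%C s).
  { apply continuous_Cinv.
    - apply continuous_Cminus; [apply continuous_Cconst |].
      apply continuous_Cmult; [apply continuous_Cconst | apply continuous_cis].
    - apply one_minus_conj_neq_0; [exact Hz | rewrite Cmod_cis; lra]. }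
  apply continuous_Cmult.
  - apply continuous_Cmult; [apply continuous_Cconst | apply continuous_cis].
  - apply continuous_Cmult; exact Hi.
Qed.

(** * Means of the data against a kernel *)

Definition cmean (u : B -> R) (k : R -> C) : C :=
  (/ RtoC (2 * PI) * CRInt (fun s => RtoC (bval u s) * k s)%C 0 (2 * PI))%C.

Lemma RtoC_2PI_neq_0 : RtoC (2 * PI) <> 0.
Proof. intros H; apply RtoC_inj in H. generalize PI_RGT_0; lra. Qed.

Lemma bval_ccont (u : B -> R) (k : R -> C) (s : R) :
  dini disk u -> ccont k s -> ccont (fun s => RtoC (bval u s) * k s)%C s.
Proof.
  intros Hu Hk. apply continuous_Cmult; [| exact Hk].
  apply continuous_RtoC, dini_continuous, Hu.
Qed.

Lemma ex_bval (u : B -> R) (k : R -> C) (a b : R) :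
  dini disk u -> (forall s, ccont k s) ->
  @ex_RInt C_R_CompleteNormedModule (fun s => RtoC (bval u s) * k s)%C a b.
Proof. intros Hu Hk; apply ex_CRInt; intros s _. apply bval_ccont; auto. Qed.

Lemma cmean_minus (u : B -> R) (k l : R -> C) :
  dini disk u -> (forall s, ccont k s) -> (forall s, ccont l s) ->
  cmean u (fun s => k s - l s)%C = (cmean u k - cmean u l)%C.
Proof.
  intros Hu Hk Hl. unfold cmean.
  replace (CRInt (fun s => RtoC (bval u s) * (k s - l s))%C 0 (2 * PI))
    with (CRInt (fun s => RtoC (bval u s) * k s)%C 0 (2 * PI)
          - CRInt (fun s => RtoC (bval u s) * l s)%C 0 (2 * PI))%C; [ring |].
  rewrite <- CRInt_minus by (apply ex_bval; assumption).
  apply CRInt_ext; intros s _; ring.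
Qed.

Lemma cmean_Cmult (u : B -> R) (k : R -> C) (c : C) :
  dini disk u -> (forall s, ccont k s) ->
  cmean u (fun s => c * k s)%C = (c * cmean u k)%C.
Proof.
  intros Hu Hk. unfold cmean.
  rewrite (CRInt_ext _ (fun s => c * (RtoC (bval u s) * k s))%C) by (intros; ring).
  rewrite CRInt_Cmult by (apply ex_bval; assumption). ring.
Qed.

Lemma Cmod_inv_2PI_le (c : C) : Cmod (/ RtoC (2 * PI) * c) <= Cmod c.
Proof.
  rewrite Cmod_mult, Cmod_inv, Cmod_R by apply RtoC_2PI_neq_0.
  rewrite Rabs_pos_eq by (generalize PI_RGT_0; lra).
  assert (H : / (2 * PI) <= 1).
  { rewrite <- Rinv_1. apply Rinv_le_contravar; [lra |]. generalize PI2_1; lra. }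
  generalize (Cmod_ge_0 c); nra.
Qed.

(** Brings in the difference u - u(s0), to which [dini_kernel] applies; the correction is the mean
    of k, known for every kernel used below. *)
Lemma cmean_shift (u : B -> R) (k : R -> C) (s0 : R) :
  dini disk u -> (forall s, ccont k s) ->
  (/ RtoC (2 * PI) * CRInt (fun s => RtoC (bval u s - bval u s0) * k s)%C 0 (2 * PI))%C
  = (cmean u k - RtoC (bval u s0) * (/ RtoC (2 * PI) * CRInt k 0 (2 * PI)))%C.
Proof.
  intros Hu Hk. unfold cmean.
  assert (Ik : @ex_RInt C_R_CompleteNormedModule k 0 (2 * PI)) by (apply ex_CRInt; auto).
  rewrite (CRInt_ext _ (fun s => RtoC (bval u s) * k s - RtoC (bval u s0) * k s)%C)
    by (intros; rewrite RtoC_minus; ring).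
  rewrite CRInt_minus, CRInt_Cmult.
  - ring.
  - exact Ik.
  - apply ex_bval; assumption.
  - apply ex_CRInt; intros s _. apply continuous_Cmult; [apply continuous_Cconst | apply Hk].
Qed.

Lemma Cmod_r_cis (r s : R) : 0 <= r -> Cmod (RtoC r * cis s) = r.
Proof. intros Hr. rewrite Cmod_mult, Cmod_cis, Cmod_R, Rabs_pos_eq; lra. Qed.

Lemma schwarz_ker_periodic (z : C) (s : R) :
  schwarz_ker z (s + 2 * PI) = schwarz_ker z s.
Proof. unfold schwarz_ker; rewrite cis_2PI; reflexivity. Qed.

Lemma dschwarz_ker_periodic (z : C) (s : R) :
  dschwarz_ker z (s + 2 * PI) = dschwarz_ker z s.
Proof. unfold dschwarz_ker; rewrite cis_2PI; reflexivity. Qed.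

Lemma Re_schwarz_ker (z : C) (s : R) : Cmod z < 1 ->
  Re (schwarz_ker z s) = (1 - Cmod z ^ 2) / Cmod (cis s - z) ^ 2.
Proof.
  intros Hz. unfold schwarz_ker, Cdiv. rewrite Cinv_Cconj.
  assert (P : 0 < Cmod (cis s - z)) by (apply Cmod_gt_0, cis_minus_neq_0, Hz).
  apply (Rmult_eq_reg_r (Cmod (cis s - z) ^ 2)); [| apply pow_nonzero; lra].
  unfold Rdiv at 1. rewrite Rmult_assoc, Rinv_l, Rmult_1_r by (apply pow_nonzero; lra).
  replace ((cis s + z) * (RtoC (/ Cmod (cis s - z) ^ 2) * Cconj (cis s - z)))%C
    with (RtoC (/ Cmod (cis s - z) ^ 2) * ((cis s + z) * Cconj (cis s - z)))%C by ring.
  assert (Er : forall (a : R) (b : C), Re (RtoC a * b)%C = a * Re b).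
  { intros a [? ?]; simpl; ring. }
  rewrite Er.
  replace (/ Cmod (cis s - z) ^ 2 * Re ((cis s + z) * Cconj (cis s - z))%C * Cmod (cis s - z) ^ 2)
    with (Re ((cis s + z) * Cconj (cis s - z))%C) by (field; lra).
  rewrite Cmod2_alt. destruct z as [x y]; simpl.
  generalize (sin2_cos2 s); unfold Rsqr. nra.
Qed.

(** Only the real part of the kernel, the Poisson kernel, is handed to [dini_kernel]; the full
    Schwarz kernel violates the required bound away from s0. The replacement is legitimate since u
    is real. *)
Lemma Re_schwarz_lim (u : B -> R) (eps : R) : dini disk u -> 0 < eps ->
  exists delta, 0 < delta < 1 /\ forall r s, 1 - delta < r < 1 ->
    Rabs (Re (cmean u (schwarz_ker (RtoC r * cis s))) - bval u s) <= eps.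
Proof.
  intros Hu He. destruct (dini_kernel u eps Hu He) as [delta [Hd H]].
  exists delta; split; [exact Hd |]; intros r s0 Hr.
  set (z := (RtoC r * cis s0)%C).
  assert (Mz : Cmod z = r) by (apply Cmod_r_cis; lra).
  assert (Hz : Cmod z < 1) by lra.
  assert (Kc := fun s => schwarz_ker_ccont z s Hz).
  specialize (H r r s0 (fun s => RtoC (Re (schwarz_ker z s)))).
  assert (E := cmean_shift u (schwarz_ker z) s0 Hu Kc).
  rewrite CRInt_schwarz_ker, Cinv_l, Cmult_1_r in E by (exact Hz || apply RtoC_2PI_neq_0).
  apply (f_equal Re) in E.
  replace (Re (cmean u (schwarz_ker z)) - bval u s0)
    with (Re (cmean u (schwarz_ker z) - RtoC (bval u s0))%C) by reflexivity.
  rewrite <- E.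
  set (d := fun s => bval u s - bval u s0).
  assert (Id : forall k : R -> C, (forall s, ccont k s) ->
     @ex_RInt C_R_CompleteNormedModule (fun s => RtoC (d s) * k s)%C 0 (2 * PI)).
  { intros k Hk. apply ex_CRInt; intros s _. apply continuous_Cmult; [| apply Hk].
    apply continuous_RtoC, (@continuous_minus _ R_AbsRing R_NormedModule);
      [apply dini_continuous, Hu | apply continuous_const]. }
  assert (Kr : forall s, ccont (fun s => RtoC (Re (schwarz_ker z s))) s).
  { intros s; apply continuous_RtoC, continuous_Re, Kc. }
  assert (F : Re (CRInt (fun s => RtoC (d s) * schwarz_ker z s)%C 0 (2 * PI))
    = Re (CRInt (fun s => RtoC (d s) * RtoC (Re (schwarz_ker z s)))%C 0 (2 * PI))).
  { rewrite !CRInt_components by (apply Id; assumption). simpl.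
    apply RInt_ext; intros s _. simpl; ring. }
  assert (Er : forall b : C, Re (/ RtoC (2 * PI) * b)%C = / (2 * PI) * Re b).
  { intros [? ?]. rewrite <- RtoC_inv by (generalize PI_RGT_0; lra). simpl; ring. }
  unfold d in F. rewrite Er, F, <- Er.
  eapply Rle_trans; [apply re_le_Cmod |].
  eapply Rle_trans; [apply Cmod_inv_2PI_le |].
  apply H; [lra | lra | exact Kr | |].
  - intros s. rewrite schwarz_ker_periodic; reflexivity.
  - intros s. rewrite Re_schwarz_ker by exact Hz. fold z. rewrite Mz, Cmod_R.
    assert (P : 0 < Cmod (cis s - z)) by (apply Cmod_gt_0, cis_minus_neq_0, Hz).
    rewrite Rabs_pos_eq.
    + replace (Cmod (cis s - z) ^ 2) with (Cmod (cis s - z) * Cmod (cis s - z)) by ring.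
      apply Rmult_le_compat_r; [apply Rlt_le, Rinv_0_lt_compat; nra | nra].
    + apply Rdiv_le_0_compat; [nra | apply pow_lt, P].
Qed.

(** With the factor 1 - r^2 <= 2 (1 - r) the derivative kernel has the size of the Poisson kernel,
    and its mean is 0, so subtracting u(s0) changes nothing. *)
Lemma dschwarz_lim (u : B -> R) (eps : R) : dini disk u -> 0 < eps ->
  exists delta, 0 < delta < 1 /\ forall r s, 1 - delta < r < 1 ->
    Cmod (RtoC (1 - r ^ 2) * cmean u (dschwarz_ker (RtoC r * cis s))) <= eps.
Proof.
  intros Hu He. destruct (dini_kernel u eps Hu He) as [delta [Hd H]].
  exists delta; split; [exact Hd |]; intros r s0 Hr.
  set (z := (RtoC r * cis s0)%C).
  assert (Mz : Cmod z = r) by (apply Cmod_r_cis; lra).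
  assert (Hz : Cmod z < 1) by lra.
  assert (Kc := fun s => dschwarz_ker_ccont z s Hz).
  assert (Kc' : forall s, ccont (fun s => RtoC (1 - r ^ 2) * dschwarz_ker z s)%C s).
  { intros s; apply continuous_Cmult; [apply continuous_Cconst | apply Kc]. }
  assert (E := cmean_shift u _ s0 Hu Kc').
  rewrite (CRInt_Cmult (dschwarz_ker z)), CRInt_dschwarz_ker in E
    by (exact Hz || apply ex_CRInt; auto).
  rewrite cmean_Cmult in E by assumption.
  replace (RtoC (1 - r ^ 2) * cmean u (dschwarz_ker z))%C
    with (RtoC (1 - r ^ 2) * cmean u (dschwarz_ker z)
      - RtoC (bval u s0) * (/ RtoC (2 * PI) * (RtoC (1 - r ^ 2) * 0)))%C by ring.
  rewrite <- E.
  eapply Rle_trans; [apply Cmod_inv_2PI_le |].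
  apply (H r r s0); [lra | lra | exact Kc' | |].
  - intros s. rewrite dschwarz_ker_periodic; reflexivity.
  - intros s. fold z. unfold dschwarz_ker.
    assert (N := cis_minus_neq_0 z s Hz).
    assert (P : 0 < Cmod (cis s - z)) by (apply Cmod_gt_0, N).
    rewrite Cmod_mult, Cmod_div, !Cmod_mult, Cmod_cis, !Cmod_R by (apply Cmult_neq_0; exact N).
    rewrite !Rabs_pos_eq by nra.
    unfold Rdiv. rewrite <- Rmult_assoc.
    apply Rmult_le_compat_r; [apply Rlt_le, Rinv_0_lt_compat; nra | nra].
Qed.

(** The difference of the two kernels is 2 t (z - z') / ((t - z) (t - z')) with |z - z'| = r' - r <=
    1 - r; this is where the two radii in [dini_kernel] come from. Both kernels have the same mean,
    so u(s0) drops out. *)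
Lemma schwarz_radial_cauchy (u : B -> R) (eps : R) : dini disk u -> 0 < eps ->
  exists delta, 0 < delta < 1 /\ forall r r' s, 1 - delta < r -> r <= r' < 1 ->
    Cmod (cmean u (schwarz_ker (RtoC r * cis s)) - cmean u (schwarz_ker (RtoC r' * cis s))) <= eps.
Proof.
  intros Hu He. destruct (dini_kernel u eps Hu He) as [delta [Hd H]].
  exists delta; split; [exact Hd |]; intros r r' s0 Hr Hr'.
  set (z := (RtoC r * cis s0)%C). set (z' := (RtoC r' * cis s0)%C).
  assert (Mz : Cmod z = r) by (apply Cmod_r_cis; lra).
  assert (Hz : Cmod z < 1) by lra.
  assert (Mz' : Cmod z' = r') by (apply Cmod_r_cis; lra).
  assert (Hz' : Cmod z' < 1) by lra.
  assert (Kc := fun s => schwarz_ker_ccont z s Hz).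
  assert (Kc' := fun s => schwarz_ker_ccont z' s Hz').
  assert (Kd : forall s, ccont (fun s => schwarz_ker z s - schwarz_ker z' s)%C s).
  { intros s; apply continuous_Cminus; auto. }
  assert (E := cmean_shift u _ s0 Hu Kd).
  rewrite (CRInt_minus (schwarz_ker z)), !CRInt_schwarz_ker in E
    by (assumption || (apply ex_CRInt; auto)).
  rewrite cmean_minus in E by assumption.
  replace (cmean u (schwarz_ker z) - cmean u (schwarz_ker z'))%C
    with (cmean u (schwarz_ker z) - cmean u (schwarz_ker z')
      - RtoC (bval u s0) * (/ RtoC (2 * PI) * (RtoC (2 * PI) - RtoC (2 * PI))))%C by ring.
  rewrite <- E.
  eapply Rle_trans; [apply Cmod_inv_2PI_le |].
  apply (H r r' s0); [lra | lra | exact Kd | |].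
  - intros s. rewrite !schwarz_ker_periodic; reflexivity.
  - intros s. fold z z'. unfold schwarz_ker.
    assert (N := cis_minus_neq_0 z s Hz). assert (N' := cis_minus_neq_0 z' s Hz').
    assert (P : 0 < Cmod (cis s - z)) by (apply Cmod_gt_0, N).
    assert (P' : 0 < Cmod (cis s - z')) by (apply Cmod_gt_0, N').
    replace ((cis s + z) / (cis s - z) - (cis s + z') / (cis s - z'))%C
      with (2 * cis s * (RtoC (r - r') * cis s0) / ((cis s - z) * (cis s - z')))%C
      by (unfold z, z' in *; rewrite RtoC_minus; field; split; assumption).
    rewrite Cmod_div, !Cmod_mult, !Cmod_cis, !Cmod_R by (apply Cmult_neq_0; assumption).
    rewrite (Rabs_pos_eq 2), (Rabs_left1 (r - r')) by lra.
    apply Rmult_le_compat_r; [apply Rlt_le, Rinv_0_lt_compat; nra | lra].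
Qed.

(** * The integral S_disk *)

(** The element a + b rho. *)
Definition mkB (a b : C) : B := ((a + b)%C, (Ci * b)%C).

Lemma pa_mkB (a b : C) : pa (mkB a b) = a.
Proof.
  unfold pa, mkB; simpl fst; simpl snd.
  replace (a + b + Ci * (Ci * b))%C with (a + (1 + Ci * Ci) * b)%C by ring.
  rewrite Ci_Ci; ring.
Qed.

Lemma pb_mkB (a b : C) : pb (mkB a b) = b.
Proof.
  unfold pb, mkB; simpl snd.
  replace (- Ci * (Ci * b))%C with (- (Ci * Ci) * b)%C by ring. rewrite Ci_Ci; ring.
Qed.

Lemma pa_Binv (a : B) : pa a <> 0 -> pa (/ a)%B = (/ pa a)%C.
Proof.
  intros H. unfold Binv. fold (pa a). unfold pa at 1; simpl fst; simpl snd.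
  transitivity (pa a / (pa a * pa a))%C; [| field; exact H].
  unfold pa, Cdiv. destruct a as [x y]; simpl fst; simpl snd. ring.
Qed.

(** (a + b rho)^-1 = 1 / a - (b / a^2) rho, because rho^2 = 0. *)
Lemma pb_Binv (a : B) : pa a <> 0 -> pb (/ a)%B = (- pb a / (pa a * pa a))%C.
Proof.
  intros H. unfold Binv. fold (pa a). unfold pb; simpl snd. unfold Cdiv.
  destruct a as [x y]; simpl snd. ring.
Qed.

Lemma emb_neq_0 (w : C) : w <> 0 -> pa (emb w) <> 0.
Proof. rewrite pa_emb; trivial. Qed.

(** On mu the rho-coordinate has modulus |Im w| <= |w|, so inversion costs just a constant; for
    general elements 1 / |[pa]| gives no such bound. *)
Lemma nB_Binv_emb (w : C) : w <> 0 -> nB (/ emb w)%B <= 2 / Cmod w.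
Proof.
  intros Hw. assert (H := emb_neq_0 w Hw).
  assert (P : 0 < Cmod w) by (apply Cmod_gt_0, Hw).
  unfold nB. rewrite pa_Binv, pb_Binv by exact H. rewrite pa_emb, pb_emb.
  rewrite Cmod_inv, Cmod_div, Cmod_opp, !Cmod_mult, Cmod_opp, Cmod_Ci, Cmod_R
    by (try apply Cmult_neq_0; exact Hw).
  apply (Rmult_le_reg_r (Cmod w * Cmod w)); [nra |].
  replace ((/ Cmod w + 1 * Rabs (Im w) / (Cmod w * Cmod w)) * (Cmod w * Cmod w))
    with (Cmod w + Rabs (Im w)) by (field; lra).
  replace (2 / Cmod w * (Cmod w * Cmod w)) with (2 * Cmod w) by (field; lra).
  generalize (im_le_Cmod w); lra.
Qed.

Definition Bint (g : R -> B) : B :=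
  (CRInt (fun s => fst (g s)) 0 (2 * PI), CRInt (fun s => snd (g s)) 0 (2 * PI)).

Lemma CRInt_plus (f g : R -> C) (a b : R) :
  @ex_RInt C_R_CompleteNormedModule f a b ->
  @ex_RInt C_R_CompleteNormedModule g a b ->
  CRInt (fun x => f x + g x)%C a b = (CRInt f a b + CRInt g a b)%C.
Proof. apply (RInt_plus (V := C_R_CompleteNormedModule)). Qed.

Lemma Bint_mkB (g : R -> B) (f h : R -> C) :
  (forall s, ccont f s) -> (forall s, ccont h s) ->
  (forall s, pa (g s) = f s) -> (forall s, pb (g s) = h s) ->
  Bint g = mkB (CRInt f 0 (2 * PI)) (CRInt h 0 (2 * PI)).
Proof.
  intros Hf Hh Ef Eh. unfold Bint, mkB.
  rewrite <- CRInt_plus, <- CRInt_Cmult by (apply ex_CRInt; auto).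
  apply f_equal2; apply CRInt_ext; intros s _.
  - rewrite fst_pa_pb, Ef, Eh; reflexivity.
  - rewrite snd_pb, Eh; reflexivity.
Qed.

Definition bcont (k : R -> B) : Prop :=
  forall s, ccont (fun s => pa (k s)) s /\ ccont (fun s => pb (k s)) s.

Definition Bmean (u : B -> R) (k : R -> B) : B :=
  mkB (cmean u (fun s => pa (k s))) (cmean u (fun s => pb (k s))).

(** The factor [- i] turns [1 / (2 pi i)] into [1 / (2 pi)]. *)
Definition bker (zeta : B) (s : R) : B :=
  let tau := emb (cis s) in
  ((- Ci)%C *: ((tau + zeta) * / (tau - zeta) * / tau * emb (Ci * cis s)))%B.

Lemma bcont_emb (f : R -> C) : (forall s, ccont f s) -> bcont (fun s => emb (f s)).
Proof.
  intros Hf s; split.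
  - apply (@continuous_ext R_UniformSpace C_R_NormedModule f); [| apply Hf].
    intros t; rewrite pa_emb; reflexivity.
  - apply (@continuous_ext R_UniformSpace C_R_NormedModule (fun t => - Ci * RtoC (Im (f t)))%C).
    + intros t; rewrite pb_emb; reflexivity.
    + apply continuous_Cmult; [apply continuous_Cconst |].
      apply continuous_RtoC, continuous_Im, Hf.
Qed.

Lemma bcont_const (b : B) : bcont (fun _ => b).
Proof. intros s; split; apply continuous_Cconst. Qed.

Lemma bcont_plus (k l : R -> B) : bcont k -> bcont l -> bcont (fun s => k s + l s)%B.
Proof.
  intros Hk Hl s; split.
  - apply (@continuous_ext R_UniformSpace C_R_NormedModule (fun s => pa (k s) + pa (l s))%C).
    + intros t; rewrite pa_plus; reflexivity.
    + exact (continuous_Cplus _ _ _ (proj1 (Hk s)) (proj1 (Hl s))).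
  - apply (@continuous_ext R_UniformSpace C_R_NormedModule (fun s => pb (k s) + pb (l s))%C).
    + intros t; rewrite pb_plus; reflexivity.
    + exact (continuous_Cplus _ _ _ (proj2 (Hk s)) (proj2 (Hl s))).
Qed.

Lemma bcont_minus (k l : R -> B) : bcont k -> bcont l -> bcont (fun s => k s - l s)%B.
Proof.
  intros Hk Hl s; split.
  - apply (@continuous_ext R_UniformSpace C_R_NormedModule (fun s => pa (k s) - pa (l s))%C).
    + intros t; rewrite pa_minus; reflexivity.
    + exact (continuous_Cminus _ _ _ (proj1 (Hk s)) (proj1 (Hl s))).
  - apply (@continuous_ext R_UniformSpace C_R_NormedModule (fun s => pb (k s) - pb (l s))%C).
    + intros t; rewrite pb_minus; reflexivity.
    + exact (continuous_Cminus _ _ _ (proj2 (Hk s)) (proj2 (Hl s))).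
Qed.

Lemma bcont_mult (k l : R -> B) : bcont k -> bcont l -> bcont (fun s => k s * l s)%B.
Proof.
  intros Hk Hl s; split.
  - apply (@continuous_ext R_UniformSpace C_R_NormedModule (fun s => pa (k s) * pa (l s))%C).
    + intros t; rewrite pa_mult; reflexivity.
    + exact (continuous_Cmult _ _ _ (proj1 (Hk s)) (proj1 (Hl s))).
  - apply (@continuous_ext R_UniformSpace C_R_NormedModule
             (fun s => pa (k s) * pb (l s) + pb (k s) * pa (l s))%C).
    + intros t; rewrite pb_mult; reflexivity.
    + exact (continuous_Cplus _ _ _
               (continuous_Cmult _ _ _ (proj1 (Hk s)) (proj2 (Hl s)))
               (continuous_Cmult _ _ _ (proj2 (Hk s)) (proj1 (Hl s)))).
Qed.

Lemma bcont_scal (c : C) (k : R -> B) : bcont k -> bcont (fun s => c *: k s)%B.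
Proof.
  intros Hk s; split.
  - apply (@continuous_ext R_UniformSpace C_R_NormedModule (fun s => c * pa (k s))%C).
    + intros t; rewrite pa_scal; reflexivity.
    + exact (continuous_Cmult _ _ _ (continuous_Cconst c s) (proj1 (Hk s))).
  - apply (@continuous_ext R_UniformSpace C_R_NormedModule (fun s => c * pb (k s))%C).
    + intros t; rewrite pb_scal; reflexivity.
    + exact (continuous_Cmult _ _ _ (continuous_Cconst c s) (proj2 (Hk s))).
Qed.

Lemma bcont_Binv (k : R -> B) :
  bcont k -> (forall s, pa (k s) <> 0) -> bcont (fun s => / k s)%B.
Proof.
  intros Hk H0 s; split.
  - apply (@continuous_ext R_UniformSpace C_R_NormedModule (fun s => / pa (k s))%C).
    + intros t; rewrite pa_Binv by apply H0; reflexivity.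
    + exact (continuous_Cinv _ _ (proj1 (Hk s)) (H0 s)).
  - apply (@continuous_ext R_UniformSpace C_R_NormedModule
             (fun s => - pb (k s) / (pa (k s) * pa (k s)))%C).
    + intros t; rewrite pb_Binv by apply H0; reflexivity.
    + apply continuous_Cdiv.
      * exact (continuous_Copp _ _ (proj2 (Hk s))).
      * exact (continuous_Cmult _ _ _ (proj1 (Hk s)) (proj1 (Hk s))).
      * apply Cmult_neq_0; apply H0.
Qed.

Lemma bcont_tau : bcont (fun s => emb (cis s)).
Proof. apply bcont_emb, continuous_cis. Qed.

Lemma bcont_dtau : bcont (fun s => emb (Ci * cis s)).
Proof.
  apply (bcont_emb (fun s => Ci * cis s)%C); intros s.
  apply continuous_Cmult; [apply continuous_Cconst | apply continuous_cis].
Qed.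

Lemma pa_tau_minus (z : C) (s : R) : Cmod z < 1 -> pa (emb (cis s) - emb z)%B <> 0.
Proof. intros Hz. rewrite <- emb_minus. apply emb_neq_0, cis_minus_neq_0, Hz. Qed.

Lemma pa_tau (s : R) : pa (emb (cis s)) <> 0.
Proof. apply emb_neq_0, cis_neq_0. Qed.

Lemma bker_bcont (z : C) : Cmod z < 1 -> bcont (bker (emb z)).
Proof.
  intros Hz.
  apply (bcont_scal (- Ci)%C (fun s => (emb (cis s) + emb z) * / (emb (cis s) - emb z)
            * / emb (cis s) * emb (Ci * cis s))%B).
  apply (bcont_mult _ (fun s => emb (Ci * cis s))); [| apply bcont_dtau].
  apply (bcont_mult _ (fun s => / emb (cis s))%B).
  - apply (bcont_mult (fun s => emb (cis s) + emb z)%B).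
    + apply bcont_plus; [apply bcont_tau | apply bcont_const].
    + apply (bcont_Binv (fun s => emb (cis s) - emb z)%B); [| intros s; apply pa_tau_minus, Hz].
      apply bcont_minus; [apply bcont_tau | apply bcont_const].
  - apply bcont_Binv; [apply bcont_tau | apply pa_tau].
Qed.

(** The tangent vector - sin s + i cos s is i t in C, hence [emb] (Ci * cis s) in mu. It is not i
    times [emb] (cis s), as [emb] is only real-linear. *)
Lemma S_disk_Bmean (u : B -> R) (z : C) : dini disk u -> Cmod z < 1 ->
  S_disk u (emb z) = Bmean u (bker (emb z)).
Proof.
  intros Hu Hz.
  assert (Kc := bker_bcont z Hz).
  assert (Ca := fun s => proj1 (Kc s)). assert (Cb := fun s => proj2 (Kc s)).
  set (f := fun s => (Ci * (RtoC (bval u s) * pa (bker (emb z) s)))%C).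
  set (h := fun s => (Ci * (RtoC (bval u s) * pb (bker (emb z) s)))%C).
  assert (Hf : forall s, ccont f s).
  { intros s; apply continuous_Cmult; [apply continuous_Cconst | apply bval_ccont; auto]. }
  assert (Hh : forall s, ccont h s).
  { intros s; apply continuous_Cmult; [apply continuous_Cconst | apply bval_ccont; auto]. }
  assert (E : forall s,
     (RtoC (u (muplane (cos s) (sin s))) *:
        ((muplane (cos s) (sin s) + emb z) * / (muplane (cos s) (sin s) - emb z)
          * / muplane (cos s) (sin s)) * muplane (- sin s) (cos s))%B
     = (Ci *: (RtoC (bval u s) *: bker (emb z) s))%B).
  { intros s. change (muplane (cos s) (sin s)) with (emb (cis s)).
    replace (muplane (- sin s) (cos s)) with (emb (Ci * cis s)).
    - fold (bval u s). unfold bker.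
      apply B_ext; rewrite ?pa_scal, ?pb_scal, ?pb_mult, ?pa_mult, ?pa_scal, ?pb_scal,
        ?pb_mult, ?pa_mult.
      + match goal with |- ?l = (Ci * (?v * (- Ci * ?w)))%C =>
          transitivity (- (Ci * Ci) * (v * w))%C; [rewrite Ci_Ci; ring | ring] end.
      + match goal with |- ?l = (Ci * (?v * (- Ci * ?w)))%C =>
          transitivity (- (Ci * Ci) * (v * w))%C; [rewrite Ci_Ci; ring | ring] end.
    - rewrite muplane_emb. apply f_equal. unfold cis; apply injective_projections; simpl; ring. }
  assert (G : Bcircle_int (fun tau => RtoC (u tau) *: ((tau + emb z) * / (tau - emb z) * / tau))%B
      = mkB (CRInt f 0 (2 * PI)) (CRInt h 0 (2 * PI))).
  { apply (Bint_mkB (fun s => (RtoC (u (muplane (cos s) (sin s))) *: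
        ((muplane (cos s) (sin s) + emb z) * / (muplane (cos s) (sin s) - emb z)
          * / muplane (cos s) (sin s)) * muplane (- sin s) (cos s))%B)); [exact Hf | exact Hh | |];
      intros s; rewrite E; unfold f, h; rewrite ?pa_scal, ?pb_scal; reflexivity. }
  unfold S_disk. rewrite G.
  assert (Hi : Ci <> 0) by (intros K; apply (f_equal Im) in K; simpl in K; lra).
  assert (H2 := RtoC_2PI_neq_0).
  assert (Ec : forall x, (/ (2 * PI * Ci) * (Ci * x))%C = (/ RtoC (2 * PI) * x)%C).
  { intros x. rewrite RtoC_mult in *. field. repeat split; try exact Hi;
    intros K; apply H2; rewrite K; ring. }
  unfold Bmean. apply B_ext.
  - rewrite pa_scal, !pa_mkB. unfold f, cmean.
    rewrite CRInt_Cmult by (apply ex_bval; auto). apply Ec.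
  - rewrite pb_scal, !pb_mkB. unfold h, cmean.
    rewrite CRInt_Cmult by (apply ex_bval; auto). apply Ec.
Qed.

Opaque pa pb emb.

(** [pa] is multiplicative and a left inverse of [emb], so it turns the kernel of B into the
    classical one; t^-1 dt / i becomes ds. *)
Lemma pa_S_disk (u : B -> R) (z : C) : dini disk u -> Cmod z < 1 ->
  pa (S_disk u (emb z)) = cmean u (schwarz_ker z).
Proof.
  intros Hu Hz. rewrite S_disk_Bmean by assumption.
  unfold Bmean. rewrite pa_mkB. unfold cmean. f_equal.
  apply CRInt_ext; intros s _. apply f_equal.
  unfold bker, schwarz_ker.
  assert (H1 := pa_tau_minus z s Hz). assert (H2 := pa_tau s).
  rewrite pa_scal, !pa_mult, !pa_Binv by assumption.
  rewrite pa_plus, pa_minus, !pa_emb.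
  assert (H := cis_minus_neq_0 z s Hz). assert (H' := cis_neq_0 s).
  (* For [field] the unit Ci is an indeterminate; writing 1 as - Ci^2 balances its powers on the two
     sides. *)
  transitivity (- (Ci * Ci) * ((cis s + z) / (cis s - z)))%C.
  - field. split; assumption.
  - rewrite Ci_Ci; ring.
Qed.

Lemma pb_emb_conj (w : C) : pb (emb w) = ((Cconj w - w) / 2)%C.
Proof.
  rewrite pb_emb. destruct w as [x y]. apply injective_projections; simpl; field.
Qed.

(** The rho-coordinates of the factors involve conj t and conj z. On the circle conj t = 1 / t,
    which makes the kernel rational in t with double poles at 0 and z; the three terms are its
    partial fractions. The split needs z <> 0 and is used only near the circle. *)
Lemma pb_S_disk (u : B -> R) (z : C) : dini disk u -> Cmod z < 1 -> z <> 0 ->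
  pb (S_disk u (emb z))
  = (cmean u (fun s => / (cis s * cis s)) + cmean u (fun s => / cis s) / z
     - RtoC (1 - Cmod z ^ 2) / (2 * z) * cmean u (dschwarz_ker z))%C.
Proof.
  intros Hu Hz Hz0. rewrite S_disk_Bmean by assumption.
  unfold Bmean. rewrite pb_mkB.
  assert (C1 : forall s, ccont (fun s => / cis s)%C s).
  { intros s; apply continuous_Cinv; [apply continuous_cis | apply cis_neq_0]. }
  assert (C2 : forall s, ccont (fun s => / (cis s * cis s))%C s).
  { intros s; apply continuous_Cinv; [apply continuous_Cmult; apply continuous_cis |].
    apply Cmult_neq_0; apply cis_neq_0. }
  assert (C3 := fun s => dschwarz_ker_ccont z s Hz).
  set (c := (RtoC (1 - Cmod z ^ 2) / (2 * z))%C).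
  assert (C1' : forall s, ccont (fun s => - / z * / cis s)%C s).
  { intros s; apply continuous_Cmult; [apply continuous_Cconst | apply C1]. }
  assert (C3' : forall s, ccont (fun s => c * dschwarz_ker z s)%C s).
  { intros s; apply continuous_Cmult; [apply continuous_Cconst | apply C3]. }
  transitivity (cmean u (fun s => (/ (cis s * cis s) - - / z * / cis s) - c * dschwarz_ker z s)%C).
  - unfold cmean. f_equal. apply CRInt_ext; intros s _. apply f_equal.
    unfold bker, dschwarz_ker.
    assert (H1 := pa_tau_minus z s Hz). assert (H2 := pa_tau s).
    rewrite pb_scal, !pb_mult, !pa_mult, !pa_Binv, !pb_Binv by assumption.
    rewrite pa_plus, pa_minus, pb_plus, pb_minus, !pa_emb, !pb_emb_conj.
    assert (H := cis_minus_neq_0 z s Hz). assert (H' := cis_neq_0 s).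
    assert (Ec : RtoC (1 - Cmod z ^ 2) = (1 - z * Cconj z)%C).
    { rewrite <- Cmod2_conj, RtoC_minus. reflexivity. }
    unfold c. rewrite Ec, Cmult_conj, cis_conj.
    replace (Cconj Ci) with (- Ci)%C by (apply injective_projections; simpl; ring).
    match goal with |- ?l = ?r => transitivity (- (Ci * Ci) * r)%C; [| rewrite Ci_Ci; ring] end.
    field. repeat split; try assumption.
  - rewrite !cmean_minus, !cmean_Cmult; try assumption.
    + field. exact Hz0.
    + intros s; apply continuous_Cminus; auto.
Qed.

Lemma cmean_plus (u : B -> R) (k l : R -> C) :
  dini disk u -> (forall s, ccont k s) -> (forall s, ccont l s) ->
  cmean u (fun s => k s + l s)%C = (cmean u k + cmean u l)%C.
Proof.
  intros Hu Hk Hl. unfold cmean.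
  replace (CRInt (fun s => RtoC (bval u s) * (k s + l s))%C 0 (2 * PI))
    with (CRInt (fun s => RtoC (bval u s) * k s)%C 0 (2 * PI)
          + CRInt (fun s => RtoC (bval u s) * l s)%C 0 (2 * PI))%C; [ring |].
  rewrite <- CRInt_plus by (apply ex_bval; assumption).
  apply CRInt_ext; intros s _; ring.
Qed.

Lemma cmean_ext (u : B -> R) (k l : R -> C) :
  (forall s, k s = l s) -> cmean u k = cmean u l.
Proof.
  intros H. unfold cmean. f_equal. apply CRInt_ext; intros s _. rewrite H; reflexivity.
Qed.

Lemma Bmean_minus (u : B -> R) (k l : R -> B) : dini disk u -> bcont k -> bcont l ->
  Bmean u (fun s => k s - l s)%B = (Bmean u k - Bmean u l)%B.
Proof.
  intros Hu Hk Hl. apply B_ext.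
  - rewrite pa_minus. unfold Bmean. rewrite !pa_mkB, <- cmean_minus;
      [| exact Hu | exact (fun s => proj1 (Hk s)) | exact (fun s => proj1 (Hl s))].
    apply cmean_ext; intros s; apply pa_minus.
  - rewrite pb_minus. unfold Bmean. rewrite !pb_mkB, <- cmean_minus;
      [| exact Hu | exact (fun s => proj2 (Hk s)) | exact (fun s => proj2 (Hl s))].
    apply cmean_ext; intros s; apply pb_minus.
Qed.

Lemma Bmean_mult (u : B -> R) (k : R -> B) (b : B) : dini disk u -> bcont k ->
  Bmean u (fun s => k s * b)%B = (Bmean u k * b)%B.
Proof.
  intros Hu Hk.
  assert (Ca := fun s => proj1 (Hk s)). assert (Cb := fun s => proj2 (Hk s)).
  assert (M : forall (c : C) (f : R -> C), (forall s, ccont f s) ->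
     forall s, ccont (fun s => c * f s)%C s).
  { intros c f Hf s; apply continuous_Cmult; [apply continuous_Cconst | apply Hf]. }
  apply B_ext.
  - rewrite pa_mult. unfold Bmean. rewrite !pa_mkB, Cmult_comm, <- cmean_Cmult; [| auto | auto].
    apply cmean_ext; intros s; rewrite pa_mult; ring.
  - rewrite pb_mult. unfold Bmean. rewrite !pb_mkB, !pa_mkB.
    rewrite (Cmult_comm _ (pb b)), (Cmult_comm _ (pa b)), <- !cmean_Cmult, <- cmean_plus; auto.
    apply cmean_ext; intros s; rewrite pb_mult; ring.
Qed.

Lemma cmean_bound (u : B -> R) : dini disk u ->
  exists M, 0 <= M /\ forall (k : R -> C) K, (forall s, ccont k s) ->
    (forall s, Cmod (k s) <= K) -> Cmod (cmean u k) <= M * K.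
Proof.
  intros Hu. destruct (bval_bounded u Hu) as [M0 [P0 H0]].
  assert (Hpi := PI_RGT_0).
  (* Every angle in [0, 2 PI] is within PI of the angle PI, the range covered by [bval_bounded]. *)
  exists (Rabs (bval u PI) + M0); split; [generalize (Rabs_pos (bval u PI)); lra |].
  intros k K Kc HK.
  unfold cmean. rewrite Cmod_mult, Cmod_inv, Cmod_R by apply RtoC_2PI_neq_0.
  rewrite Rabs_pos_eq by lra.
  apply (Rmult_le_reg_l (2 * PI)); [lra |].
  rewrite <- Rmult_assoc, Rinv_r, Rmult_1_l by lra.
  eapply Rle_trans; [apply (Cmod_CRInt_le_const _ 0 (2 * PI) ((Rabs (bval u PI) + M0) * K)) |].
  - lra.
  - intros s Hs. rewrite Cmod_mult, Cmod_R.
    apply Rmult_le_compat; [apply Rabs_pos | apply Cmod_ge_0 | | apply HK].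
    replace (bval u s) with (bval u PI + (bval u s - bval u PI)) by ring.
    eapply Rle_trans; [apply Rabs_triang |]. apply Rplus_le_compat_l, H0.
    apply Rabs_le; lra.
  - apply ex_bval; assumption.
  - lra.
Qed.

Lemma Bmean_bound (u : B -> R) : dini disk u ->
  exists M, 0 <= M /\ forall (k : R -> B) K, bcont k ->
    (forall s, nB (k s) <= K) -> nB (Bmean u k) <= M * K.
Proof.
  intros Hu. destruct (cmean_bound u Hu) as [M [P H]].
  exists (2 * M); split; [lra |]. intros k K Kc HK.
  unfold nB, Bmean. rewrite pa_mkB, pb_mkB.
  assert (H1 : Cmod (cmean u (fun s => pa (k s))) <= M * K).
  { apply H; [exact (fun s => proj1 (Kc s)) |]. intros s; eapply Rle_trans; [| apply (HK s)].
    unfold nB; generalize (Cmod_ge_0 (pb (k s))); lra. }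
  assert (H2 : Cmod (cmean u (fun s => pb (k s))) <= M * K).
  { apply H; [exact (fun s => proj2 (Kc s)) |]. intros s; eapply Rle_trans; [| apply (HK s)].
    unfold nB; generalize (Cmod_ge_0 (pa (k s))); lra. }
  lra.
Qed.

(** The derivative of [bker] with respect to zeta: from 2 tau (tau - zeta)^-2 tau^-1 the factors tau
    and tau^-1 are cancelled. *)
Definition dbker (zeta : B) (s : R) : B :=
  let a := (emb (cis s) - zeta)%B in
  ((- Ci * 2)%C *: (/ a * / a * emb (Ci * cis s)))%B.

Lemma dbker_bcont (z : C) : Cmod z < 1 -> bcont (dbker (emb z)).
Proof.
  intros Hz.
  assert (I : bcont (fun s => / (emb (cis s) - emb z))%B).
  { apply (bcont_Binv (fun s => emb (cis s) - emb z)%B); [| intros s; apply pa_tau_minus, Hz].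
    apply bcont_minus; [apply bcont_tau | apply bcont_const]. }
  apply (bcont_scal _ (fun s => / (emb (cis s) - emb z) * / (emb (cis s) - emb z)
           * emb (Ci * cis s))%B).
  apply (bcont_mult _ (fun s => emb (Ci * cis s))); [| apply bcont_dtau].
  apply (bcont_mult (fun s => / (emb (cis s) - emb z))%B); exact I.
Qed.

(** The error of the difference quotient contains the factor [emb] w, with the other factors bounded
    uniformly in s for small w; this justifies differentiation under the integral. *)
Lemma bker_quotient (z w : C) (s : R) : Cmod z < 1 -> Cmod (z + w) < 1 -> w <> 0 ->
  ((bker (emb z + emb w) s - bker (emb z) s) * / emb w - dbker (emb z) s)%B
  = ((- Ci * 2)%C *: (emb w * / (emb (cis s) - emb z) * / (emb (cis s) - emb z)
       * / (emb (cis s) - emb (z + w)) * emb (Ci * cis s)))%B.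
Proof.
  intros Hz Hzw Hw.
  rewrite <- emb_plus. unfold bker, dbker.
  assert (H1 := pa_tau_minus z s Hz). assert (H2 := pa_tau_minus (z + w) s Hzw).
  assert (H3 := pa_tau s). assert (H4 := emb_neq_0 w Hw).
  assert (Ea : pa (emb (z + w)) = (pa (emb z) + pa (emb w))%C).
  { rewrite emb_plus; apply pa_plus. }
  assert (Eb : pb (emb (z + w)) = (pb (emb z) + pb (emb w))%C).
  { rewrite emb_plus; apply pb_plus. }
  apply B_ext;
  rewrite ?pa_minus, ?pb_minus, ?pa_mult, ?pb_mult, ?pa_minus, ?pb_minus, ?pa_scal, ?pb_scal,
    ?pa_mult, ?pb_mult, ?pa_mult, ?pb_mult, ?pa_Binv, ?pb_Binv by assumption;
  rewrite ?pa_minus in *; rewrite ?pa_plus, ?pb_plus, ?pa_minus, ?pb_minus in *;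
  rewrite ?Ea, ?Eb in *; field; repeat split; assumption.
Qed.

(** * Difference quotients along mu *)

Definition quotient_lim (Phi : B -> B) (z : C) (d : B) : Prop :=
  forall eps, 0 < eps -> exists delta, 0 < delta /\
    forall w : C, w <> 0 -> Cmod w < delta ->
      nB (((Phi (emb z + emb w) - Phi (emb z)) * / emb w - d)%B) < eps.

Lemma S_disk_quotient_lim (u : B -> R) (z : C) : dini disk u -> Cmod z < 1 ->
  exists d, quotient_lim (S_disk u) z d.
Proof.
  intros Hu Hz. exists (Bmean u (dbker (emb z))).
  intros eps He. destruct (Bmean_bound u Hu) as [M [PM HM]].
  set (e := 1 - Cmod z). assert (Pe : 0 < e) by (unfold e; lra).
  (* Twice the product of the bounds for the factors in [bker_quotient]: the scalar 2, 2 |w| for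
     [emb] w, 2 / e for two inverses, 4 / e for the third and 2 for the tangent. Here e is the
     distance from z to the circle, and |w| < e / 2 keeps z + w at distance e / 2. *)
  set (K := 4 * 2 * (2 / e) * (2 / e) * (4 / e) * 2).
  assert (P2e : 0 < 2 / e) by (apply Rdiv_lt_0_compat; lra).
  assert (P4e : 0 < 4 / e) by (apply Rdiv_lt_0_compat; lra).
  assert (PK : 0 < K) by (unfold K; repeat apply Rmult_lt_0_compat; lra).
  assert (PMK : 0 <= M * K) by nra.
  exists (Rmin (e / 2) (eps / (M * K + 1))); split.
  { apply Rmin_pos; [lra | apply Rdiv_lt_0_compat; lra]. }
  intros w Hw Bw.
  assert (B1 := Rlt_le_trans _ _ _ Bw (Rmin_l _ _)).
  assert (B2 := Rlt_le_trans _ _ _ Bw (Rmin_r _ _)).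
  assert (Hzw : Cmod (z + w) < 1).
  { generalize (Cmod_triangle z w). unfold e in *; lra. }
  rewrite <- emb_plus, !S_disk_Bmean by assumption.
  rewrite <- Bmean_minus, <- Bmean_mult, <- Bmean_minus.
  - assert (Q : nB (Bmean u (fun s => (bker (emb (z + w)) s - bker (emb z) s) * / emb w
                     - dbker (emb z) s)%B) <= M * (K * Cmod w)).
    { apply HM.
      - apply (bcont_minus (fun s => (bker (emb (z + w)) s - bker (emb z) s) * / emb w)%B);
          [| apply dbker_bcont, Hz].
        apply (bcont_mult (fun s => bker (emb (z + w)) s - bker (emb z) s)%B);
          [apply bcont_minus; apply bker_bcont; assumption | apply bcont_const].
      - intros s. rewrite emb_plus, bker_quotient by assumption.
        rewrite nB_scal, Cmod_mult, Cmod_opp, Cmod_Ci, Cmod_R, Rabs_pos_eq by lra.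
        assert (L1 : e <= Cmod (cis s - z)).
        { generalize (Cmod_triangle (cis s - z) z).
          replace (cis s - z + z)%C with (cis s) by ring. rewrite Cmod_cis; unfold e; lra. }
        assert (L2 : e / 2 <= Cmod (cis s - (z + w))).
        { generalize (Cmod_triangle (cis s - (z + w)) w).
          replace (cis s - (z + w) + w)%C with (cis s - z)%C by ring. lra. }
        assert (I1 : nB (/ (emb (cis s) - emb z))%B <= 2 / e).
        { rewrite <- emb_minus. eapply Rle_trans; [apply nB_Binv_emb, cis_minus_neq_0, Hz |].
          apply Rmult_le_compat_l; [lra | apply Rinv_le_contravar; lra]. }
        assert (I2 : nB (/ (emb (cis s) - emb (z + w)))%B <= 4 / e).
        { rewrite <- emb_minus. eapply Rle_trans; [apply nB_Binv_emb, cis_minus_neq_0, Hzw |].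
          replace (4 / e) with (2 * / (e / 2)) by (field; lra).
          apply Rmult_le_compat_l; [lra | apply Rinv_le_contravar; lra]. }
        assert (I3 : nB (emb w) <= 2 * Cmod w) by apply nB_emb.
        assert (I4 : nB (emb (Ci * cis s)) <= 2).
        { eapply Rle_trans; [apply nB_emb |]. rewrite Cmod_mult, Cmod_Ci, Cmod_cis; lra. }
        assert (Step : forall a b x y, nB a <= x -> nB b <= y -> nB (a * b)%B <= x * y).
        { intros a b x y Ha Hb. eapply Rle_trans; [apply nB_mult |].
          apply Rmult_le_compat; try apply nB_pos; assumption. }
        apply Rle_trans with (1 * 2 * (2 * Cmod w * (2 / e) * (2 / e) * (4 / e) * 2)).
        + apply Rmult_le_compat_l; [lra |]. repeat apply Step; assumption.
        + unfold K. generalize (Cmod_ge_0 w); intros.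
          replace (1 * 2 * (2 * Cmod w * (2 / e) * (2 / e) * (4 / e) * 2))
            with (8 * (2 / e) * (2 / e) * (4 / e) * Cmod w) by (field; lra).
          replace (4 * 2 * (2 / e) * (2 / e) * (4 / e) * 2 * Cmod w)
            with (16 * (2 / e) * (2 / e) * (4 / e) * Cmod w) by (field; lra).
          apply Rmult_le_compat_r; [assumption |].
          repeat (apply Rmult_le_compat_r; [lra |]). lra. }
    eapply Rle_lt_trans; [exact Q |].
    apply (Rmult_lt_compat_r (M * K + 1)) in B2; [| lra].
    replace (eps / (M * K + 1) * (M * K + 1)) with eps in B2 by (field; lra).
    generalize (Cmod_ge_0 w); nra.
  - exact Hu.
  - apply (bcont_mult (fun s => bker (emb (z + w)) s - bker (emb z) s)%B);
      [apply bcont_minus; apply bker_bcont; assumption | apply bcont_const].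
  - apply dbker_bcont, Hz.
  - exact Hu.
  - apply bcont_minus; apply bker_bcont; assumption.
  - exact Hu.
  - apply bker_bcont, Hzw.
  - apply bker_bcont, Hz.
Qed.

(** * Extension to the closed disk *)

Lemma polar_unit (z : C) : Cmod z = 1 -> exists s, z = cis s.
Proof.
  destruct z as [x y]; intros H.
  assert (E : x * x + y * y = 1).
  { assert (K := Cmod2_alt (x, y)). rewrite H in K. simpl in K. lra. }
  assert (Hx : -1 <= x <= 1) by nra.
  assert (Hs : sin (acos x) = sqrt (y * y)).
  { rewrite sin_acos by exact Hx. f_equal. unfold Rsqr; lra. }
  assert (Ha : sqrt (y * y) = Rabs y) by apply (sqrt_Rsqr_abs y).
  destruct (Rle_dec 0 y) as [Hy | Hy].
  - exists (acos x). unfold cis. rewrite cos_acos, Hs, Ha, Rabs_pos_eq by assumption.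
    reflexivity.
  - exists (- acos x). unfold cis. rewrite cos_neg, sin_neg, cos_acos, Hs, Ha, Rabs_left1 by lra.
    rewrite Ropp_involutive; reflexivity.
Qed.

Lemma polar (z : C) : exists s, z = (RtoC (Cmod z) * cis s)%C.
Proof.
  destruct (Req_dec (Cmod z) 0) as [H | H].
  - exists 0. rewrite H. rewrite (Cmod_eq_0 z H). ring.
  - assert (H0 : RtoC (Cmod z) <> 0) by (intros K; apply RtoC_inj in K; contradiction).
    destruct (polar_unit (z / RtoC (Cmod z))) as [s Hs].
    { rewrite Cmod_div, Cmod_R, Rabs_pos_eq by (exact H0 || apply Cmod_ge_0). field; exact H. }
    exists s. rewrite <- Hs. field; exact H0.
Qed.

(** The angle s is quantified after delta: this uniformity is what makes the limit function
    continuous along the circle. *)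
Definition radially_cauchy (f : C -> C) : Prop :=
  forall eps, 0 < eps -> exists delta, 0 < delta < 1 /\
    forall r r' s, 1 - delta < r -> r <= r' < 1 ->
      Cmod (f (RtoC r * cis s)%C - f (RtoC r' * cis s)%C) <= eps.

Definition ccont_open_disc (f : C -> C) : Prop :=
  forall z, Cmod z < 1 -> forall eps, 0 < eps ->
  exists delta, 0 < delta /\ forall w, Cmod (w - z) < delta -> Cmod (f w - f z) < eps.

Lemma is_lim_seq_le_Rabs (x : nat -> R) (c eps : R) (N : nat) :
  ex_finite_lim_seq x -> (forall n, (N <= n)%nat -> Rabs (x n - c) <= eps) ->
  Rabs (real (Lim_seq x) - c) <= eps.
Proof.
  intros Hx H. assert (L := Lim_seq_correct' x Hx).
  assert (U : Rbar_le (real (Lim_seq x)) (c + eps)).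
  { apply (is_lim_seq_le_loc x (fun _ => c + eps)); [| exact L | apply is_lim_seq_const].
    exists N; intros n Hn. specialize (H n Hn). apply Rabs_le_between in H. lra. }
  assert (V : Rbar_le (c - eps) (real (Lim_seq x))).
  { apply (is_lim_seq_le_loc (fun _ => c - eps) x); [| apply is_lim_seq_const | exact L].
    exists N; intros n Hn. specialize (H n Hn). apply Rabs_le_between in H. lra. }
  simpl in U, V. apply Rabs_le; lra.
Qed.

Definition radius (n : nat) : R := 1 - / (INR n + 2).

Lemma radius_bounds (n : nat) : 0 < radius n < 1.
Proof.
  unfold radius. assert (H := pos_INR n).
  assert (0 < / (INR n + 2)) by (apply Rinv_0_lt_compat; lra).
  assert (/ (INR n + 2) <= / 2) by (apply Rinv_le_contravar; lra). lra.
Qed.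

Lemma radius_mono (n m : nat) : (n <= m)%nat -> radius n <= radius m.
Proof.
  intros H. apply le_INR in H. unfold radius. assert (P := pos_INR n).
  assert (/ (INR m + 2) <= / (INR n + 2)) by (apply Rinv_le_contravar; lra). lra.
Qed.

Lemma radius_large (r : R) : r < 1 -> exists N, r < radius N.
Proof.
  intros H. destruct (archimed_cor1 (1 - r)) as [N [H1 H2]]; [lra |].
  exists N. unfold radius.
  assert (0 < INR N) by (apply lt_0_INR; exact H2).
  assert (/ (INR N + 2) <= / INR N) by (apply Rinv_le_contravar; lra). lra.
Qed.

(** Boundary values are the limits along radii. Continuity at a boundary point follows by passing to
    an inner circle, where f is continuous. *)
Lemma radially_cauchy_extension (f : C -> C) :
  ccont_open_disc f -> radially_cauchy f ->
  exists F, ccont_disc F /\ forall z, Cmod z < 1 -> F z = f z.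
Proof.
  intros Hc Hr.
  set (seqf := fun z n => f (RtoC (radius n) * z)%C).
  (* [Lim_seq] is total; the limits are shown to be finite for z on the circle, the only place where
     the values of [lim] matter. *)
  set (lim := fun z => (real (Lim_seq (fun n => Re (seqf z n))),
                        real (Lim_seq (fun n => Im (seqf z n)))) : C).
  assert (Cau : forall s eps, 0 < eps -> exists N, forall n m, (N <= n)%nat -> (N <= m)%nat ->
     Cmod (seqf (cis s) n - seqf (cis s) m) <= eps).
  { intros s eps He. destruct (Hr eps He) as [delta [Hd H]].
    destruct (radius_large (1 - delta)) as [N HN]; [lra |].
    exists N. intros n m Hn Hm.
    assert (Rn := radius_mono _ _ Hn). assert (Rm := radius_mono _ _ Hm).
    assert (Bn := radius_bounds n). assert (Bm := radius_bounds m).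
    unfold seqf. destruct (Rle_dec (radius n) (radius m)).
    - apply H; lra.
    - rewrite <- Cmod_opp, Copp_minus_distr. apply H; lra. }
  assert (Ex : forall s, ex_finite_lim_seq (fun n => Re (seqf (cis s) n)) /\
                         ex_finite_lim_seq (fun n => Im (seqf (cis s) n))).
  { intros s; split; apply ex_lim_seq_cauchy_corr; intros eps;
      assert (He : 0 < eps / 2) by (generalize (cond_pos eps); lra);
      destruct (Cau s (eps / 2) He) as [N HN]; exists N; intros n m Hn Hm;
      (eapply Rle_lt_trans; [| apply (Rlt_eps2_eps eps (cond_pos eps))]);
      (eapply Rle_trans; [| apply (HN n m Hn Hm)]).
    - apply (re_le_Cmod (seqf (cis s) n - seqf (cis s) m)%C).
    - apply (im_le_Cmod (seqf (cis s) n - seqf (cis s) m)%C). }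
  assert (Lim : forall eps delta, (forall r r' s, 1 - delta < r -> r <= r' < 1 ->
        Cmod (f (RtoC r * cis s)%C - f (RtoC r' * cis s)%C) <= eps) ->
     forall r s, 1 - delta < r < 1 -> Cmod (lim (cis s) - f (RtoC r * cis s)%C) <= 2 * eps).
  { intros eps delta H r s Hrr. eapply Rle_trans; [apply Cmod_le_Rabs |].
    destruct (radius_large r) as [N HN]; [lra |].
    assert (B : forall n, (N <= n)%nat ->
       Cmod (seqf (cis s) n - f (RtoC r * cis s)%C) <= eps).
    { intros n Hn. rewrite <- Cmod_opp, Copp_minus_distr. unfold seqf.
      generalize (radius_mono _ _ Hn) (radius_bounds n); intros. apply H; lra. }
    replace (2 * eps) with (eps + eps) by ring. apply Rplus_le_compat.
    - apply (is_lim_seq_le_Rabs _ _ _ N); [apply Ex |]. intros n Hn.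
      eapply Rle_trans; [| apply (B n Hn)].
      apply (re_le_Cmod (seqf (cis s) n - f (RtoC r * cis s)%C)%C).
    - apply (is_lim_seq_le_Rabs _ _ _ N); [apply Ex |]. intros n Hn.
      eapply Rle_trans; [| apply (B n Hn)].
      apply (im_le_Cmod (seqf (cis s) n - f (RtoC r * cis s)%C)%C). }
  set (F := fun z => if Rlt_dec (Cmod z) 1 then f z else lim z).
  assert (F1 : forall z, Cmod z < 1 -> F z = f z).
  { intros z Hz. unfold F. destruct Rlt_dec; [reflexivity | contradiction]. }
  assert (F2 : forall s, F (cis s) = lim (cis s)).
  { intros s. unfold F. destruct Rlt_dec as [H | H]; [rewrite Cmod_cis in H; lra | reflexivity]. }
  exists F; split; [| exact F1].
  intros z Hz eps He. destruct Hz as [Hz | Hz].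
  - destruct (Hc z Hz eps He) as [delta [Hd H]].
    exists (Rmin delta (1 - Cmod z)); split; [apply Rmin_pos; lra |].
    intros w _ Bw.
    assert (B1 := Rlt_le_trans _ _ _ Bw (Rmin_l _ _)).
    assert (B2 := Rlt_le_trans _ _ _ Bw (Rmin_r _ _)).
    rewrite !F1; [apply H, B1 | exact Hz |].
    generalize (Cmod_triangle (w - z) z). replace (w - z + z)%C with w by ring. lra.
  - destruct (polar_unit z Hz) as [s0 ->].
    destruct (Hr (eps / 6) ltac:(lra)) as [delta [Hd H]].
    assert (L := Lim (eps / 6) delta H).
    (* F w and F (cis s0) are compared through r1 cis s and r1 cis s0, where s is the angle of w.
       The three errors are 2 eps / 6, eps / 6 and 2 eps / 6. *)
    set (r1 := 1 - delta / 2).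
    assert (M1 : Cmod (RtoC r1 * cis s0) < 1).
    { rewrite Cmod_r_cis; unfold r1; lra. }
    destruct (Hc _ M1 (eps / 6) ltac:(lra)) as [d2 [Hd2 H2]].
    exists (Rmin (delta / 2) (d2 / 2)); split; [apply Rmin_pos; lra |].
    intros w Hw Bw.
    assert (B1 := Rlt_le_trans _ _ _ Bw (Rmin_l _ _)).
    assert (B2 := Rlt_le_trans _ _ _ Bw (Rmin_r _ _)).
    assert (Tw : 1 - Cmod w <= Cmod (w - cis s0)).
    { generalize (Cmod_triangle w (- (w - cis s0))%C). rewrite Cmod_opp.
      replace (w + - (w - cis s0))%C with (cis s0) by ring. rewrite Cmod_cis. lra. }
    destruct (polar w) as [s Es].
    set (r := Cmod w) in *.
    assert (X1 : Cmod (F w - f (RtoC r1 * cis s)%C) <= 2 * (eps / 6)).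
    { destruct Hw as [Hw | Hw].
      - rewrite F1 by exact Hw. rewrite Es, <- Cmod_opp, Copp_minus_distr.
        apply Rle_trans with (eps / 6); [apply H; unfold r1; lra | lra].
      - assert (Ew : w = cis s) by (rewrite Es, Hw; ring).
        rewrite Ew, F2. apply L; unfold r1; lra. }
    assert (X2 : Cmod (f (RtoC r1 * cis s)%C - f (RtoC r1 * cis s0)%C) < eps / 6).
    { apply H2.
      replace (RtoC r1 * cis s - RtoC r1 * cis s0)%C with (RtoC r1 * (cis s - cis s0))%C by ring.
      rewrite Cmod_mult, Cmod_R, Rabs_pos_eq by (unfold r1; lra).
      (* Projecting w radially onto the circle moves it by 1 - |w|, which is at most its distance to
         cis s0. *)
      assert (Cmod (cis s - cis s0) <= 2 * Cmod (w - cis s0)).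
      { replace (cis s - cis s0)%C with (RtoC (1 - r) * cis s + (w - cis s0))%C
          by (rewrite Es, RtoC_minus; ring).
        eapply Rle_trans; [apply Cmod_triangle |].
        rewrite Cmod_r_cis by lra. lra. }
      generalize (Cmod_ge_0 (cis s - cis s0)); intros.
      assert (r1 * Cmod (cis s - cis s0) <= 1 * Cmod (cis s - cis s0))
        by (apply Rmult_le_compat_r; [assumption | unfold r1; lra]).
      lra. }
    assert (X3 : Cmod (lim (cis s0) - f (RtoC r1 * cis s0)%C) <= 2 * (eps / 6)).
    { apply L; unfold r1; lra. }
    rewrite F2.
    replace (F w - lim (cis s0))%C with ((F w - f (RtoC r1 * cis s)%C)
      + ((f (RtoC r1 * cis s)%C - f (RtoC r1 * cis s0)%C)
         + - (lim (cis s0) - f (RtoC r1 * cis s0)%C)))%C by ring.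
    eapply Rle_lt_trans; [apply Cmod_triangle |].
    eapply Rle_lt_trans; [apply Rplus_le_compat_l, Cmod_triangle |].
    rewrite Cmod_opp. lra.
Qed.

Lemma radially_cauchy_plus (f g : C -> C) :
  radially_cauchy f -> radially_cauchy g -> radially_cauchy (fun z => f z + g z)%C.
Proof.
  intros Hf Hg eps He.
  destruct (Hf (eps / 2) ltac:(lra)) as [d1 [P1 H1]].
  destruct (Hg (eps / 2) ltac:(lra)) as [d2 [P2 H2]].
  exists (Rmin d1 d2); split.
  { split; [apply Rmin_pos; lra | eapply Rle_lt_trans; [apply Rmin_l | lra]]. }
  intros r r' s Hr Hr'. assert (M1 := Rmin_l d1 d2). assert (M2 := Rmin_r d1 d2).
  match goal with |- Cmod (?a + ?b - (?c + ?d)) <= _ =>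
    replace (a + b - (c + d))%C with ((a - c) + (b - d))%C by ring end.
  eapply Rle_trans; [apply Cmod_triangle |].
  specialize (H1 r r' s ltac:(lra) Hr'). specialize (H2 r r' s ltac:(lra) Hr'). lra.
Qed.

Lemma radially_cauchy_Cmult (c : C) (f : C -> C) :
  radially_cauchy f -> radially_cauchy (fun z => c * f z)%C.
Proof.
  intros Hf eps He. assert (P := Cmod_ge_0 c).
  destruct (Hf (eps / (Cmod c + 1))) as [d [Hd H]].
  { apply Rdiv_lt_0_compat; lra. }
  exists d; split; [exact Hd |]. intros r r' s Hr Hr'. specialize (H r r' s Hr Hr').
  match goal with |- Cmod (c * ?a - c * ?b) <= _ =>
    replace (c * a - c * b)%C with (c * (a - b))%C by ring end.
  rewrite Cmod_mult.
  apply (Rmult_le_compat_l (Cmod c + 1)) in H; [| lra].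
  replace ((Cmod c + 1) * (eps / (Cmod c + 1))) with eps in H by (field; lra).
  generalize (Cmod_ge_0 (f (RtoC r * cis s)%C - f (RtoC r' * cis s)%C)). lra.
Qed.

Lemma radially_cauchy_const (c : C) : radially_cauchy (fun _ => c).
Proof.
  intros eps He. exists (1 / 2); split; [lra |]. intros r r' s _ _.
  replace (c - c)%C with (RtoC 0) by ring. rewrite Cmod_0; lra.
Qed.

Lemma radially_cauchy_id : radially_cauchy (fun z => z).
Proof.
  intros eps He. exists (Rmin (1 / 2) eps).
  assert (M1 := Rmin_l (1 / 2) eps). assert (M2 := Rmin_r (1 / 2) eps).
  split; [split; [apply Rmin_pos; lra | lra] |]. intros r r' s Hr Hr'.
  replace (RtoC r * cis s - RtoC r' * cis s)%C with (RtoC (r - r') * cis s)%C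
    by (rewrite RtoC_minus; ring).
  rewrite Cmod_mult, Cmod_cis, Cmod_R, Rabs_left1 by lra. lra.
Qed.

Lemma radially_cauchy_inv : radially_cauchy (fun z => / z)%C.
Proof.
  intros eps He. exists (Rmin (1 / 2) (eps / 4)).
  assert (M1 := Rmin_l (1 / 2) (eps / 4)). assert (M2 := Rmin_r (1 / 2) (eps / 4)).
  split; [split; [apply Rmin_pos; lra | lra] |]. intros r r' s Hr Hr'.
  assert (N := cis_neq_0 s).
  assert (N1 : RtoC r <> 0) by (intros K; apply RtoC_inj in K; lra).
  assert (N2 : RtoC r' <> 0) by (intros K; apply RtoC_inj in K; lra).
  replace (/ (RtoC r * cis s) - / (RtoC r' * cis s))%C
    with (RtoC (r' - r) / (RtoC r * RtoC r' * cis s))%C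
    by (rewrite RtoC_minus; field; repeat split; assumption).
  rewrite Cmod_div, !Cmod_mult, Cmod_cis, !Cmod_R by (repeat apply Cmult_neq_0; assumption).
  rewrite !Rabs_pos_eq by lra.
  apply (Rmult_le_reg_r (r * r' * 1)); [nra |].
  replace ((r' - r) / (r * r' * 1) * (r * r' * 1)) with (r' - r) by (field; lra).
  assert (1 / 4 <= r * r') by nra. nra.
Qed.

Lemma radially_cauchy_small (f : C -> C) :
  (forall eps, 0 < eps -> exists delta, 0 < delta < 1 /\ forall r s, 1 - delta < r < 1 ->
     Cmod (f (RtoC r * cis s)%C) <= eps) -> radially_cauchy f.
Proof.
  intros H eps He. destruct (H (eps / 2) ltac:(lra)) as [d [Hd Hf]].
  exists d; split; [exact Hd |]. intros r r' s Hr Hr'.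
  eapply Rle_trans; [apply Cmod_triangle |]. rewrite Cmod_opp.
  generalize (Hf r s ltac:(lra)) (Hf r' s ltac:(lra)). lra.
Qed.

Lemma radially_cauchy_ext (f g : C -> C) :
  (forall z, 0 < Cmod z < 1 -> f z = g z) -> radially_cauchy f -> radially_cauchy g.
Proof.
  intros E Hf eps He. destruct (Hf eps He) as [d [Hd H]].
  exists d; split; [exact Hd |]. intros r r' s Hr Hr'.
  rewrite <- !E by (rewrite Cmod_r_cis; lra). apply H; assumption.
Qed.

Lemma rho_term_small (u : B -> R) (eps : R) : dini disk u -> 0 < eps ->
  exists delta, 0 < delta < 1 /\ forall r s, 1 - delta < r < 1 ->
    Cmod ((fun z => - (RtoC (1 - Cmod z ^ 2) / (2 * z) * cmean u (dschwarz_ker z)))%C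
      (RtoC r * cis s)%C) <= eps.
Proof.
  intros Hu He. destruct (dschwarz_lim u eps Hu He) as [d [Hd H]].
  exists (Rmin (1 / 2) d).
  assert (M1 := Rmin_l (1 / 2) d). assert (M2 := Rmin_r (1 / 2) d).
  split; [split; [apply Rmin_pos; lra | lra] |]. intros r s Hr. cbv beta.
  specialize (H r s ltac:(lra)). rewrite Cmod_r_cis by lra.
  assert (N : (2 * (RtoC r * cis s))%C <> 0).
  { repeat apply Cmult_neq_0; [| | apply cis_neq_0]; intros K; apply RtoC_inj in K; lra. }
  rewrite Cmod_opp.
  replace (RtoC (1 - r ^ 2) / (2 * (RtoC r * cis s)) * cmean u (dschwarz_ker (RtoC r * cis s)))%C
    with (/ (2 * (RtoC r * cis s))
          * (RtoC (1 - r ^ 2) * cmean u (dschwarz_ker (RtoC r * cis s))))%C by (unfold Cdiv; ring).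
  rewrite Cmod_mult, Cmod_inv by exact N.
  rewrite Cmod_mult, Cmod_r_cis, Cmod_R, Rabs_pos_eq by lra.
  assert (/ (2 * r) <= 1).
  { rewrite <- Rinv_1. apply Rinv_le_contravar; lra. }
  assert (0 < / (2 * r)) by (apply Rinv_0_lt_compat; lra).
  generalize (Cmod_ge_0 (RtoC (1 - r ^ 2) * cmean u (dschwarz_ker (RtoC r * cis s)))). nra.
Qed.

Lemma radially_cauchy_pa_S_disk (u : B -> R) : dini disk u ->
  radially_cauchy (fun z => pa (S_disk u (emb z))).
Proof.
  intros Hu. apply (radially_cauchy_ext (fun z => cmean u (schwarz_ker z))).
  - intros z Hz. rewrite pa_S_disk; [reflexivity | exact Hu | lra].
  - intros eps He. apply schwarz_radial_cauchy; assumption.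
Qed.

Lemma radially_cauchy_pb_S_disk (u : B -> R) : dini disk u ->
  radially_cauchy (fun z => pb (S_disk u (emb z))).
Proof.
  intros Hu.
  apply (radially_cauchy_ext (fun z =>
     cmean u (fun s => / (cis s * cis s)) + cmean u (fun s => / cis s) * / z
     + - (RtoC (1 - Cmod z ^ 2) / (2 * z) * cmean u (dschwarz_ker z)))%C).
  - intros z Hz. rewrite pb_S_disk; [reflexivity | exact Hu | lra |].
    apply Cmod_gt_0; lra.
  - apply radially_cauchy_plus.
    + apply radially_cauchy_plus; [apply radially_cauchy_const |].
      apply radially_cauchy_Cmult, radially_cauchy_inv.
    + apply radially_cauchy_small; intros eps He. apply rho_term_small; assumption.
Qed.

(** * The (1-4)-problem *)

Lemma Ci_opp_Ci : (Ci * - Ci)%C = 1.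
Proof. apply injective_projections; simpl; ring. Qed.

Lemma Cmod_pa_le_nB (b : B) : Cmod (pa b) <= nB b.
Proof. unfold nB; generalize (Cmod_ge_0 (pb b)); lra. Qed.
Lemma Cmod_pb_le_nB (b : B) : Cmod (pb b) <= nB b.
Proof. unfold nB; generalize (Cmod_ge_0 (pa b)); lra. Qed.

Lemma continuous_on_closed_disk (Phi : B -> B) :
  continuous_on (closure disk) Phi <->
  ccont_disc (fun z => pa (Phi (emb z))) /\ ccont_disc (fun z => pb (Phi (emb z))).
Proof.
  split.
  - intros H.
    assert (K : forall z, Cmod z <= 1 -> forall eps, 0 < eps -> exists delta, 0 < delta /\
       forall w, Cmod w <= 1 -> Cmod (w - z) < delta -> nB (Phi (emb w) - Phi (emb z))%B < eps).
    { intros z Hz eps He.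
      destruct (proj1 (locally_B (emb z) _) (H (emb z) (proj2 (closure_disk_emb z) Hz)
         (fun b => nB (b - Phi (emb z))%B < eps)
         (proj2 (locally_B _ _) (ex_intro _ eps (conj He (fun w Hw => Hw)))))) as [d [Hd K]].
      exists (d / 2); split; [lra |]. intros w Hw Bw.
      apply K; [| apply closure_disk_emb, Hw].
      rewrite <- emb_minus. generalize (nB_emb (w - z)%C). lra. }
    split; intros z Hz eps He; destruct (K z Hz eps He) as [d [Hd H1]];
      exists d; (split; [exact Hd |]); intros w Hw Bw; specialize (H1 w Hw Bw).
    + rewrite <- pa_minus. eapply Rle_lt_trans; [apply Cmod_pa_le_nB | exact H1].
    + rewrite <- pb_minus. eapply Rle_lt_trans; [apply Cmod_pb_le_nB | exact H1].
  - intros [Ha Hb] zeta Hz P HP.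
    destruct (closure_disk_inv zeta Hz) as [z [-> Hz1]].
    apply locally_B in HP. destruct HP as [eps [He HP]].
    destruct (Ha z Hz1 (eps / 2) ltac:(lra)) as [d1 [Hd1 H1]].
    destruct (Hb z Hz1 (eps / 2) ltac:(lra)) as [d2 [Hd2 H2]].
    apply locally_B. exists (Rmin d1 d2); split; [apply Rmin_pos; assumption |].
    intros zeta' Bw Hw. destruct (closure_disk_inv zeta' Hw) as [w [-> Hw1]].
    rewrite <- emb_minus in Bw.
    assert (M1 := Rmin_l d1 d2). assert (M2 := Rmin_r d1 d2).
    assert (N := nB_emb (w - z)%C).
    apply HP. unfold nB. rewrite pa_minus, pb_minus.
    generalize (H1 w Hw1 ltac:(lra)) (H2 w Hw1 ltac:(lra)). lra.
Qed.

Lemma pa_zero : pa zero = 0.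
Proof. replace (@zero B) with (e1 - e1)%B by apply (@minus_eq_zero B).
  rewrite pa_minus; ring. Qed.

Lemma emb_0 : emb 0 = zero.
Proof.
  replace (RtoC 0) with (0 - 0)%C by ring. rewrite emb_minus. apply (@minus_eq_zero B).
Qed.

Lemma monogenic_iff (Phi : B -> B) :
  monogenic disk Phi <-> forall z, Cmod z < 1 -> exists d, quotient_lim Phi z d.
Proof.
  split.
  - intros H z Hz. destruct (H (emb z) (proj2 (disk_emb z) Hz)) as [d Hd].
    exists d; intros eps He.
    destruct (proj1 (locally_B zero _) (Hd (fun b => nB (b - d)%B < eps)
         (proj2 (locally_B _ _) (ex_intro _ eps (conj He (fun w Hw => Hw)))))) as [delta [Hdel K]].
    exists (delta / 2); split; [lra |]. intros w Hw Bw.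
    apply K.
    + rewrite <- emb_0, <- emb_minus. replace (w - 0)%C with w by ring.
      generalize (nB_emb w). lra.
    + split; [exists (Re w), (Im w); reflexivity |].
      intros E. apply Hw. rewrite <- (pa_emb w), E. apply pa_zero.
  - intros H zeta Hz. destruct (disk_inv zeta Hz) as [z [-> Hz1]].
    destruct (H z Hz1) as [d Hd]. exists d. intros P HP.
    apply locally_B in HP. destruct HP as [eps [He HP]].
    destruct (Hd eps He) as [delta [Hdel K]].
    apply locally_B. exists delta; split; [exact Hdel |].
    intros h Bh [[x [y Eh]] Nh]. rewrite muplane_emb in Eh. subst h.
    apply HP, K.
    + intros E. apply Nh. rewrite E. apply emb_0.
    + rewrite <- emb_0, <- emb_minus in Bh.
      replace ((x, y) - 0)%C with ((x, y) : C) in Bh by (apply injective_projections; simpl; ring).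
      generalize (nB_emb (x, y)). lra.
Qed.

Lemma quotient_lim_ext (Phi Psi : B -> B) (z : C) (d : B) :
  Cmod z < 1 -> (forall w, Cmod w < 1 -> Phi (emb w) = Psi (emb w)) ->
  quotient_lim Phi z d -> quotient_lim Psi z d.
Proof.
  intros Hz E H eps He. destruct (H eps He) as [delta [Hd K]].
  exists (Rmin delta (1 - Cmod z)); split; [apply Rmin_pos; lra |].
  intros w Hw Bw.
  assert (B1 := Rlt_le_trans _ _ _ Bw (Rmin_l _ _)).
  assert (B2 := Rlt_le_trans _ _ _ Bw (Rmin_r _ _)).
  specialize (K w Hw B1). rewrite <- emb_plus in *.
  rewrite <- !E; [exact K | exact Hz |].
  generalize (Cmod_triangle z w); lra.
Qed.

Lemma quotient_lim_minus (Phi Psi : B -> B) (z : C) (d e : B) :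
  quotient_lim Phi z d -> quotient_lim Psi z e ->
  quotient_lim (fun zeta => Phi zeta - Psi zeta)%B z (d - e)%B.
Proof.
  intros H1 H2 eps He.
  destruct (H1 (eps / 2) ltac:(lra)) as [d1 [P1 K1]].
  destruct (H2 (eps / 2) ltac:(lra)) as [d2 [P2 K2]].
  exists (Rmin d1 d2); split; [apply Rmin_pos; assumption |].
  intros w Hw Bw.
  specialize (K1 w Hw (Rlt_le_trans _ _ _ Bw (Rmin_l _ _))).
  specialize (K2 w Hw (Rlt_le_trans _ _ _ Bw (Rmin_r _ _))).
  set (X := ((Phi (emb z + emb w) - Phi (emb z)) * / emb w - d)%B) in *.
  set (Y := ((Psi (emb z + emb w) - Psi (emb z)) * / emb w - e)%B) in *.
  match goal with |- nB ?q < _ => replace q with (X + (RtoC (-1) *: Y))%B end.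
  - eapply Rle_lt_trans; [apply nB_plus |]. rewrite nB_scal, Cmod_R, Rabs_left by lra. lra.
  - unfold X, Y. apply B_ext; rewrite ?pa_plus, ?pb_plus, ?pa_minus, ?pb_minus, ?pa_scal,
      ?pb_scal, ?pa_minus, ?pb_minus, ?pa_mult, ?pb_mult, ?pa_minus, ?pb_minus; ring.
Qed.

Lemma quotient_lim_continuous (Phi : B -> B) (z : C) (d : B) : quotient_lim Phi z d ->
  forall eps, 0 < eps -> exists delta, 0 < delta /\ forall w, Cmod (w - z) < delta ->
    nB (Phi (emb w) - Phi (emb z))%B < eps.
Proof.
  intros H eps He. destruct (H 1 Rlt_0_1) as [d1 [P1 K]].
  assert (N := nB_pos d).
  assert (P2 : 0 < eps / (2 * (nB d + 1))) by (apply Rdiv_lt_0_compat; lra).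
  exists (Rmin d1 (eps / (2 * (nB d + 1)))); split; [apply Rmin_pos; assumption |].
  intros w Bw.
  assert (B1 := Rlt_le_trans _ _ _ Bw (Rmin_l _ _)).
  assert (B2 := Rlt_le_trans _ _ _ Bw (Rmin_r _ _)).
  destruct (Ceq_dec w z) as [-> | Hw].
  - replace (Phi (emb z) - Phi (emb z))%B with (@zero B) by (symmetry; apply (@minus_eq_zero B)).
    rewrite <- emb_0. eapply Rle_lt_trans; [apply nB_emb |]. rewrite Cmod_0; lra.
  - assert (Hwz : (w - z)%C <> 0).
    { intros E; apply Hw. replace w with ((w - z) + z)%C by ring. rewrite E; ring. }
    specialize (K (w - z)%C Hwz B1). rewrite <- emb_plus in K.
    replace (z + (w - z))%C with w in K by ring.
    set (q := ((Phi (emb w) - Phi (emb z)) * / emb (w - z))%B) in *.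
    assert (H0 := emb_neq_0 _ Hwz).
    (* Increments in mu are invertible, so the increment of Phi is its difference quotient times h;
       the quotient is bounded by 1 + [nB] d. *)
    assert (E : (Phi (emb w) - Phi (emb z))%B = ((q - d + d) * emb (w - z))%B).
    { unfold q. apply B_ext.
      - repeat rewrite ?pa_mult, ?pa_plus, ?pa_minus.
        rewrite pa_Binv by exact H0. field; exact H0.
      - repeat rewrite ?pb_mult, ?pa_mult, ?pa_plus, ?pb_plus, ?pa_minus, ?pb_minus.
        rewrite pa_Binv, pb_Binv by exact H0. field; exact H0. }
    rewrite E. eapply Rle_lt_trans; [apply nB_mult |].
    assert (Q : nB (q - d + d)%B <= 1 + nB d).
    { eapply Rle_trans; [apply nB_plus | lra]. }
    assert (M := nB_emb (w - z)%C).
    apply (Rmult_lt_compat_r (2 * (nB d + 1))) in B2; [| lra].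
    replace (eps / (2 * (nB d + 1)) * (2 * (nB d + 1))) with eps in B2 by (field; lra).
    assert (nB (q - d + d)%B * nB (emb (w - z)) <= (1 + nB d) * (2 * Cmod (w - z))).
    { apply Rmult_le_compat; try apply nB_pos; [exact Q | apply M]. }
    lra.
Qed.

Lemma Cderiv_of_quotient (f : C -> C) (z d : C) :
  (forall eps, 0 < eps -> exists delta, 0 < delta /\ forall w : C, w <> 0 -> Cmod w < delta ->
     Cmod ((f (z + w)%C - f z) / w - d) < eps) -> Cderiv f z d.
Proof.
  intros H. apply Cderiv_iff; intros eps He.
  destruct (H eps He) as [delta [Hd K]]. exists delta; split; [exact Hd |].
  intros w Bw. destruct (Ceq_dec w z) as [-> | Hw].
  - replace (f z - f z - (z - z) * d)%C with (RtoC 0) by ring.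
    replace (z - z)%C with (RtoC 0) by ring. rewrite Cmod_0; lra.
  - assert (Hwz : (w - z)%C <> 0).
    { intros E; apply Hw. replace w with ((w - z) + z)%C by ring. rewrite E; ring. }
    specialize (K (w - z)%C Hwz Bw). replace (z + (w - z))%C with w in K by ring.
    replace (f w - f z - (w - z) * d)%C with (((f w - f z) / (w - z) - d) * (w - z))%C
      by (field; exact Hwz).
    rewrite Cmod_mult. apply Rmult_le_compat_r; [apply Cmod_ge_0 | lra].
Qed.

Lemma quotient_lim_pa (Phi : B -> B) (z : C) (d : B) :
  quotient_lim Phi z d -> Cderiv (fun w => pa (Phi (emb w))) z (pa d).
Proof.
  intros H. apply Cderiv_of_quotient; intros eps He.
  destruct (H eps He) as [delta [Hd K]]. exists delta; split; [exact Hd |].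
  intros w Hw Bw. specialize (K w Hw Bw).
  apply (Rle_lt_trans _ _ _ (Cmod_pa_le_nB _)) in K.
  rewrite pa_minus, pa_mult, pa_minus, pa_Binv in K by (apply emb_neq_0, Hw).
  rewrite pa_emb, <- emb_plus in K. exact K.
Qed.

(** The rho-coordinate of the difference quotient also contains the increment of [pa] times the
    rho-coordinate of h^-1, a term with Im w in it. For constant [pa] this term vanishes and an
    ordinary complex quotient remains. *)
Lemma quotient_lim_pb (Phi : B -> B) (z : C) (d : B) :
  Cmod z < 1 ->
  (forall w, Cmod w < 1 -> pa (Phi (emb w)) = pa (Phi (emb z))) ->
  quotient_lim Phi z d -> Cderiv (fun w => pb (Phi (emb w))) z (pb d).
Proof.
  intros Hz Hc H. apply Cderiv_of_quotient; intros eps He.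
  destruct (H eps He) as [delta [Hd K]].
  exists (Rmin delta (1 - Cmod z)); split; [apply Rmin_pos; lra |].
  intros w Hw Bw.
  assert (B1 := Rlt_le_trans _ _ _ Bw (Rmin_l _ _)).
  assert (B2 := Rlt_le_trans _ _ _ Bw (Rmin_r _ _)).
  specialize (K w Hw B1).
  apply (Rle_lt_trans _ _ _ (Cmod_pb_le_nB _)) in K.
  assert (H0 := emb_neq_0 w Hw).
  rewrite pb_minus, pb_mult, pa_minus, pb_minus, pa_Binv, pb_Binv in K by exact H0.
  rewrite <- emb_plus, (Hc (z + w)%C), pa_emb in K
    by (generalize (Cmod_triangle z w); lra).
  match type of K with Cmod ?x < _ => match goal with |- Cmod ?y < _ =>
    replace y with x; [exact K |] end end.
  field. exact Hw.
Qed.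

(** * The family of candidate solutions *)

Definition solution (u1 u4 : B -> R) (c : C) (b a1 a2 : R) (zeta : B) : B :=
  (S_disk u1 zeta * e1 + S_disk u4 zeta * (Ci *: e2)
   + (c *: zeta + RtoC b *: e1) * (e1 + Ci *: e2)
   + RtoC a1 *: (Ci *: e1) + RtoC a2 *: e2)%B.

(** [pa] kills rho = e1 + i e2, so c and b drop out; it takes i e2 to -1 and both i e1 and e2 to
    i. *)
Lemma pa_solution (u1 u4 : B -> R) (c : C) (b a1 a2 : R) (z : C) :
  pa (solution u1 u4 c b a1 a2 (emb z))
  = (pa (S_disk u1 (emb z)) + - (1) * pa (S_disk u4 (emb z)) + Ci * RtoC (a1 + a2))%C.
Proof.
  unfold solution.
  rewrite !pa_plus, !pa_mult, !pa_plus, !pa_scal, !pa_e1, !pa_e2, RtoC_plus.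
  rewrite Ci_Ci. ring.
Qed.

(** The term with c is a multiple of rho, so only z = [pa] zeta survives of its factor zeta. The
    coordinate of i e2 is 1, which is how the Schwarz integral of u4 enters. *)
Lemma pb_solution (u1 u4 : B -> R) (c : C) (b a1 a2 : R) (z : C) :
  pb (solution u1 u4 c b a1 a2 (emb z))
  = (pb (S_disk u1 (emb z)) + - (1) * pb (S_disk u4 (emb z)) + pa (S_disk u4 (emb z))
     + c * z + (RtoC b - Ci * RtoC a2))%C.
Proof.
  unfold solution.
  rewrite !pb_plus, !pb_mult, !pa_plus, !pb_plus, !pa_scal, !pb_scal, !pa_e1, !pb_e1, !pa_e2,
    !pb_e2, pa_emb.
  rewrite Ci_opp_Ci.
  rewrite Ci_Ci. ring.
Qed.

Lemma solution_quotient_lim (u1 u4 : B -> R) (c : C) (b a1 a2 : R) (z : C) :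
  dini disk u1 -> dini disk u4 -> Cmod z < 1 ->
  exists d, quotient_lim (solution u1 u4 c b a1 a2) z d.
Proof.
  intros H1 H4 Hz.
  destruct (S_disk_quotient_lim u1 z H1 Hz) as [d1 L1].
  destruct (S_disk_quotient_lim u4 z H4 Hz) as [d4 L4].
  exists (d1 * e1 + d4 * (Ci *: e2) + c *: (e1 + Ci *: e2))%B.
  intros eps He.
  assert (N1 : nB e1 = 1).
  { unfold nB. rewrite pa_e1, pb_e1, Cmod_1, Cmod_0; ring. }
  assert (N2 : nB (Ci *: e2)%B = 2).
  { rewrite nB_scal. unfold nB. rewrite pa_e2, pb_e2, Cmod_opp, Cmod_Ci; ring. }
  destruct (L1 (eps / 4) ltac:(lra)) as [r1 [P1 K1]].
  destruct (L4 (eps / 4) ltac:(lra)) as [r4 [P4 K4]].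
  exists (Rmin r1 r4); split; [apply Rmin_pos; assumption |].
  intros w Hw Bw.
  specialize (K1 w Hw (Rlt_le_trans _ _ _ Bw (Rmin_l _ _))).
  specialize (K4 w Hw (Rlt_le_trans _ _ _ Bw (Rmin_r _ _))).
  assert (H0 := emb_neq_0 w Hw).
  set (X := ((S_disk u1 (emb z + emb w) - S_disk u1 (emb z)) * / emb w - d1)%B) in *.
  set (Y := ((S_disk u4 (emb z + emb w) - S_disk u4 (emb z)) * / emb w - d4)%B) in *.
  match goal with |- nB ?q < _ => replace q with (X * e1 + Y * (Ci *: e2))%B end.
  - eapply Rle_lt_trans; [apply nB_plus |].
    generalize (nB_mult X e1) (nB_mult Y (Ci *: e2)%B). rewrite N1, N2. lra.
  - unfold X, Y, solution. apply B_ext.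
    + repeat rewrite ?pa_minus, ?pa_plus, ?pa_mult, ?pa_scal.
      rewrite pa_Binv, !pa_emb, !pa_e1, !pa_e2 by exact H0. field. exact Hw.
    + repeat rewrite ?pa_minus, ?pa_plus, ?pa_mult, ?pa_scal, ?pb_minus, ?pb_plus, ?pb_mult, ?pb_scal.
      rewrite pa_Binv, pb_Binv, !pa_emb, !pa_e1, !pa_e2, !pb_e1, !pb_e2 by exact H0.
      rewrite Ci_opp_Ci.
      rewrite Ci_Ci. field. exact Hw.
Qed.

Lemma solution_extension (u1 u4 : B -> R) (c : C) (b a1 a2 : R) :
  dini disk u1 -> dini disk u4 ->
  exists Phi : B -> B, continuous_on (closure disk) Phi /\
    (forall zeta, disk zeta -> Phi zeta = solution u1 u4 c b a1 a2 zeta).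
Proof.
  intros H1 H4. set (f := solution u1 u4 c b a1 a2).
  assert (Cf : forall z, Cmod z < 1 -> forall eps, 0 < eps -> exists delta, 0 < delta /\
     forall w, Cmod (w - z) < delta -> nB (f (emb w) - f (emb z))%B < eps).
  { intros z Hz. destruct (solution_quotient_lim u1 u4 c b a1 a2 z H1 H4 Hz) as [d Hd].
    exact (quotient_lim_continuous f z d Hd). }
  destruct (radially_cauchy_extension (fun z => pa (f (emb z)))) as [FA [CA EA]].
  { intros z Hz eps He. destruct (Cf z Hz eps He) as [delta [Hd K]].
    exists delta; split; [exact Hd |]. intros w Bw. rewrite <- pa_minus.
    eapply Rle_lt_trans; [apply Cmod_pa_le_nB | apply K, Bw]. }
  { apply (radially_cauchy_ext (fun z => pa (S_disk u1 (emb z))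
       + - (1) * pa (S_disk u4 (emb z)) + Ci * RtoC (a1 + a2))%C).
    - intros z _. symmetry; apply pa_solution.
    - apply radially_cauchy_plus; [| apply radially_cauchy_const].
      apply radially_cauchy_plus; [| apply radially_cauchy_Cmult];
        apply radially_cauchy_pa_S_disk; assumption. }
  destruct (radially_cauchy_extension (fun z => pb (f (emb z)))) as [FB [CB EB]].
  { intros z Hz eps He. destruct (Cf z Hz eps He) as [delta [Hd K]].
    exists delta; split; [exact Hd |]. intros w Bw. rewrite <- pb_minus.
    eapply Rle_lt_trans; [apply Cmod_pb_le_nB | apply K, Bw]. }
  { apply (radially_cauchy_ext (fun z => pb (S_disk u1 (emb z))
       + - (1) * pb (S_disk u4 (emb z)) + pa (S_disk u4 (emb z))
       + c * z + (RtoC b - Ci * RtoC a2))%C).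
    - intros z _. symmetry; apply pb_solution.
    - apply radially_cauchy_plus; [| apply radially_cauchy_const].
      apply radially_cauchy_plus; [| apply radially_cauchy_Cmult, radially_cauchy_id].
      apply radially_cauchy_plus; [| apply radially_cauchy_pa_S_disk; assumption].
      apply radially_cauchy_plus; [| apply radially_cauchy_Cmult];
        apply radially_cauchy_pb_S_disk; assumption. }
  (* [pa] recovers z from zeta = [emb] z; off mu the values are irrelevant. *)
  exists (fun zeta => mkB (FA (pa zeta)) (FB (pa zeta))); split.
  - assert (T : forall F, ccont_disc F -> forall G, (forall z, G z = F z) -> ccont_disc G).
    { intros F HF G E z Hz eps He. destruct (HF z Hz eps He) as [delta [Hd K]].
      exists delta; split; [exact Hd |]. intros w; rewrite !E; apply K. }
    apply continuous_on_closed_disk; split.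
    + apply (T FA CA). intros z; rewrite pa_mkB, pa_emb; reflexivity.
    + apply (T FB CB). intros z; rewrite pb_mkB, pa_emb; reflexivity.
  - intros zeta Hz. destruct (disk_inv zeta Hz) as [z [-> Hz1]].
    rewrite pa_emb, EA, EB by exact Hz1.
    apply B_ext; rewrite ?pa_mkB, ?pb_mkB; reflexivity.
Qed.

(** * Boundary values of the candidates *)

Lemma radial_limit_Re (F : C -> C) (s v : R) :
  ccont_disc F ->
  (forall eps, 0 < eps -> exists delta, 0 < delta < 1 /\ forall r, 1 - delta < r < 1 ->
     Rabs (Re (F (RtoC r * cis s)%C) - v) <= eps) -> Re (F (cis s)) = v.
Proof.
  intros Hc H. apply Rminus_diag_uniq, Rabs_eq_0, Rle_antisym; [| apply Rabs_pos].
  apply le_epsilon; intros eps He; rewrite Rplus_0_l.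
  destruct (H (eps / 2) ltac:(lra)) as [d1 [P1 K1]].
  destruct (Hc (cis s) ltac:(rewrite Cmod_cis; lra) (eps / 2) ltac:(lra)) as [d2 [P2 K2]].
  set (d := Rmin d1 d2). assert (M1 : d <= d1) by apply Rmin_l.
  assert (M2 : d <= d2) by apply Rmin_r. assert (P : 0 < d) by (apply Rmin_pos; lra).
  set (r := 1 - d / 2).
  specialize (K1 r ltac:(unfold r; lra)).
  specialize (K2 (RtoC r * cis s)%C).
  rewrite Cmod_r_cis in K2 by (unfold r; lra).
  specialize (K2 ltac:(unfold r; lra)).
  assert (Q : Cmod (RtoC r * cis s - cis s) < d2).
  { replace (RtoC r * cis s - cis s)%C with (RtoC (r - 1) * cis s)%C
      by (rewrite RtoC_minus; ring).
    rewrite Cmod_mult, Cmod_cis, Cmod_R, Rabs_left; unfold r; lra. }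
  specialize (K2 Q).
  assert (L := re_le_Cmod (F (RtoC r * cis s)%C - F (cis s))%C).
  change (Re (F (RtoC r * cis s)%C - F (cis s))%C)
    with (Re (F (RtoC r * cis s)%C) - Re (F (cis s))) in L.
  replace (Re (F (cis s)) - v) with (- (Re (F (RtoC r * cis s)%C) - Re (F (cis s)))
     + (Re (F (RtoC r * cis s)%C) - v)) by ring.
  eapply Rle_trans; [apply Rabs_triang |]. rewrite Rabs_Ropp. lra.
Qed.

(** [moment1] and [moment2] are the J2 and J3 of the overview: dt = i t ds raises the exponents -2
    and -3 of the contour integrals by one. *)
Definition moment1 (u : B -> R) : C := cmean u (fun s => / cis s)%C.
Definition moment2 (u : B -> R) : C := cmean u (fun s => / (cis s * cis s))%C.

Lemma Re_plus (a b : C) : Re (a + b)%C = Re a + Re b.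
Proof. reflexivity. Qed.
Lemma Re_opp (a : C) : Re (- a)%C = - Re a.
Proof. reflexivity. Qed.

(** At r = 1, with t = cis s, the sum is J conj t minus its own conjugate, hence purely imaginary;
    inside the disk the deviation is measured by 1 / r - r. *)
Lemma Re_cancel_pole (J : C) (r s : R) : 0 < r ->
  Re (J / (RtoC r * cis s) + - Cconj J * (RtoC r * cis s))%C
  = (/ r - r) * Re (J * Cconj (cis s))%C.
Proof.
  intros Hr. assert (N := cis_neq_0 s).
  assert (N1 : RtoC r <> 0) by (intros K; apply RtoC_inj in K; lra).
  replace (J / (RtoC r * cis s))%C with (RtoC (/ r) * (J * Cconj (cis s)))%C
    by (rewrite cis_conj, RtoC_inv by lra; field; split; assumption).
  destruct J as [p q]. simpl. ring.
Qed.

Lemma Re_pb_solution_lim (u1 u4 : B -> R) (c : C) (b : R) (s eps : R) :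
  dini disk u1 -> dini disk u4 ->
  c = (- Cconj (moment1 u1 - moment1 u4))%C -> b = - Re (moment2 u1 - moment2 u4)%C ->
  0 < eps -> exists delta, 0 < delta < 1 /\ forall r, 1 - delta < r < 1 ->
    Rabs (Re (pb (S_disk u1 (emb (RtoC r * cis s))) + - (1) * pb (S_disk u4 (emb (RtoC r * cis s)))
              + c * (RtoC r * cis s) + RtoC b)%C) <= eps.
Proof.
  intros H1 H4 Ec Eb He.
  destruct (rho_term_small u1 (eps / 3) H1 ltac:(lra)) as [d1 [P1 K1]].
  destruct (rho_term_small u4 (eps / 3) H4 ltac:(lra)) as [d4 [P4 K4]].
  set (J := (moment1 u1 - moment1 u4)%C).
  set (M := Cmod J + 1). assert (PM : 0 < M) by (unfold M; generalize (Cmod_ge_0 J); lra).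
  (* For r >= 1 / 2 the factor 1 / r - r = (1 - r) (1 + r) / r is at most 4 d, and 4 d M <= eps / 3
     by the last bound. The two rho-terms account for the other two thirds. *)
  set (d := Rmin (Rmin d1 d4) (Rmin (1 / 2) (eps / (12 * M)))).
  assert (PE : 0 < eps / (12 * M)) by (apply Rdiv_lt_0_compat; lra).
  assert (Q1 : d <= Rmin d1 d4) by apply Rmin_l.
  assert (Q2 : d <= Rmin (1 / 2) (eps / (12 * M))) by apply Rmin_r.
  assert (Q3 := Rmin_l d1 d4). assert (Q4 := Rmin_r d1 d4).
  assert (Q5 := Rmin_l (1 / 2) (eps / (12 * M))). assert (Q6 := Rmin_r (1 / 2) (eps / (12 * M))).
  assert (P : 0 < d) by (repeat apply Rmin_pos; lra).
  exists d; split; [lra |]. intros r Hr.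
  specialize (K1 r s ltac:(lra)). specialize (K4 r s ltac:(lra)). cbv beta in K1, K4.
  set (z := (RtoC r * cis s)%C) in *.
  assert (Mz : Cmod z = r) by (apply Cmod_r_cis; lra).
  assert (Hz0 : z <> 0) by (apply Cmod_gt_0; lra).
  rewrite !pb_S_disk by (assumption || lra).
  set (T1 := (- (RtoC (1 - Cmod z ^ 2) / (2 * z) * cmean u1 (dschwarz_ker z)))%C) in *.
  set (T4 := (- (RtoC (1 - Cmod z ^ 2) / (2 * z) * cmean u4 (dschwarz_ker z)))%C) in *.
  match goal with |- Rabs (Re ?x) <= _ =>
    replace x with ((moment2 u1 - moment2 u4 + RtoC b)
                    + (J / z + - Cconj J * z) + (T1 + - T4))%C end.
  - rewrite (Re_plus (_ + _)%C (T1 + - T4)%C), (Re_plus (_ + RtoC b)%C).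
    unfold z at 1 2. rewrite Re_cancel_pole by lra.
    rewrite (Re_plus T1), (Re_plus (moment2 u1 - moment2 u4)%C).
    replace (Re (moment2 u1 - moment2 u4)%C + Re (RtoC b)) with 0 by (rewrite Eb; simpl; ring).
    assert (X : Rabs ((/ r - r) * Re (J * Cconj (cis s))%C) <= eps / 3).
    { rewrite Rabs_mult.
      assert (B1 : Rabs (Re (J * Cconj (cis s))%C) <= M).
      { eapply Rle_trans; [apply re_le_Cmod |]. rewrite Cmod_mult, Cmod_conj, Cmod_cis.
        unfold M; lra. }
      assert (B2 : Rabs (/ r - r) <= 4 * d).
      { assert (E : / r - r = (1 - r) * ((1 + r) / r)) by (field; lra).
        assert (F : 0 <= (1 + r) / r <= 4).
        { split; [apply Rdiv_le_0_compat; lra |].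
          apply (Rmult_le_reg_r r); [lra |].
          replace ((1 + r) / r * r) with (1 + r) by (field; lra). lra. }
        rewrite E, Rabs_mult, !Rabs_pos_eq by lra.
        apply Rle_trans with (d * 4); [| lra]. apply Rmult_le_compat; lra. }
      apply Rle_trans with (4 * d * M).
      - apply Rmult_le_compat; try apply Rabs_pos; assumption.
      - assert (d * (12 * M) <= eps).
        { apply Rle_trans with (eps / (12 * M) * (12 * M)).
          - apply Rmult_le_compat_r; lra.
          - apply Req_le; field; lra. }
        lra. }
    assert (Y : Rabs (Re T1 + Re (- T4)%C) <= eps / 3 + eps / 3).
    { eapply Rle_trans; [apply Rabs_triang |]. rewrite Re_opp, Rabs_Ropp.
      apply Rplus_le_compat; (eapply Rle_trans; [apply re_le_Cmod | assumption]). }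
    eapply Rle_trans; [apply Rabs_triang |].
    eapply Rle_trans; [apply Rplus_le_compat_r, Rabs_triang |].
    rewrite Rabs_R0. lra.
  - rewrite Ec. fold J. unfold T1, T4, J, moment1, moment2. field. exact Hz0.
Qed.

(** The values on the circle are computed along radii, where Phi is the explicit formula. The
    constants a1 and a2 enter both coordinates only through imaginary terms, so they do not affect
    the data. *)
Lemma solution_boundary (u1 u4 : B -> R) (c : C) (b a1 a2 : R) (Phi : B -> B) :
  dini disk u1 -> dini disk u4 ->
  c = (- Cconj (moment1 u1 - moment1 u4))%C -> b = - Re (moment2 u1 - moment2 u4)%C ->
  continuous_on (closure disk) Phi ->
  (forall zeta, disk zeta -> Phi zeta = solution u1 u4 c b a1 a2 zeta) ->
  problem14 disk u1 u4 Phi.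
Proof.
  intros H1 H4 Ec Eb Hc Hf.
  assert (Hf' : forall z, Cmod z < 1 -> Phi (emb z) = solution u1 u4 c b a1 a2 (emb z)).
  { intros z Hz; apply Hf, disk_emb, Hz. }
  split; [exact Hc |]. split.
  { apply monogenic_iff. intros z Hz.
    destruct (solution_quotient_lim u1 u4 c b a1 a2 z H1 H4 Hz) as [d Hd].
    exists d. apply (quotient_lim_ext (solution u1 u4 c b a1 a2)); [exact Hz | | exact Hd].
    intros w Hw; symmetry; apply Hf', Hw. }
  destruct (proj1 (continuous_on_closed_disk Phi) Hc) as [CA CB].
  intros zeta Hz. destruct (boundary_disk_inv zeta Hz) as [z [-> Hz1]].
  destruct (polar_unit z Hz1) as [s ->].
  assert (EA : Re (pa (Phi (emb (cis s)))) = bval u1 s - bval u4 s).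
  { apply (radial_limit_Re (fun z => pa (Phi (emb z)))); [exact CA |]. intros eps He.
    destruct (Re_schwarz_lim u1 (eps / 2) H1 ltac:(lra)) as [d1 [P1 K1]].
    destruct (Re_schwarz_lim u4 (eps / 2) H4 ltac:(lra)) as [d4 [P4 K4]].
    exists (Rmin d1 d4). assert (M1 := Rmin_l d1 d4). assert (M4 := Rmin_r d1 d4).
    split; [split; [apply Rmin_pos; lra | lra] |]. intros r Hr.
    specialize (K1 r s ltac:(lra)). specialize (K4 r s ltac:(lra)).
    assert (Mz : Cmod (RtoC r * cis s) < 1) by (rewrite Cmod_r_cis; lra).
    rewrite Hf', pa_solution, !pa_S_disk by assumption.
    match goal with |- Rabs ?x <= _ => replace x with
      ((Re (cmean u1 (schwarz_ker (RtoC r * cis s))) - bval u1 s)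
       + - (Re (cmean u4 (schwarz_ker (RtoC r * cis s))) - bval u4 s)) by (simpl; ring) end.
    eapply Rle_trans; [apply Rabs_triang |]. rewrite Rabs_Ropp. lra. }
  assert (EB : Re (pb (Phi (emb (cis s)))) = bval u4 s).
  { apply (radial_limit_Re (fun z => pb (Phi (emb z)))); [exact CB |]. intros eps He.
    destruct (Re_pb_solution_lim u1 u4 c b s (eps / 2) H1 H4 Ec Eb ltac:(lra)) as [d1 [P1 K1]].
    destruct (Re_schwarz_lim u4 (eps / 2) H4 ltac:(lra)) as [d4 [P4 K4]].
    exists (Rmin d1 d4). assert (M1 := Rmin_l d1 d4). assert (M4 := Rmin_r d1 d4).
    split; [split; [apply Rmin_pos; lra | lra] |]. intros r Hr.
    specialize (K1 r ltac:(lra)). specialize (K4 r s ltac:(lra)).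
    assert (Mz : Cmod (RtoC r * cis s) < 1) by (rewrite Cmod_r_cis; lra).
    rewrite Hf', pb_solution, (pa_S_disk u4) by assumption.
    match type of K1 with Rabs (Re ?y) <= _ => match goal with |- Rabs ?x <= _ => replace x with
      (Re y + (Re (cmean u4 (schwarz_ker (RtoC r * cis s))) - bval u4 s)) by (simpl; ring) end end.
    eapply Rle_trans; [apply Rabs_triang |]. lra. }
  unfold U1, U4.
  split.
  - rewrite fst_pa_pb, Re_plus, EA, EB. unfold bval; ring.
  - rewrite snd_pb.
    transitivity (Re (pb (Phi (emb (cis s))))); [| exact EB].
    generalize (pb (Phi (emb (cis s)))); intros [x y]; simpl; ring.
Qed.

(** * Uniqueness, and the constants of the theorem *)

Lemma solution_unique (u1 u4 : B -> R) (c : C) (b : R) (Phi Phi0 : B -> B) :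
  problem14 disk u1 u4 Phi -> problem14 disk u1 u4 Phi0 ->
  (forall zeta, disk zeta -> Phi0 zeta = solution u1 u4 c b 0 0 zeta) ->
  exists a1 a2 : R, forall zeta, disk zeta -> Phi zeta = solution u1 u4 c b a1 a2 zeta.
Proof.
  intros [C1 [M1 B1]] [C0 [M0 B0]] E0.
  destruct (proj1 (continuous_on_closed_disk _) C1) as [CA1 CB1].
  destruct (proj1 (continuous_on_closed_disk _) C0) as [CA0 CB0].
  set (Psi := fun zeta => (Phi zeta - Phi0 zeta)%B).
  assert (Dif : forall F G : C -> C, ccont_disc F -> ccont_disc G ->
     ccont_disc (fun z => F z - G z)%C).
  { intros F G HF HG z Hz eps He.
    destruct (HF z Hz (eps / 2) ltac:(lra)) as [d1 [P1 K1]].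
    destruct (HG z Hz (eps / 2) ltac:(lra)) as [d2 [P2 K2]].
    exists (Rmin d1 d2); split; [apply Rmin_pos; assumption |]. intros w Hw Bw.
    specialize (K1 w Hw (Rlt_le_trans _ _ _ Bw (Rmin_l _ _))).
    specialize (K2 w Hw (Rlt_le_trans _ _ _ Bw (Rmin_r _ _))).
    replace (F w - G w - (F z - G z))%C with ((F w - F z) + - (G w - G z))%C by ring.
    eapply Rle_lt_trans; [apply Cmod_triangle |]. rewrite Cmod_opp. lra. }
  assert (T : forall F, ccont_disc F -> forall G, (forall z, G z = F z) -> ccont_disc G).
  { intros F HF G E z Hz eps He. destruct (HF z Hz eps He) as [delta [Hd K]].
    exists delta; split; [exact Hd |]. intros w; rewrite !E; apply K. }
  assert (CA : ccont_disc (fun z => pa (Psi (emb z)))).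
  { apply (T _ (Dif _ _ CA1 CA0)). intros z; apply pa_minus. }
  assert (CB : ccont_disc (fun z => pb (Psi (emb z)))).
  { apply (T _ (Dif _ _ CB1 CB0)). intros z; apply pb_minus. }
  assert (Q : forall z, Cmod z < 1 -> exists d, quotient_lim Psi z d).
  { intros z Hz.
    destruct (proj1 (monogenic_iff _) M1 z Hz) as [d1 D1].
    destruct (proj1 (monogenic_iff _) M0 z Hz) as [d0 D0].
    exists (d1 - d0)%B. apply quotient_lim_minus; assumption. }
  assert (BV : forall z, Cmod z = 1 ->
     Re (pa (Psi (emb z))) = 0 /\ Re (pb (Psi (emb z))) = 0).
  { intros z Hz. assert (Hb := proj2 (boundary_disk_emb z) Hz).
    destruct (B1 _ Hb) as [V1 V4]. destruct (B0 _ Hb) as [W1 W4].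
    unfold U1, U4 in *. rewrite fst_pa_pb in V1, W1. rewrite snd_pb in V4, W4.
    unfold Psi. rewrite pa_minus, pb_minus.
    destruct (pa (Phi (emb z))), (pa (Phi0 (emb z))), (pb (Phi (emb z))), (pb (Phi0 (emb z))).
    simpl in *. lra. }
  destruct (zero_Re_constant _ CA) as [p Hp].
  { intros z Hz. destruct (Q z Hz) as [d Hd]. exists (pa d). apply quotient_lim_pa, Hd. }
  { intros z Hz; apply BV, Hz. }
  destruct (zero_Re_constant _ CB) as [q Hq].
  { intros z Hz. destruct (Q z Hz) as [d Hd]. exists (pb d).
    apply quotient_lim_pb; [exact Hz | | exact Hd].
    intros w Hw. rewrite !Hp by assumption; reflexivity. }
  { intros z Hz; apply BV, Hz. }
  (* The difference of the two solutions has coordinates i p and i q, while a1 and a2 contribute i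
     (a1 + a2) and - i a2. *)
  exists (p + q), (- q). intros zeta Hz.
  destruct (disk_inv zeta Hz) as [z [-> Hz1]].
  specialize (Hp z Hz1). specialize (Hq z Hz1). unfold Psi in Hp, Hq.
  rewrite pa_minus in Hp. rewrite pb_minus in Hq.
  rewrite (E0 _ Hz) in Hp, Hq.
  apply B_ext.
  - transitivity (pa (Phi (emb z)) - pa (solution u1 u4 c b 0 0 (emb z))
      + pa (solution u1 u4 c b 0 0 (emb z)))%C; [ring |].
    rewrite Hp, !pa_solution, !RtoC_plus, RtoC_opp. ring.
  - transitivity (pb (Phi (emb z)) - pb (solution u1 u4 c b 0 0 (emb z))
      + pb (solution u1 u4 c b 0 0 (emb z)))%C; [ring |].
    rewrite Hq, !pb_solution, RtoC_opp. ring.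
Qed.

Lemma Ccircle_int_moment (u1 u4 : B -> R) (n : nat) (k : R -> C) :
  dini disk u1 -> dini disk u4 -> (forall s, ccont k s) ->
  (forall s, (cis s / cis s ^ n)%C = k s) ->
  Ccircle_int (fun t => (RtoC (hat u1 t - hat u4 t) / t ^ n)%C)
  = (Ci * (RtoC (2 * PI) * (cmean u1 k - cmean u4 k)))%C.
Proof.
  intros H1 H4 Hk Ek. unfold cmean.
  assert (N := RtoC_2PI_neq_0).
  transitivity (Ci * (CRInt (fun s => RtoC (bval u1 s) * k s)%C 0 (2 * PI)
     - CRInt (fun s => RtoC (bval u4 s) * k s)%C 0 (2 * PI)))%C.
  - rewrite <- CRInt_minus by (apply ex_bval; assumption).
    rewrite <- CRInt_Cmult.
    + apply CRInt_ext; intros s _. rewrite <- Ek.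
      change (hat u1 (cos s, sin s)) with (bval u1 s).
      change (hat u4 (cos s, sin s)) with (bval u4 s).
      change (cos s, sin s) with (cis s).
      replace ((- sin s)%R, cos s) with (Ci * cis s)%C
        by (unfold cis; apply injective_projections; simpl; ring).
      rewrite RtoC_minus. unfold Cdiv. ring.
    + apply (ex_RInt_minus (V := C_R_NormedModule)); apply ex_bval; assumption.
  - field. exact N.
Qed.

Theorem theorem4 (u1 u4 : B -> R) (H1 : dini disk u1) (H4 : dini disk u4) :
  let I2 : C := Ccircle_int (fun t => (RtoC (hat u1 t - hat u4 t) / t ^ 2)%C) in
  let I3 : C := Ccircle_int (fun t => (RtoC (hat u1 t - hat u4 t) / t ^ 3)%C) in
  let b1 : R := - / (2 * PI) * Im I2 in
  let b2 : R := - / (2 * PI) * Re I2 in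
  let b : R := - / (2 * PI) * Im I3 in
  let formula (a1 a2 : R) (zeta : B) : B :=
    (S_disk u1 zeta * e1 + S_disk u4 zeta * (Ci *: e2)
     + ((RtoC b1 + Ci * RtoC b2)%C *: zeta + RtoC b *: e1) * (e1 + Ci *: e2)
     + RtoC a1 *: (Ci *: e1) + RtoC a2 *: e2)%B in
  (* each member of the family extends continuously to the closed disk *)
  (forall a1 a2 : R, exists Phi : B -> B,
     continuous_on (closure disk) Phi /\
     (forall zeta, disk zeta -> Phi zeta = formula a1 a2 zeta)) /\
  (forall Phi : B -> B,
     problem14 disk u1 u4 Phi <->
     exists a1 a2 : R,
       continuous_on (closure disk) Phi /\
       (forall zeta, disk zeta -> Phi zeta = formula a1 a2 zeta)).
Proof.
  intros I2 I3 b1 b2 b formula.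
  set (c := (RtoC b1 + Ci * RtoC b2)%C).
  assert (Hpi := PI_RGT_0).
  assert (C1 : forall s, ccont (fun s => / cis s)%C s).
  { intros s; apply continuous_Cinv; [apply continuous_cis | apply cis_neq_0]. }
  assert (C2 : forall s, ccont (fun s => / (cis s * cis s))%C s).
  { intros s; apply continuous_Cinv; [apply continuous_Cmult; apply continuous_cis |].
    apply Cmult_neq_0; apply cis_neq_0. }
  (* With p + i q the difference of the first moments, I2 = 2 pi (- q + i p); hence b1 = - p and b2
     = q. *)
  assert (Ec : c = (- Cconj (moment1 u1 - moment1 u4))%C).
  { unfold c, b1, b2, I2.
    rewrite (Ccircle_int_moment u1 u4 2 (fun s => / cis s)%C H1 H4 C1)
      by (intros s; simpl; field; apply cis_neq_0).
    fold (moment1 u1) (moment1 u4). destruct (moment1 u1 - moment1 u4)%C as [p q].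
    apply injective_projections; simpl; field; lra. }
  assert (Eb : b = - Re (moment2 u1 - moment2 u4)%C).
  { unfold b, I3.
    rewrite (Ccircle_int_moment u1 u4 3 (fun s => / (cis s * cis s))%C H1 H4 C2)
      by (intros s; simpl; field; apply cis_neq_0).
    fold (moment2 u1) (moment2 u4). destruct (moment2 u1 - moment2 u4)%C as [p q].
    simpl; field; lra. }
  change formula with (solution u1 u4 c b). clear formula.
  split; [intros a1 a2; apply solution_extension; assumption |].
  intros Phi; split.
  - intros HP.
    (* The member with a1 = a2 = 0 serves as the reference solution from which any other differs by
       constants. *)
    destruct (solution_extension u1 u4 c b 0 0 H1 H4) as [Phi0 [K0 E0]].
    destruct (solution_unique u1 u4 c b Phi Phi0 HP) as [a1 [a2 E]].
    + apply (solution_boundary u1 u4 c b 0 0); assumption.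
    + exact E0.
    + exists a1, a2; split; [apply HP | exact E].
  - intros [a1 [a2 [K E]]]. apply (solution_boundary u1 u4 c b a1 a2); assumption.
Qed.
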